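(* Let $c\in\mathbb R$, let $U\subset\mathbb R^2$ be a domain, and let $f:U\to M^3_1(c)$ be a time-like immersion with constant mean curvature. Let $p\in U$ be an umbilic of $f$, and suppose that the Hopf differential $Q_f$ of $f$ is of finite type at $p$ and is non-degenerate at $p$. Then the order $m\ge 1$ of $Q_f$ at $p$ is well defined (it does not depend on the choice of the isothermal coordinate system centered at $p$). If $p$ is an isolated umbilic, then $m$ is even. Moreover, in this case (i.e. if $p$ is an isolated umbilic), there exists a smooth curvature line flow of $f$ around $p$ with index $1$ or $-1$ at $p$ if and only if $m$ is even but not divisible by $4$.
   Context: All maps are $C^\infty$ unless stated otherwise. $M^3_1(c)$ denotes the Lorentzian 3-dimensional space form of signature $(++-)$ and constant sectional curvature $c$: the Lorentz-Minkowski space $\mathbb R^3_1$ if $c=0$; the de Sitter 3-space $\{x\in\mathbb R^4_1:\langle x,x\rangle=1/c\}$ if $c>0$; the anti-de Sitter 3-space $\{x\in\mathbb R^4_2:\langle x,x\rangle=1/c\}$ if $c<0$ (here $\mathbb R^4_1$, $\mathbb R^4_2$ have signatures $(+++-)$, $(++--)$). An immersion is time-like if its induced metric is Lorentzian. The principal curvatures are the two (possibly non-real or coinciding) eigenvalues of the shape operator; the mean curvature is half of its trace. Umbilics: $p$ is an umbilic if the shape operator at $p$ is a scalar multiple of the identity. An umbilic $p$ is isolated if there is a neighborhood $U_1\subset U$ of $p$ on which the principal curvatures are real-valued and which contains no umbilics other than $p$. Curvature line flow: a (smooth) curvature line flow of $f$ around an isolated umbilic $p$ is a smooth one-dimensional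 foliation (direction field) on a punctured neighborhood of $p$ whose leaves are curvature lines, i.e. are tangent at each point to an eigendirection of the shape operator. Its index at $p$ is the usual index of a direction field at an isolated singularity. Hopf differential: around any point there are isothermal coordinates $(u,v)$, in which the first fundamental form is $ds^2=e^{2\sigma}(du^2-dv^2)$ with $\sigma$ smooth. Let $\nu$ be a unit normal field, $\nabla$ the Levi-Civita connection of $M^3_1(c)$, and $L=\langle\nabla_u f_u,\nu\rangle$, $M=\langle\nabla_u f_v,\nu\rangle$, $N=\langle\nabla_v f_v,\nu\rangle$. Let $\check{\mathbb C}=\{u+jv: u,v\in\mathbb R\}$, $j^2=1$, be the paracomplex numbers, $z=u+jv$, $\epsilon_1=(1+j)/2$, $\epsilon_{-1}=(1-j)/2$. Put $\hat Q_f:=L+N+2jM$ and $Q_f:=\hat Q_f\,dz^2$, the Hopf differential of $f$. When $f$ has constant mean curvature, $\hat Q_f$ is para-holomorphic in $z$, and in isothermal coordinates centered at $p$ (so $p$ corresponds to $o=(0,0)$) one can write near $o$ $$\hat Q_f(z)=\epsilon_1\phi_1(x)+\epsilon_{-1}\phi_{-1}(y),\qquad x=\tfrac{u+v}{2},\quad y=\tfrac{u-v}{2},$$ with $\phi_1,\phi_{-1}$ smooth real functions of one variable. Finite type: $Q_f$ is of finite type at $p$ if, for each $s\in\{1,-1\}$, either $\phi_s$ vanishes identically as a function germ at $0$ (then put $m_s:=\infty$), or there is a non-negative integer $m_s$ such that the derivative of order $m_s$ of $\phi_s$ at $0$ is the first non-vanishing one (including order $0$). The numbers $m_1,m_{-1}\in\{0,1,2,\dots\}\cup\{\infty\}$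 are the split-orders of $Q_f$ at $p$. If $m_1,m_{-1}$ are finite then $\phi_1(x)=x^{m_1}\psi_1(x)$ and $\phi_{-1}(y)=y^{m_{-1}}\psi_{-1}(y)$ with $\psi_{\pm1}$ smooth, $\psi_1(0)\neq0$, $\psi_{-1}(0)\ne0$. Non-degenerate: $Q_f$ (of finite type at $p$) is non-degenerate at $p$ if $m_1$ and $m_{-1}$ are finite and $m_1=m_{-1}$; the common value $m:=m_1=m_{-1}$ is the order of $Q_f$ at $p$. *)

(* Defs.v *)
(* Stdlib real numbers, with Coquelicot for derivatives and topology. *)
From Stdlib Require Import Reals.
From Coquelicot Require Import Coquelicot.
Open Scope R_scope.

(** * The plane: domains and smoothness *)

Definition connected_set (U : R * R -> Prop) : Prop :=
  forall A B : R * R -> Prop, open A -> open B ->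
    (forall q, U q -> A q \/ B q) ->
    (exists q, U q /\ A q) -> (exists q, U q /\ B q) ->
    exists q, U q /\ A q /\ B q.

Definition plane_domain (U : R * R -> Prop) : Prop :=
  open U /\ (exists q, U q) /\ connected_set U.

(* C^infinity on a set, meant for open sets: all iterated partial derivatives
   exist and are continuous at every point. *)
Definition smooth_on (U : R * R -> Prop) (f : R * R -> R) : Prop :=
  forall q, U q ->
    forall k : nat, ex_diff_n (fun u v => f (u, v)) k (fst q) (snd q).

Definition smooth_plane_map_on (U : R * R -> Prop) (g : R * R -> R * R) : Prop :=
  smooth_on U (fun q => fst (g q)) /\ smooth_on U (fun q => snd (g q)).

Definition smooth_germ (phi : R -> R) : Prop :=
  locally 0 (fun x => forall k : nat, ex_derive_n phi k x).

(** * The Lorentzian space forms M^3_1(c) *)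

(* R^3_1 for c = 0, R^4_1 for c > 0, R^4_2 for c < 0, with the negative
   directions last. *)
Definition ambient_dim (c : R) : nat := if Req_EM_T c 0 then 3 else 4.

Definition num_positive (c : R) : nat := if Rlt_dec 0 c then 3 else 2.

Definition ambient (c : R) : Type := Tn (ambient_dim c) R.

Definition coord {c : R} (x : ambient c) (i : nat) : R := coeff_Tn 0 x i.

Definition signature_sign (c : R) (i : nat) : R :=
  if (i <? num_positive c)%nat then 1 else -1.

(* [sum_f_R0 _ k] has k + 1 terms. *)
Definition inner {c : R} (x y : ambient c) : R :=
  sum_f_R0 (fun i => signature_sign c i * (coord x i * coord y i))
           (pred (ambient_dim c)).

Definition in_space_form {c : R} (x : ambient c) : Prop :=
  c <> 0 -> inner x x = 1 / c.

Definition tangent_to_space_form {c : R} (x w : ambient c) : Prop :=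
  c <> 0 -> inner x w = 0.

(* Orthogonal projection of w onto the tangent space of M^3_1(c) at x, using
   <x, x> = 1/c; it is the identity for c = 0.  Applied to the flat derivative
   in the ambient space, it yields the Levi-Civita connection of M^3_1(c). *)
Definition tangent_part {c : R} (x w : ambient c) : ambient c :=
  mk_Tn (ambient_dim c) (fun i => coord w i - c * inner w x * coord x i).

(** * Surfaces *)

Definition smooth_map_on {c : R} (U : R * R -> Prop) (f : R * R -> ambient c)
  : Prop :=
  forall i : nat, (i < ambient_dim c)%nat -> smooth_on U (fun q => coord (f q) i).

Definition d_u {c : R} (f : R * R -> ambient c) (q : R * R) : ambient c :=
  mk_Tn (ambient_dim c)
    (fun i => Derive (fun t => coord (f (t, snd q)) i) (fst q)).

Definition d_v {c : R} (f : R * R -> ambient c) (q : R * R) : ambient c :=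
  mk_Tn (ambient_dim c)
    (fun i => Derive (fun t => coord (f (fst q, t)) i) (snd q)).

Definition nabla_u {c : R} (f X : R * R -> ambient c) (q : R * R) : ambient c :=
  tangent_part (f q) (d_u X q).

Definition nabla_v {c : R} (f X : R * R -> ambient c) (q : R * R) : ambient c :=
  tangent_part (f q) (d_v X q).

Record mat2 : Type := Mat2 { m11 : R; m12 : R; m21 : R; m22 : R }.

Definition mat2_mul (A B : mat2) : mat2 :=
  Mat2 (m11 A * m11 B + m12 A * m21 B) (m11 A * m12 B + m12 A * m22 B)
       (m21 A * m11 B + m22 A * m21 B) (m21 A * m12 B + m22 A * m22 B).

Definition mat2_det (A : mat2) : R := m11 A * m22 A - m12 A * m21 A.

Definition mat2_inv (A : mat2) : mat2 :=
  Mat2 (m22 A / mat2_det A) (- m12 A / mat2_det A)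
       (- m21 A / mat2_det A) (m11 A / mat2_det A).

Definition mat2_trace (A : mat2) : R := m11 A + m22 A.

Definition mat2_app (A : mat2) (w : R * R) : R * R :=
  (m11 A * fst w + m12 A * snd w, m21 A * fst w + m22 A * snd w).

Definition mat2_form (A : mat2) (w w' : R * R) : R :=
  fst w * fst (mat2_app A w') + snd w * snd (mat2_app A w').

Definition mat2_eigenvalue (A : mat2) (l : C) : Prop :=
  exists a b : C, ~ (a = 0%C /\ b = 0%C) /\
    (RtoC (m11 A) * a + RtoC (m12 A) * b)%C = (l * a)%C /\
    (RtoC (m21 A) * a + RtoC (m22 A) * b)%C = (l * b)%C.

Definition first_form {c : R} (f : R * R -> ambient c) (q : R * R) : mat2 :=
  Mat2 (inner (d_u f q) (d_u f q)) (inner (d_u f q) (d_v f q))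
       (inner (d_v f q) (d_u f q)) (inner (d_v f q) (d_v f q)).

Definition coef_L {c : R} (f nu : R * R -> ambient c) (q : R * R) : R :=
  inner (nabla_u f (d_u f) q) (nu q).
Definition coef_M {c : R} (f nu : R * R -> ambient c) (q : R * R) : R :=
  inner (nabla_u f (d_v f) q) (nu q).
Definition coef_N {c : R} (f nu : R * R -> ambient c) (q : R * R) : R :=
  inner (nabla_v f (d_v f) q) (nu q).

Definition second_form {c : R} (f nu : R * R -> ambient c) (q : R * R) : mat2 :=
  Mat2 (coef_L f nu q) (coef_M f nu q) (coef_M f nu q) (coef_N f nu q).

(* The tangent plane at q is identified with R^2 through (d_u f, d_v f); the
   shape operator is the endomorphism S with I(S w, w') = II(w, w'). *)
Definition shape_operator {c : R} (f nu : R * R -> ambient c) (q : R * R) : mat2 :=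
  mat2_mul (mat2_inv (first_form f q)) (second_form f nu q).

Definition immersion_on {c : R} (U : R * R -> Prop) (f : R * R -> ambient c)
  : Prop :=
  smooth_map_on U f /\
  (forall q, U q -> in_space_form (f q)) /\
  (forall q, U q -> forall a b : R,
     (forall i : nat, (i < ambient_dim c)%nat ->
        a * coord (d_u f q) i + b * coord (d_v f q) i = 0) ->
     a = 0 /\ b = 0).

(* The induced metric has signature (+-) at every point. *)
Definition time_like_on {c : R} (U : R * R -> Prop) (f : R * R -> ambient c)
  : Prop :=
  forall q, U q -> exists e1 e2 : R * R,
    mat2_form (first_form f q) e1 e1 = 1 /\
    mat2_form (first_form f q) e2 e2 = -1 /\
    mat2_form (first_form f q) e1 e2 = 0.

(* The normal of a time-like surface in signature (++-) is space-like, whence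
   <nu, nu> = 1. *)
Definition unit_normal_on {c : R} (U : R * R -> Prop) (f nu : R * R -> ambient c)
  : Prop :=
  smooth_map_on U nu /\
  forall q, U q ->
    tangent_to_space_form (f q) (nu q) /\
    inner (nu q) (nu q) = 1 /\
    inner (d_u f q) (nu q) = 0 /\
    inner (d_v f q) (nu q) = 0.

Definition principal_curvature {c : R} (f nu : R * R -> ambient c) (q : R * R)
  (l : C) : Prop := mat2_eigenvalue (shape_operator f nu q) l.

Definition mean_curvature {c : R} (f nu : R * R -> ambient c) (q : R * R) : R :=
  mat2_trace (shape_operator f nu q) / 2.

Definition constant_mean_curvature_on {c : R} (U : R * R -> Prop)
  (f nu : R * R -> ambient c) : Prop :=
  exists H : R, forall q, U q -> mean_curvature f nu q = H.

Definition umbilic {c : R} (f nu : R * R -> ambient c) (q : R * R) : Prop :=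
  exists k : R, shape_operator f nu q = Mat2 k 0 0 k.

Definition isolated_umbilic {c : R} (U : R * R -> Prop)
  (f nu : R * R -> ambient c) (p : R * R) : Prop :=
  umbilic f nu p /\
  exists U1 : R * R -> Prop,
    open U1 /\ U1 p /\ (forall q, U1 q -> U q) /\
    (forall q, U1 q -> forall l : C, principal_curvature f nu q l -> Im l = 0) /\
    (forall q, U1 q -> umbilic f nu q -> q = p).

(** * Curvature line flows *)

(* D q is the set of vectors of the line of the field at q. *)
Definition smooth_direction_field_on (V : R * R -> Prop)
  (D : R * R -> R * R -> Prop) : Prop :=
  forall q, V q -> exists (W : R * R -> Prop) (X : R * R -> R * R),
    open W /\ W q /\ (forall q', W q' -> V q') /\
    smooth_plane_map_on W X /\
    forall q', W q' ->
      X q' <> (0, 0) /\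
      forall w : R * R,
        D q' w <-> exists t : R, w = (t * fst (X q'), t * snd (X q')).

Definition curvature_line_flow {c : R} (U : R * R -> Prop)
  (f nu : R * R -> ambient c) (p : R * R) (D : R * R -> R * R -> Prop) : Prop :=
  exists V : R * R -> Prop,
    open V /\ V p /\ (forall q, V q -> U q) /\
    smooth_direction_field_on (fun q => V q /\ q <> p) D /\
    forall q, V q -> q <> p -> forall w : R * R, D q w ->
      exists k : R,
        mat2_app (shape_operator f nu q) w = (k * fst w, k * snd w).

(* The total rotation of the field along each small positively oriented circle
   around p is 2 pi d. *)
Definition direction_field_index (D : R * R -> R * R -> Prop) (p : R * R) (d : R)
  : Prop :=
  exists r0 : R, 0 < r0 /\
    forall r : R, 0 < r < r0 ->
      exists theta : R -> R,
        (forall t : R, continuity_pt theta t) /\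
        (forall t : R, 0 <= t <= 2 * PI ->
           D (fst p + r * cos t, snd p + r * sin t)
             (cos (theta t), sin (theta t))) /\
        theta (2 * PI) - theta 0 = 2 * PI * d.

(** * The Hopf differential *)

(* (a, b) stands for a + j b, where j^2 = 1. *)
Definition paracomplex : Type := (R * R)%type.

Definition pc_add (z w : paracomplex) : paracomplex :=
  (fst z + fst w, snd z + snd w).
Definition pc_mul (z w : paracomplex) : paracomplex :=
  (fst z * fst w + snd z * snd w, fst z * snd w + snd z * fst w).
Definition pc_real (a : R) : paracomplex := (a, 0).
Definition pc_j : paracomplex := (0, 1).
Definition pc_eps1 : paracomplex := (1 / 2, 1 / 2).
Definition pc_epsm1 : paracomplex := (1 / 2, - (1 / 2)).

(* A coordinate system (u, v) on a neighborhood V of p in U with (u, v)(p) = o,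
   given by its inverse g : W -> V. *)
Definition coordinates_centered_at (U : R * R -> Prop) (p : R * R)
  (W : R * R -> Prop) (g : R * R -> R * R) : Prop :=
  open W /\ W (0, 0) /\ g (0, 0) = p /\ smooth_plane_map_on W g /\
  exists (V : R * R -> Prop) (h : R * R -> R * R),
    open V /\ (forall q, V q -> U q) /\ smooth_plane_map_on V h /\
    (forall w, W w -> V (g w) /\ h (g w) = w) /\
    (forall q, V q -> W (h q) /\ g (h q) = q).

Definition pull {c : R} (g : R * R -> R * R) (f : R * R -> ambient c)
  : R * R -> ambient c := fun w => f (g w).

Definition isothermal_coordinates_centered_at {c : R} (U : R * R -> Prop)
  (f : R * R -> ambient c) (p : R * R)
  (W : R * R -> Prop) (g : R * R -> R * R) : Prop :=
  coordinates_centered_at U p W g /\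
  exists sigma : R * R -> R, smooth_on W sigma /\
    forall w, W w ->
      first_form (pull g f) w
      = Mat2 (exp (2 * sigma w)) 0 0 (- exp (2 * sigma w)).

(* L + N + 2 j M in the coordinates (u, v) *)
Definition hopf_coefficient {c : R} (f nu : R * R -> ambient c)
  (g : R * R -> R * R) (w : R * R) : paracomplex :=
  pc_add (pc_real (coef_L (pull g f) (pull g nu) w
                   + coef_N (pull g f) (pull g nu) w))
         (pc_mul (pc_mul (pc_real 2) pc_j)
                 (pc_real (coef_M (pull g f) (pull g nu) w))).

Definition hopf_splitting {c : R} (f nu : R * R -> ambient c)
  (g : R * R -> R * R) (phi1 phim1 : R -> R) : Prop :=
  smooth_germ phi1 /\ smooth_germ phim1 /\
  locally ((0, 0) : R * R) (fun w =>
    hopf_coefficient f nu g w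
    = pc_add (pc_mul pc_eps1 (pc_real (phi1 ((fst w + snd w) / 2))))
             (pc_mul pc_epsm1 (pc_real (phim1 ((fst w - snd w) / 2))))).

(* [None] encodes the order infinity, i.e. the zero germ. *)
Definition germ_order (phi : R -> R) (o : option nat) : Prop :=
  match o with
  | Some m => (forall k : nat, (k < m)%nat -> Derive_n phi k 0 = 0) /\
              Derive_n phi m 0 <> 0
  | None => locally 0 (fun x => phi x = 0)
  end.

Definition hopf_split_orders {c : R} (f nu : R * R -> ambient c)
  (g : R * R -> R * R) (o1 om1 : option nat) : Prop :=
  exists phi1 phim1 : R -> R,
    hopf_splitting f nu g phi1 phim1 /\
    germ_order phi1 o1 /\ germ_order phim1 om1.

Definition hopf_finite_type {c : R} (f nu : R * R -> ambient c)
  (g : R * R -> R * R) : Prop :=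
  exists o1 om1 : option nat, hopf_split_orders f nu g o1 om1.

(* Both split-orders are finite and equal to m. *)
Definition hopf_order {c : R} (f nu : R * R -> ambient c)
  (g : R * R -> R * R) (m : nat) : Prop :=
  hopf_split_orders f nu g (Some m) (Some m).

Definition hopf_nondegenerate {c : R} (f nu : R * R -> ambient c)
  (g : R * R -> R * R) : Prop :=
  exists m : nat, hopf_order f nu g m.

(* Main.v *)
Require Import Defs.
From Stdlib Require Import Reals Arith.
From Stdlib Require Import Lra Lia Ranalysis5 ClassicalEpsilon.
From Coquelicot Require Import Coquelicot.
Open Scope R_scope.

(** Null coordinates [x = (u + v) / 2], [y = (u - v) / 2] turn the statement
    into one about two functions of one variable.  In such a null chart the
    first form is [2 E dx dy] and the diagonal entries of the second form are the
    components [phi1 (x)] and [phim1 (y)] of the Hopf differential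
    ([hopf_splitting_null]).  Hence the discriminant of the shape operator is
    [phi1 (x) * phim1 (y)] up to a positive factor, and a vector with components
    [(A, B)] is principal if and only if [phi1 (x) A^2 = phim1 (y) B^2].

    The order does not depend on the chart: a change of null charts preserves the
    isotropic directions, so it acts on [x] and [y] separately, up to exchanging
    them, and [phi (x) dx^2] is pulled back as a quadratic differential
    ([null_order_transfer]).  By Hadamard's lemma [phi1 = x^m psi1] and
    [phim1 = y^m psim1] with smooth units; real principal curvatures
    require [x^m y^m psi1 psim1 >= 0] near the origin, so [m = 2 n] is even and
    the units have equal signs ([isolated_umbilic_signs]).  The principal
    directions are then [(A, B) = (y^n, x^n)] up to positive factors and signs.

    If [n] is odd, the line field spanned by [(y^n, - x^n)] with these factors is
    a smooth flow which is nowhere radial on small circles, so it turns once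
    with the radius and has index one ([flow_of_index_one]).  If [n] is even,
    take any smooth flow: near the axes [A B] is a smooth function whose square
    is [x^(2 n)] (or [y^(2 n)]) times a unit, so [A B] does not change sign there
    ([axis_sign]).  The sign of [A B] is therefore constant along a small
    circle, and the field stays in one pair of opposite quadrants of the
    null coordinates; it avoids an almost constant direction and cannot make
    a full turn in either sense ([no_flow_of_index_one]).

    The index is defined with circles in the given parameters, not in null
    coordinates; the chart enters the last two steps through its differential,
    which is almost constant on small circles. *)

(** * Smooth functions on open sets of the plane *)

Definition D1 (F : R * R -> R) (q : R * R) : R :=
  Derive (fun t => F (t, snd q)) (fst q).

Definition D2 (F : R * R -> R) (q : R * R) : R :=
  Derive (fun t => F (fst q, t)) (snd q).

(** Smoothness on [U] is cut into finite orders, uniformly on [U]: inductions on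
    [k] then differentiate identities that hold on the whole open set. *)
Definition Ck (U : R * R -> Prop) (k : nat) (F : R * R -> R) : Prop :=
  forall q, U q -> ex_diff_n (fun u v => F (u, v)) k (fst q) (snd q).

Lemma continuity_2d_continuous (F : R * R -> R) (q : R * R) :
  continuity_2d_pt (fun u v => F (u, v)) (fst q) (snd q) <-> continuous F q.
Proof.
  destruct q as [x y]; simpl; rewrite continuity_2d_pt_filterlim.
  split; apply filterlim_ext; intros [a b]; reflexivity.
Qed.

Lemma open_locally_2d (U : R * R -> Prop) (P : R * R -> Prop) (q : R * R) :
  open U -> U q -> (forall z, U z -> P z) ->
  locally_2d (fun u v => P (u, v)) (fst q) (snd q).
Proof.
  intros hU hq hP; apply locally_2d_locally.
  destruct q as [x y]; generalize (hU _ hq); apply filter_imp.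
  intros [a b] h; exact (hP _ h).
Qed.

Lemma locally_prod_fst (P : R * R -> Prop) (q : R * R) :
  locally q P -> locally (fst q) (fun t => P (t, snd q)).
Proof.
  destruct q as [x y]; intros [e he]; exists e; intros t ht.
  apply he; split; [exact ht | apply ball_center].
Qed.

Lemma locally_prod_snd (P : R * R -> Prop) (q : R * R) :
  locally q P -> locally (snd q) (fun t => P (fst q, t)).
Proof.
  destruct q as [x y]; intros [e he]; exists e; intros t ht.
  apply he; split; [apply ball_center | exact ht].
Qed.

Lemma Ck_ext (U : R * R -> Prop) (k : nat) (F G : R * R -> R) :
  open U -> (forall q, U q -> F q = G q) -> Ck U k F -> Ck U k G.
Proof.
  intros hU hE hF q hq.
  apply (ex_diff_n_ext_loc (fun u v => F (u, v))); [| now apply hF].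
  now apply (open_locally_2d U (fun z => F z = G z)).
Qed.

Lemma Ck_continuous (U : R * R -> Prop) (k : nat) (F : R * R -> R) (q : R * R) :
  Ck U k F -> U q -> continuous F q.
Proof.
  intros hF hq; apply continuity_2d_continuous; specialize (hF q hq).
  destruct k; exact (proj1 hF).
Qed.

Lemma Ck_S (U : R * R -> Prop) (k : nat) (F : R * R -> R) :
  Ck U (S k) F <->
  ((forall q, U q -> continuous F q) /\
   (forall q, U q -> ex_derive (fun t => F (t, snd q)) (fst q)) /\
   (forall q, U q -> ex_derive (fun t => F (fst q, t)) (snd q)) /\
   Ck U k (D1 F) /\ Ck U k (D2 F)).
Proof.
  split.
  - intros h; repeat split; intros q hq; specialize (h q hq); simpl in h.
    + apply continuity_2d_continuous; tauto.
    + tauto.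
    + tauto.
    + apply h.
    + apply h.
  - intros (h0 & h1 & h2 & h3 & h4) q hq; simpl; repeat split.
    + apply continuity_2d_continuous; auto.
    + auto.
    + auto.
    + exact (h3 q hq).
    + exact (h4 q hq).
Qed.

Lemma Ck_le (U : R * R -> Prop) (k : nat) (F : R * R -> R) :
  Ck U (S k) F -> Ck U k F.
Proof.
  intros h q hq; apply (ex_diff_n_m (S k)); [lia | exact (h q hq)].
Qed.

Lemma Ck_const (U : R * R -> Prop) (k : nat) (a : R) : Ck U k (fun _ => a).
Proof.
  revert a; induction k as [|k IH]; intros a.
  - intros q _; split; [apply continuity_2d_pt_const | exact I].
  - apply Ck_S; repeat split; intros q hq.
    + apply continuous_const.
    + apply ex_derive_const.
    + apply ex_derive_const.
    + apply (ex_diff_n_ext_loc (fun _ _ => 0)); [| exact (IH 0 q hq)].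
      apply locally_2d_forall; intros; unfold D1; now rewrite Derive_const.
    + apply (ex_diff_n_ext_loc (fun _ _ => 0)); [| exact (IH 0 q hq)].
      apply locally_2d_forall; intros; unfold D2; now rewrite Derive_const.
Qed.

Lemma Ck_plus (U : R * R -> Prop) (k : nat) (F G : R * R -> R) :
  open U -> Ck U k F -> Ck U k G -> Ck U k (fun q => F q + G q).
Proof.
  intros hU; revert F G; induction k as [|k IH]; intros F G hF hG.
  - intros q hq; split; [| exact I].
    apply continuity_2d_pt_plus; [apply hF | apply hG]; exact hq.
  - generalize hF hG; intros hF' hG'.
    apply Ck_S in hF as (_ & f1 & f2 & f3 & f4).
    apply Ck_S in hG as (_ & g1 & g2 & g3 & g4).
    apply Ck_S; repeat split; try (intros q hq).
    + apply (continuous_plus F G); eapply Ck_continuous; eassumption.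
    + apply (ex_derive_plus (fun t => F (t, snd q)) (fun t => G (t, snd q))); auto.
    + apply (ex_derive_plus (fun t => F (fst q, t)) (fun t => G (fst q, t))); auto.
    + revert q hq; apply (Ck_ext _ _ (fun q => D1 F q + D1 G q)); auto.
      intros q hq; symmetry; unfold D1.
      rewrite (Derive_plus (fun t => F (t, snd q)) (fun t => G (t, snd q))); auto.
    + revert q hq; apply (Ck_ext _ _ (fun q => D2 F q + D2 G q)); auto.
      intros q hq; symmetry; unfold D2.
      rewrite (Derive_plus (fun t => F (fst q, t)) (fun t => G (fst q, t))); auto.
Qed.

Lemma Ck_mult (U : R * R -> Prop) (k : nat) (F G : R * R -> R) :
  open U -> Ck U k F -> Ck U k G -> Ck U k (fun q => F q * G q).
Proof.
  intros hU; revert F G; induction k as [|k IH]; intros F G hF hG.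
  - intros q hq; split; [| exact I].
    apply continuity_2d_pt_mult; [apply hF | apply hG]; exact hq.
  - generalize hF hG; intros hF' hG'.
    apply Ck_S in hF as (_ & f1 & f2 & f3 & f4).
    apply Ck_S in hG as (_ & g1 & g2 & g3 & g4).
    pose proof (Ck_le _ _ _ hF') as hF0; pose proof (Ck_le _ _ _ hG') as hG0.
    apply Ck_S; repeat split; try (intros q hq).
    + apply (continuous_mult F G); eapply Ck_continuous; eassumption.
    + apply (ex_derive_mult (fun t => F (t, snd q)) (fun t => G (t, snd q))); auto.
    + apply (ex_derive_mult (fun t => F (fst q, t)) (fun t => G (fst q, t))); auto.
    + revert q hq; apply (Ck_ext _ _ (fun q => D1 F q * G q + F q * D1 G q)); auto.
      * intros [a b] hq; symmetry; unfold D1.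
        rewrite (Derive_mult (fun t => F (t, snd (a, b))) (fun t => G (t, snd (a, b))));
          auto.
      * apply Ck_plus; auto.
    + revert q hq; apply (Ck_ext _ _ (fun q => D2 F q * G q + F q * D2 G q)); auto.
      * intros [a b] hq; symmetry; unfold D2.
        rewrite (Derive_mult (fun t => F (fst (a, b), t)) (fun t => G (fst (a, b), t)));
          auto.
      * apply Ck_plus; auto.
Qed.

(** Continuity of the partial derivatives gives a total differential; this is
    the bridge from iterated partial derivatives to the chain rule. *)
Lemma C1_filterdiff (U : R * R -> Prop) (F : R * R -> R) (q : R * R) :
  open U -> Ck U 1 F -> U q ->
  filterdiff F (locally q) (fun e => fst e * D1 F q + snd e * D2 F q).
Proof.
  intros hU hF hq; apply Ck_S in hF as (_ & f1 & f2 & f3 & _).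
  destruct q as [x y].
  apply (filterdiff_ext_lin F
    (fun e : R * R => plus (scal (fst e) (D1 F (x, y))) (scal (snd e) (D2 F (x, y))))).
  2: intros e; reflexivity.
  apply (filterdiff_ext (fun z : R * R => F (fst z, snd z)));
    [intros [a b]; reflexivity |].
  apply (is_derive_filterdiff (fun a b => F (a, b)) x y (fun a b => D1 F (a, b))).
  - generalize (hU _ hq); apply filter_imp; intros z hz.
    apply (Derive_correct (fun t => F (t, snd z))), f1, hz.
  - apply (Derive_correct (fun t => F (x, t))), (f2 (x, y)), hq.
  - apply (continuous_ext (D1 F)); [intros [a b]; reflexivity |].
    eapply Ck_continuous; eassumption.
Qed.

Lemma C1_is_derive_curve (U : R * R -> Prop) (F : R * R -> R) (a b : R -> R)
  (t a' b' : R) :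
  open U -> Ck U 1 F -> U (a t, b t) -> is_derive a t a' -> is_derive b t b' ->
  is_derive (fun s => F (a s, b s)) t
    (D1 F (a t, b t) * a' + D2 F (a t, b t) * b').
Proof.
  intros hU hF hq ha hb; unfold is_derive.
  apply (filterdiff_ext_lin (V := R_NormedModule) (fun s => F (a s, b s))
    (fun e : R => scal e a' * D1 F (a t, b t) + scal e b' * D2 F (a t, b t))).
  2: intros e; unfold scal; simpl; unfold mult; simpl; ring.
  apply (filterdiff_comp'_2 (U := R_NormedModule) (V := R_NormedModule)
           (W := R_NormedModule) a b (fun u v => F (u, v)) t
           (fun e => scal e a') (fun e => scal e b')
           (fun u v => u * D1 F (a t, b t) + v * D2 F (a t, b t)) ha hb).
  apply (filterdiff_ext F); [intros [u v]; reflexivity |].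
  exact (C1_filterdiff U F (a t, b t) hU hF hq).
Qed.

Definition compose (F : R * R -> R) (tau : R * R -> R * R) (w : R * R) : R :=
  F (tau w).

Section Composition.

Context (U W : R * R -> Prop) (tau : R * R -> R * R)
  (hU : open U) (hW : open W) (hWU : forall w, W w -> U (tau w)).

Let tau1 (w : R * R) := fst (tau w).
Let tau2 (w : R * R) := snd (tau w).

Lemma is_derive_compose_1 (F : R * R -> R) (w : R * R) :
  Ck U 1 F -> Ck W 1 tau1 -> Ck W 1 tau2 -> W w ->
  is_derive (fun t => F (tau (t, snd w))) (fst w)
    (D1 F (tau w) * D1 tau1 w + D2 F (tau w) * D1 tau2 w).
Proof.
  intros hF h1 h2 hw; destruct w as [x y]; simpl.
  apply Ck_S in h1 as (_ & h1 & _); apply Ck_S in h2 as (_ & h2 & _).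
  assert (hE : tau (x, y) = (tau1 (x, y), tau2 (x, y))) by apply surjective_pairing.
  rewrite hE.
  apply (is_derive_ext (fun t => F (tau1 (t, y), tau2 (t, y)))).
  - intros t; unfold tau1, tau2; now rewrite <- surjective_pairing.
  - apply (C1_is_derive_curve U F (fun t => tau1 (t, y)) (fun t => tau2 (t, y)));
      auto.
    + rewrite <- hE; apply hWU, hw.
    + apply Derive_correct, (h1 (x, y)), hw.
    + apply Derive_correct, (h2 (x, y)), hw.
Qed.

Lemma is_derive_compose_2 (F : R * R -> R) (w : R * R) :
  Ck U 1 F -> Ck W 1 tau1 -> Ck W 1 tau2 -> W w ->
  is_derive (fun t => F (tau (fst w, t))) (snd w)
    (D1 F (tau w) * D2 tau1 w + D2 F (tau w) * D2 tau2 w).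
Proof.
  intros hF h1 h2 hw; destruct w as [x y]; simpl.
  apply Ck_S in h1 as (_ & _ & h1 & _); apply Ck_S in h2 as (_ & _ & h2 & _).
  assert (hE : tau (x, y) = (tau1 (x, y), tau2 (x, y))) by apply surjective_pairing.
  rewrite hE.
  apply (is_derive_ext (fun t => F (tau1 (x, t), tau2 (x, t)))).
  - intros t; unfold tau1, tau2; now rewrite <- surjective_pairing.
  - apply (C1_is_derive_curve U F (fun t => tau1 (x, t)) (fun t => tau2 (x, t)));
      auto.
    + rewrite <- hE; apply hWU, hw.
    + apply Derive_correct, (h1 (x, y)), hw.
    + apply Derive_correct, (h2 (x, y)), hw.
Qed.

Lemma continuous_pair_components (w : R * R) :
  continuous tau1 w -> continuous tau2 w -> continuous tau w.
Proof.
  intros h1 h2.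
  apply (continuous_ext (fun w => (tau1 w, tau2 w))).
  - intros z; unfold tau1, tau2; now rewrite <- surjective_pairing.
  - apply (continuous_comp_2 tau1 tau2 (fun u v => (u, v)) w h1 h2).
    apply (continuous_ext (fun z => z)); [intros [a b]; reflexivity |].
    apply continuous_id.
Qed.

(** Induction on [k]: the partial derivatives of [F o tau] are sums of products
    of functions [D F o tau] and partial derivatives of [tau], all of order [k]. *)
Lemma Ck_compose (k : nat) (F : R * R -> R) :
  Ck U k F -> Ck W k tau1 -> Ck W k tau2 -> Ck W k (compose F tau).
Proof.
  revert F; induction k as [|k IH]; intros F hF h1 h2.
  - intros w hw; split; [| exact I].
    apply (continuity_2d_continuous (compose F tau)).
    apply (continuous_comp tau F).
    + apply continuous_pair_components; eapply Ck_continuous; eassumption.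
    + apply (Ck_continuous U 0); auto.
  - assert (c1 : forall G V, Ck V (S k) G -> Ck V 1 G).
    { intros G V hG q hq; apply (ex_diff_n_m (S k)); [lia | exact (hG q hq)]. }
    assert (cont : forall q, W q -> continuous (compose F tau) q).
    { intros w hw; apply (continuous_comp tau F).
      + apply continuous_pair_components; eapply Ck_continuous; eassumption.
      + apply (Ck_continuous U (S k)); auto. }
    generalize hF h1 h2; intros hF' h1' h2'.
    apply Ck_S in hF' as (_ & _ & _ & f3 & f4).
    apply Ck_S in h1' as (_ & _ & _ & a3 & a4).
    apply Ck_S in h2' as (_ & _ & _ & b3 & b4).
    pose proof (Ck_le _ _ _ h1) as h1l; pose proof (Ck_le _ _ _ h2) as h2l.
    apply Ck_S; repeat split; auto.
    + intros w hw; eexists; apply is_derive_compose_1; auto.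
    + intros w hw; eexists; apply is_derive_compose_2; auto.
    + apply (Ck_ext _ _ (fun w => compose (D1 F) tau w * D1 tau1 w
                                  + compose (D2 F) tau w * D1 tau2 w)); auto.
      * intros w hw; symmetry; apply is_derive_unique.
        apply is_derive_compose_1; auto.
      * apply Ck_plus; auto; apply Ck_mult; auto.
    + apply (Ck_ext _ _ (fun w => compose (D1 F) tau w * D2 tau1 w
                                  + compose (D2 F) tau w * D2 tau2 w)); auto.
      * intros w hw; symmetry; apply is_derive_unique.
        apply is_derive_compose_2; auto.
      * apply Ck_plus; auto; apply Ck_mult; auto.
Qed.

End Composition.

Lemma smooth_on_Ck (U : R * R -> Prop) (F : R * R -> R) :
  smooth_on U F <-> forall k, Ck U k F.
Proof. split; intros h; [intros k q hq | intros q hq k]; apply h, hq. Qed.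

Lemma smooth_on_continuous (U : R * R -> Prop) (F : R * R -> R) (q : R * R) :
  smooth_on U F -> U q -> continuous F q.
Proof. intros h hq; apply (Ck_continuous U 0); [apply smooth_on_Ck, h | exact hq]. Qed.

Lemma smooth_on_subset (U V : R * R -> Prop) (F : R * R -> R) :
  (forall q, V q -> U q) -> smooth_on U F -> smooth_on V F.
Proof. intros hVU h q hq; apply h, hVU, hq. Qed.

Lemma smooth_on_ext (U : R * R -> Prop) (F G : R * R -> R) :
  open U -> (forall q, U q -> F q = G q) -> smooth_on U F -> smooth_on U G.
Proof.
  rewrite !smooth_on_Ck; intros hU hE h k; apply (Ck_ext U k F G hU hE), h.
Qed.

Lemma smooth_on_D (U : R * R -> Prop) (F : R * R -> R) :
  smooth_on U F <->
  (forall q, U q -> continuous F q) /\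
  (forall q, U q -> ex_derive (fun t => F (t, snd q)) (fst q)) /\
  (forall q, U q -> ex_derive (fun t => F (fst q, t)) (snd q)) /\
  smooth_on U (D1 F) /\ smooth_on U (D2 F).
Proof.
  rewrite !smooth_on_Ck; split.
  - intros h; split; [intros; apply (Ck_continuous U 0); auto |].
    pose proof (h 1%nat) as h1; apply Ck_S in h1.
    split; [apply h1 |]; split; [apply h1 |].
    split; intros k; specialize (h (S k)); apply Ck_S in h; apply h.
  - intros (h0 & h1 & h2 & h3 & h4) [|k].
    + intros q hq; split; [apply continuity_2d_continuous; auto | exact I].
    + apply Ck_S; auto.
Qed.

Lemma smooth_on_D1 (U : R * R -> Prop) (F : R * R -> R) :
  smooth_on U F -> smooth_on U (D1 F).
Proof. intros h; apply smooth_on_D in h; apply h. Qed.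

Lemma smooth_on_D2 (U : R * R -> Prop) (F : R * R -> R) :
  smooth_on U F -> smooth_on U (D2 F).
Proof. intros h; apply smooth_on_D in h; apply h. Qed.

Lemma smooth_on_const (U : R * R -> Prop) (a : R) : smooth_on U (fun _ => a).
Proof. apply smooth_on_Ck; intros k; apply Ck_const. Qed.

Lemma smooth_on_fst (U : R * R -> Prop) : smooth_on U fst.
Proof.
  apply smooth_on_D; repeat split; try (intros q hq).
  - apply continuous_fst.
  - apply ex_derive_id.
  - apply (ex_derive_const (fst q)).
  - intros k; apply (ex_diff_n_ext_loc (fun _ _ => 1)).
    + apply locally_2d_forall; intros; symmetry; apply Derive_id.
    + exact (smooth_on_const U 1 q hq k).
  - intros k; apply (ex_diff_n_ext_loc (fun _ _ => 0)).
    + apply locally_2d_forall; intros; symmetry; apply (Derive_const u).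
    + exact (smooth_on_const U 0 q hq k).
Qed.

Lemma smooth_on_snd (U : R * R -> Prop) : smooth_on U snd.
Proof.
  apply smooth_on_D; repeat split; try (intros q hq).
  - apply continuous_snd.
  - apply (ex_derive_const (snd q)).
  - apply ex_derive_id.
  - intros k; apply (ex_diff_n_ext_loc (fun _ _ => 0)).
    + apply locally_2d_forall; intros; symmetry; apply (Derive_const v).
    + exact (smooth_on_const U 0 q hq k).
  - intros k; apply (ex_diff_n_ext_loc (fun _ _ => 1)).
    + apply locally_2d_forall; intros; symmetry; apply Derive_id.
    + exact (smooth_on_const U 1 q hq k).
Qed.

Lemma smooth_on_plus (U : R * R -> Prop) (F G : R * R -> R) :
  open U -> smooth_on U F -> smooth_on U G -> smooth_on U (fun q => F q + G q).
Proof. rewrite !smooth_on_Ck; intros hU hF hG k; now apply Ck_plus. Qed.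

Lemma smooth_on_mult (U : R * R -> Prop) (F G : R * R -> R) :
  open U -> smooth_on U F -> smooth_on U G -> smooth_on U (fun q => F q * G q).
Proof. rewrite !smooth_on_Ck; intros hU hF hG k; now apply Ck_mult. Qed.

Lemma smooth_on_scal (U : R * R -> Prop) (a : R) (F : R * R -> R) :
  open U -> smooth_on U F -> smooth_on U (fun q => a * F q).
Proof.
  intros hU hF; apply (smooth_on_mult U (fun _ => a)); auto.
  apply smooth_on_const.
Qed.

Lemma smooth_on_minus (U : R * R -> Prop) (F G : R * R -> R) :
  open U -> smooth_on U F -> smooth_on U G -> smooth_on U (fun q => F q - G q).
Proof.
  intros hU hF hG; apply (smooth_on_ext U (fun q => F q + (-1) * G q)); auto.
  - intros; ring.
  - apply smooth_on_plus; auto; apply smooth_on_scal; auto.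
Qed.

Lemma smooth_on_compose (U W : R * R -> Prop) (F : R * R -> R)
  (tau : R * R -> R * R) :
  open U -> open W -> (forall w, W w -> U (tau w)) ->
  smooth_on U F -> smooth_plane_map_on W tau ->
  smooth_on W (fun w => F (tau w)).
Proof.
  intros hU hW hWU hF [h1 h2]; apply smooth_on_Ck; intros k.
  apply (Ck_compose U W tau hU hW hWU k F); now apply smooth_on_Ck.
Qed.

Lemma smooth_plane_map_compose (U W : R * R -> Prop) (G tau : R * R -> R * R) :
  open U -> open W -> (forall w, W w -> U (tau w)) ->
  smooth_plane_map_on U G -> smooth_plane_map_on W tau ->
  smooth_plane_map_on W (fun w => G (tau w)).
Proof.
  intros hU hW hWU [g1 g2] ht; split.
  - now apply (smooth_on_compose U W (fun q => fst (G q))).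
  - now apply (smooth_on_compose U W (fun q => snd (G q))).
Qed.

Lemma smooth_plane_map_subset (U V : R * R -> Prop) (G : R * R -> R * R) :
  (forall q, V q -> U q) -> smooth_plane_map_on U G -> smooth_plane_map_on V G.
Proof. intros h [h1 h2]; split; now apply (smooth_on_subset U V). Qed.

Lemma smooth_plane_map_continuous (W : R * R -> Prop) (tau : R * R -> R * R)
  (w : R * R) : smooth_plane_map_on W tau -> W w -> continuous tau w.
Proof.
  intros [h1 h2] hw; apply (continuous_pair_components tau).
  - now apply (smooth_on_continuous W (fun q => fst (tau q))).
  - now apply (smooth_on_continuous W (fun q => snd (tau q))).
Qed.

Lemma open_preimage (U W : R * R -> Prop) (tau : R * R -> R * R) :
  open U -> open W -> smooth_plane_map_on W tau ->
  open (fun w => W w /\ U (tau w)).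
Proof.
  intros hU hW ht w [hw hUw]; apply filter_and.
  - apply hW, hw.
  - apply (smooth_plane_map_continuous W tau w ht hw), hU, hUw.
Qed.

Lemma is_derive_pull_1 (U W : R * R -> Prop) (F : R * R -> R)
  (tau : R * R -> R * R) (w : R * R) :
  open U -> (forall w, W w -> U (tau w)) ->
  smooth_on U F -> smooth_plane_map_on W tau -> W w ->
  is_derive (fun t => F (tau (t, snd w))) (fst w)
    (D1 F (tau w) * D1 (fun z => fst (tau z)) w
     + D2 F (tau w) * D1 (fun z => snd (tau z)) w).
Proof.
  intros hU hWU hF [h1 h2] hw.
  apply (is_derive_compose_1 U W tau hU hWU F w); auto; now apply smooth_on_Ck.
Qed.

Lemma is_derive_pull_2 (U W : R * R -> Prop) (F : R * R -> R)
  (tau : R * R -> R * R) (w : R * R) :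
  open U -> (forall w, W w -> U (tau w)) ->
  smooth_on U F -> smooth_plane_map_on W tau -> W w ->
  is_derive (fun t => F (tau (fst w, t))) (snd w)
    (D1 F (tau w) * D2 (fun z => fst (tau z)) w
     + D2 F (tau w) * D2 (fun z => snd (tau z)) w).
Proof.
  intros hU hWU hF [h1 h2] hw.
  apply (is_derive_compose_2 U W tau hU hWU F w); auto; now apply smooth_on_Ck.
Qed.

Lemma smooth_on_Schwarz (U : R * R -> Prop) (F : R * R -> R) (q : R * R) :
  open U -> smooth_on U F -> U q -> D1 (D2 F) q = D2 (D1 F) q.
Proof.
  intros hU hF hq; destruct q as [x y].
  pose proof hF as h; apply smooth_on_D in h as (_ & h1 & h2 & h3 & h4).
  pose proof h3 as h; apply smooth_on_D in h as (_ & _ & h6 & _ & h5).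
  pose proof h4 as h; apply smooth_on_D in h as (_ & h8 & _ & h7 & _).
  apply (Schwarz (fun a b => F (a, b)) x y).
  - apply (open_locally_2d U (fun z =>
      ex_derive (fun t => F (t, snd z)) (fst z) /\
      ex_derive (fun t => F (fst z, t)) (snd z) /\
      ex_derive (fun t => D2 F (t, snd z)) (fst z) /\
      ex_derive (fun t => D1 F (fst z, t)) (snd z)) (x, y)); auto.
  - apply (continuity_2d_continuous (D1 (D2 F)) (x, y)).
    now apply (smooth_on_continuous U).
  - apply (continuity_2d_continuous (D2 (D1 F)) (x, y)).
    now apply (smooth_on_continuous U).
Qed.

(** * Smooth germs of one variable *)

Definition smooth_near (d : R) (phi : R -> R) : Prop :=
  forall x, Rabs x < d -> forall k : nat, ex_derive_n phi k x.

Lemma locally_Rabs (P : R -> Prop) :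
  locally 0 P <-> exists r, 0 < r /\ forall x, Rabs x < r -> P x.
Proof.
  split.
  - intros [r h]; exists r; split; [apply cond_pos |]; intros x hx; apply h.
    unfold ball; simpl; unfold AbsRing_ball, abs, minus, plus, opp; simpl.
    now rewrite Ropp_0, Rplus_0_r.
  - intros (r & hr & h); exists (mkposreal r hr); intros x hx; apply h.
    unfold ball in hx; simpl in hx.
    unfold AbsRing_ball, abs, minus, plus, opp in hx; simpl in hx.
    now rewrite Ropp_0, Rplus_0_r in hx.
Qed.

Lemma smooth_germ_near (phi : R -> R) :
  smooth_germ phi <-> exists d, 0 < d /\ smooth_near d phi.
Proof. exact (locally_Rabs (fun x => forall k : nat, ex_derive_n phi k x)). Qed.

Lemma smooth_near_le (d e : R) (phi : R -> R) :
  e <= d -> smooth_near d phi -> smooth_near e phi.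
Proof. intros hed h x hx; apply h; lra. Qed.

Lemma Derive_n_Derive (phi : R -> R) (k : nat) (x : R) :
  Derive_n (Derive phi) k x = Derive_n phi (S k) x.
Proof.
  generalize (Derive_n_comp phi k 1 x); rewrite Nat.add_1_r; now simpl.
Qed.

Lemma smooth_near_Derive (d : R) (phi : R -> R) :
  smooth_near d phi -> smooth_near d (Derive phi).
Proof.
  intros h x hx [|k]; [exact I |].
  apply (ex_derive_ext (Derive_n phi (S k))).
  - intros t; symmetry; apply Derive_n_Derive.
  - exact (h x hx (S (S k))).
Qed.

Lemma smooth_near_Derive_n (d : R) (phi : R -> R) (n : nat) :
  smooth_near d phi -> smooth_near d (Derive_n phi n).
Proof.
  intros h; induction n as [|n IH]; [exact h |].
  now apply smooth_near_Derive.
Qed.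

Lemma open_Rabs_lt (d : R) : open (fun x => Rabs x < d).
Proof.
  apply (open_comp Rabs (fun y => y < d)); [| apply open_lt].
  intros x _; apply continuous_Rabs.
Qed.

Lemma open_strip (d : R) : open (fun q : R * R => Rabs (fst q) < d).
Proof.
  apply (open_comp fst (fun x => Rabs x < d)); [| apply open_Rabs_lt].
  intros x _; apply continuous_fst.
Qed.

Lemma open_strip_snd (d : R) : open (fun q : R * R => Rabs (snd q) < d).
Proof.
  apply (open_comp snd (fun x => Rabs x < d)); [| apply open_Rabs_lt].
  intros x _; apply continuous_snd.
Qed.

Lemma smooth_near_on_strip (d : R) (phi : R -> R) :
  smooth_near d phi ->
  smooth_on (fun q => Rabs (fst q) < d) (fun q => phi (fst q)).
Proof.
  intros h; apply smooth_on_Ck; intros k; revert phi h.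
  induction k as [|k IH]; intros phi h.
  - intros [x y] hq; simpl in *; split; [| exact I].
    apply (continuity_1d_2d_pt_comp phi (fun u _ => u)).
    + apply continuity_pt_filterlim, (ex_derive_continuous phi), (h x hq 1%nat).
    + apply continuity_2d_pt_id1.
  - apply Ck_S; repeat split; try (intros q hq).
    + apply (continuous_comp fst phi); [apply continuous_fst |].
      apply (ex_derive_continuous phi), (h _ hq 1%nat).
    + exact (h _ hq 1%nat).
    + apply (ex_derive_const (phi (fst q))).
    + exact (IH _ (smooth_near_Derive _ _ h) q hq).
    + apply (ex_diff_n_ext_loc (fun _ _ => 0)).
      * apply locally_2d_forall; intros; symmetry; apply (Derive_const (phi u)).
      * exact (Ck_const (fun _ => True) k 0 q I).
Qed.

(** The restriction of a smooth function to a horizontal line: its [n]-th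
    derivative is the [n]-th iterate of [D1], without any interchange. *)
Lemma smooth_on_horizontal (U : R * R -> Prop) (F : R * R -> R) (x y : R) :
  smooth_on U F -> U (x, y) -> forall k, ex_derive_n (fun t => F (t, y)) k x.
Proof.
  intros hF hq [|k]; [exact I |].
  assert (hk : forall n t, Derive_n (fun t => F (t, y)) n t = Nat.iter n D1 F (t, y)).
  { induction n as [|n IH]; intros t; [reflexivity |].
    simpl; unfold D1; simpl; now apply Derive_ext. }
  apply (ex_derive_ext (fun t => Nat.iter k D1 F (t, y))).
  - intros t; symmetry; apply hk.
  - assert (hs : smooth_on U (Nat.iter k D1 F)).
    { clear hk; induction k as [|k IH]; [exact hF |]; now apply smooth_on_D1. }
    apply smooth_on_D in hs; apply (proj1 (proj2 hs) (x, y) hq).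
Qed.

Lemma smooth_on_fst_comp (U : R * R -> Prop) (d : R) (phi : R -> R)
  (F : R * R -> R) :
  open U -> smooth_near d phi -> smooth_on U F ->
  (forall q, U q -> Rabs (F q) < d) -> smooth_on U (fun q => phi (F q)).
Proof.
  intros hU hphi hF hd.
  apply (smooth_on_compose (fun q => Rabs (fst q) < d) U (fun q => phi (fst q))
           (fun q => (F q, 0))); auto.
  - apply open_strip.
  - now apply smooth_near_on_strip.
  - split; [exact hF | exact (smooth_on_const U 0)].
Qed.

(** Hadamard's division: [psi x] is the mean of [phi'] over the segment from 0
    to [x], and differentiation under the integral sign makes it smooth; its
    [k]-th derivative is the mean of [t ^ k * phi^(k+1) (t x)]. *)
Lemma hadamard (d : R) (phi : R -> R) :
  smooth_near d phi -> phi 0 = 0 ->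
  exists psi, smooth_near d psi /\
    (forall x, Rabs x < d -> phi x = x * psi x) /\
    (0 < d -> forall k, Derive_n phi (S k) 0 = INR (S k) * Derive_n psi k 0).
Proof.
  intros h h0.
  set (O := fun q : R * R => Rabs (fst q * snd q) < d).
  set (Phi := fun (k : nat) (q : R * R) =>
                snd q ^ k * Derive_n phi (S k) (fst q * snd q)).
  assert (hO : open O).
  { apply (open_comp (fun q : R * R => fst q * snd q) (fun x => Rabs x < d));
      [| apply open_Rabs_lt].
    intros q _; apply (smooth_on_continuous (fun _ => True)); [| exact I].
    apply (smooth_on_mult _ fst snd);
      [apply open_true | apply smooth_on_fst | apply smooth_on_snd]. }
  assert (hP : forall k, smooth_on O (Phi k)).
  { intros k; apply smooth_on_mult; auto.
    - induction k as [|k IH]; [exact (smooth_on_const O 1) |].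
      apply (smooth_on_mult O snd (fun q => snd q ^ k)); auto; apply smooth_on_snd.
    - apply (smooth_on_fst_comp O d); auto.
      + now apply smooth_near_Derive_n.
      + apply smooth_on_mult; auto; [apply smooth_on_fst | apply smooth_on_snd]. }
  assert (hD : forall k q, O q -> D1 (Phi k) q = Phi (S k) q).
  { intros k [x t] hq; unfold O in hq; simpl in hq.
    apply is_derive_unique.
    replace (Phi (S k) (x, t)) with (t ^ k * (t * Derive (Derive_n phi (S k)) (x * t))).
    2: { change (Phi (S k) (x, t))
           with (t * t ^ k * Derive (Derive_n phi (S k)) (x * t)); ring. }
    apply (is_derive_scal (fun z => Derive_n phi (S k) (z * t))).
    apply (is_derive_comp (Derive_n phi (S k)) (fun z => z * t)).
    - apply Derive_correct, (h _ hq (S (S k))).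
    - auto_derive; [exact I | ring]. }
  assert (hin : forall x t, Rabs x < d -> Rmin 0 1 <= t <= Rmax 0 1 -> O (x, t)).
  { intros x t hx; rewrite Rmin_left, Rmax_right by lra; intros ht.
    unfold O; simpl; rewrite Rabs_mult, (Rabs_pos_eq t) by lra.
    pose proof (Rabs_pos x); nra. }
  assert (hint : forall k x, Rabs x < d -> ex_RInt (fun t => Phi k (x, t)) 0 1).
  { intros k x hx; apply (ex_RInt_continuous (fun t => Phi k (x, t))).
    intros t ht.
    pose proof (proj1 (smooth_on_D _ _) (hP k)) as (_ & _ & h2 & _).
    exact (ex_derive_continuous _ _ (h2 (x, t) (hin x t hx ht))). }
  set (G := fun k x => RInt (fun t => Phi k (x, t)) 0 1).
  assert (hG : forall k x, Rabs x < d -> is_derive (G k) x (G (S k) x)).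
  { intros k x hx.
    assert (hloc : locally x (fun y => Rabs y < d)) by (apply (open_Rabs_lt d); auto).
    unfold G at 2.
    rewrite (RInt_ext (fun t => Phi (S k) (x, t))
               (fun t => Derive (fun u => Phi k (u, t)) x)).
    - apply (is_derive_RInt_param (fun u t => Phi k (u, t))).
      + revert hloc; apply filter_imp; intros y hy t ht.
        pose proof (proj1 (smooth_on_D _ _) (hP k)) as (_ & h1 & _).
        exact (h1 (y, t) (hin y t hy ht)).
      + intros t ht.
        apply (continuity_2d_continuous (D1 (Phi k)) (x, t)).
        apply (smooth_on_continuous O); [apply smooth_on_D1, hP | now apply hin].
      + revert hloc; apply filter_imp; intros y hy; now apply hint.
    - intros t ht; symmetry; apply (hD k (x, t)), hin; auto; lra. }
  assert (hn : forall k x, Rabs x < d -> Derive_n (G 0%nat) k x = G k x).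
  { induction k as [|k IH]; intros x hx; [reflexivity |].
    simpl; rewrite (Derive_ext_loc _ (G k)).
    - now apply is_derive_unique, hG.
    - generalize (open_Rabs_lt d x hx); apply filter_imp; auto. }
  exists (G 0%nat); split; [| split].
  - intros x hx [|k]; [exact I |].
    apply (ex_derive_ext_loc (G k)).
    + generalize (open_Rabs_lt d x hx); apply filter_imp; intros; symmetry; auto.
    + eexists; now apply hG.
  - intros x hx.
    assert (hI : is_RInt (fun t => x * Phi 0%nat (x, t)) 0 1
                   (minus (phi (x * 1)) (phi (x * 0)))).
    { apply (is_RInt_derive (fun t => phi (x * t))).
      - intros t ht; unfold Phi; simpl; rewrite Rmult_1_l.
        apply (is_derive_comp phi (fun t => x * t)).
        + apply Derive_correct, (h _ (hin x t hx ht) 1%nat).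
        + auto_derive; [exact I | ring].
      - intros t ht; apply (continuous_scal_r x (fun t => Phi 0%nat (x, t))).
        pose proof (proj1 (smooth_on_D _ _) (hP 0%nat)) as (_ & _ & h2 & _).
        exact (ex_derive_continuous _ _ (h2 (x, t) (hin x t hx ht))). }
    rewrite Rmult_1_r, Rmult_0_r, h0 in hI.
    apply (is_RInt_unique (V := R_CompleteNormedModule)) in hI.
    pose proof (RInt_scal (V := R_CompleteNormedModule)
                  (fun t => Phi 0%nat (x, t)) 0 1 x (hint 0%nat x hx)) as hS.
    unfold minus, plus, opp, scal in hI, hS; simpl in hI, hS.
    unfold mult in hS; simpl in hS; unfold G.
    rewrite <- hS, hI; ring.
  - intros hd k.
    assert (hd0 : Rabs 0 < d) by (rewrite Rabs_R0; exact hd).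
    rewrite hn by exact hd0; unfold G.
    assert (hI : is_RInt (fun t => Phi k (0, t)) 0 1 (Derive_n phi (S k) 0 * / INR (S k))).
    { apply (is_RInt_ext (fun t => Derive_n phi (S k) 0 * t ^ k)).
      - intros t _; unfold Phi; simpl; rewrite Rmult_0_l; ring.
      - replace (/ INR (S k)) with (/ INR (S k) * 1 ^ S k - / INR (S k) * 0 ^ S k)
          by (rewrite pow1; simpl; ring).
        replace (Derive_n phi (S k) 0 *
                 (/ INR (S k) * 1 ^ S k - / INR (S k) * 0 ^ S k))
          with (minus ((fun t => Derive_n phi (S k) 0 * (/ INR (S k) * t ^ S k)) 1)
                  ((fun t => Derive_n phi (S k) 0 * (/ INR (S k) * t ^ S k)) 0))
          by (unfold minus, plus, opp; simpl; ring).
        apply (is_RInt_derive (fun t => Derive_n phi (S k) 0 * (/ INR (S k) * t ^ S k))).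
        + intros t _; auto_derive; [exact I |].
          
          change (match k with 0%nat => 1 | S _ => INR k + 1 end) with (INR (S k)).
          change (Init.Nat.pred (S k)) with k.
          simpl Derive_n; generalize (Derive (Derive_n phi k) 0); intros a.
          field; apply not_0_INR; lia.
        + intros t _; apply (ex_derive_continuous (fun t => Derive_n phi (S k) 0 * t ^ k)).
          auto_derive; exact I. }
    rewrite (is_RInt_unique (V := R_CompleteNormedModule) _ _ _ _ hI).
    field; apply not_0_INR; lia.
Qed.

Lemma eq_at_0_of_continuous (d : R) (f g : R -> R) :
  0 < d -> continuous f 0 -> continuous g 0 ->
  (forall x, Rabs x < d -> x <> 0 -> f x = g x) -> f 0 = g 0.
Proof.
  intros hd hf hg h.
  destruct (Req_dec (f 0 - g 0) 0) as [e | ne]; [lra | exfalso].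
  assert (hc : continuous (fun x => f x - g x) 0) by now apply (continuous_minus f g).
  destruct (hc _ (open_neq 0 _ ne)) as [e he].
  set (x := Rmin e d / 2).
  assert (hx : 0 < x /\ x < e /\ x < d).
  { pose proof (cond_pos e); unfold x.
    pose proof (Rmin_l e d); pose proof (Rmin_r e d).
    pose proof (Rmin_pos e d ltac:(lra) hd); lra. }
  apply (he x).
  - unfold ball; simpl; unfold AbsRing_ball, abs, minus, plus, opp; simpl.
    rewrite Ropp_0, Rplus_0_r, Rabs_pos_eq; lra.
  - rewrite (h x); [ring | rewrite Rabs_pos_eq; lra | lra].
Qed.

Lemma smooth_near_continuous (d : R) (phi : R -> R) (x : R) :
  smooth_near d phi -> Rabs x < d -> continuous phi x.
Proof. intros h hx; apply (ex_derive_continuous phi), (h x hx 1%nat). Qed.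

(** Divide by [x] once for each vanishing derivative. *)
Lemma germ_order_factor (d : R) (phi : R -> R) (m : nat) :
  0 < d -> smooth_near d phi -> germ_order phi (Some m) ->
  exists psi, smooth_near d psi /\ psi 0 <> 0 /\
    forall x, Rabs x < d -> phi x = x ^ m * psi x.
Proof.
  intros hd; revert phi; induction m as [|m IH]; intros phi hphi [hz hm].
  - exists phi; split; [exact hphi |]; split; [exact hm |]; intros; simpl; ring.
  - destruct (hadamard d phi hphi (hz 0%nat ltac:(lia))) as (psi & h1 & h2 & h3).
    specialize (h3 hd).
    destruct (IH psi h1) as (chi & c1 & c2 & c3).
    + split.
      * intros k hk; specialize (hz (S k) ltac:(lia)); rewrite h3 in hz.
        apply Rmult_integral in hz as [hz | hz]; [| exact hz].
        exfalso; revert hz; apply not_0_INR; lia.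
      * intros e; apply hm; rewrite h3, e; ring.
    + exists chi; split; [exact c1 |]; split; [exact c2 |].
      intros x hx; rewrite h2, c3 by exact hx; simpl; ring.
Qed.

Lemma continuous_pow_mult (psi : R -> R) (m : nat) :
  continuous psi 0 -> continuous (fun x => x ^ m * psi x) 0.
Proof.
  intros h; apply (continuous_mult (fun x => x ^ m) psi); [| exact h].
  apply (ex_derive_continuous (fun x => x ^ m)); auto_derive; exact I.
Qed.

(** Continuity at [0] forces [phi 0 = 0] when [m] is positive, and the quotient
    by [x] satisfies the same factorization with [m - 1]. *)
Lemma germ_order_of_factor (d : R) (phi psi : R -> R) (m : nat) :
  0 < d -> smooth_near d phi -> continuous psi 0 -> psi 0 <> 0 ->
  (forall x, Rabs x < d -> x <> 0 -> phi x = x ^ m * psi x) ->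
  germ_order phi (Some m).
Proof.
  intros hd; revert phi; induction m as [|m IH]; intros phi hphi hc hn h.
  - assert (h0 : phi 0 = psi 0).
    { apply (eq_at_0_of_continuous d); auto.
      - apply (smooth_near_continuous d); auto; now rewrite Rabs_R0.
      - intros x hx hx0; rewrite h by auto; simpl; ring. }
    split; [intros k hk; lia | simpl; congruence].
  - assert (h0 : phi 0 = 0).
    { rewrite (eq_at_0_of_continuous d phi (fun x => x ^ S m * psi x)); auto.
      - simpl; ring.
      - apply (smooth_near_continuous d); auto; now rewrite Rabs_R0.
      - now apply continuous_pow_mult. }
    destruct (hadamard d phi hphi h0) as (chi & h1 & h2 & h3); specialize (h3 hd).
    destruct (IH chi h1 hc hn) as [hz hm].
    { intros x hx hx0; apply (Rmult_eq_reg_l x); [| exact hx0].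
      rewrite <- h2, h by auto; simpl; ring. }
    split.
    + intros [|k] hk; [exact h0 |].
      rewrite h3, hz by lia; ring.
    + rewrite h3; apply Rmult_integral_contrapositive_currified; [| exact hm].
      apply not_0_INR; lia.
Qed.

Lemma germ_order_unique (phi : R -> R) (m n : nat) :
  germ_order phi (Some m) -> germ_order phi (Some n) -> m = n.
Proof.
  intros [h1 h2] [h3 h4].
  destruct (lt_eq_lt_dec m n) as [[h | h] | h]; [| exact h |];
    exfalso; auto.
Qed.

Lemma germ_order_ext (phi psi : R -> R) (m : nat) :
  locally 0 (fun x => phi x = psi x) ->
  germ_order phi (Some m) -> germ_order psi (Some m).
Proof.
  intros he [h1 h2]; split.
  - intros k hk; rewrite <- (Derive_n_ext_loc phi psi k 0 he); auto.
  - rewrite <- (Derive_n_ext_loc phi psi m 0 he); exact h2.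
Qed.

(** As [b ^ 2] vanishes at [0], so does [b], and Hadamard's division lowers [n]
    by one.  When [chi 0] is non-zero, [b] thus changes sign at the origin
    exactly when [n] is odd; this dichotomy decides the index. *)
Lemma smooth_sqrt_factor (d : R) (b chi : R -> R) (n : nat) :
  0 < d -> smooth_near d b -> continuous chi 0 ->
  (forall x, Rabs x < d -> x <> 0 -> b x * b x = x ^ (2 * n) * chi x) ->
  exists beta, smooth_near d beta /\ beta 0 * beta 0 = chi 0 /\
    forall x, Rabs x < d -> b x = x ^ n * beta x.
Proof.
  intros hd; revert b; induction n as [|n IH]; intros b hb hc h.
  - exists b; split; [exact hb |]; split; [| intros; simpl; ring].
    assert (hb0 : continuous b 0)
      by (apply (smooth_near_continuous d); auto; now rewrite Rabs_R0).
    apply (eq_at_0_of_continuous d (fun x => b x * b x)); auto.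
    + now apply (continuous_mult b b).
    + intros x hx hx0; rewrite h by auto; simpl; ring.
  - assert (hb0 : continuous b 0)
      by (apply (smooth_near_continuous d); auto; now rewrite Rabs_R0).
    assert (h0 : b 0 = 0).
    { assert (e : b 0 * b 0 = 0).
      { rewrite (eq_at_0_of_continuous d (fun x => b x * b x)
                   (fun x => x ^ (2 * S n) * chi x)); auto.
        - simpl; ring.
        - now apply (continuous_mult b b).
        - now apply continuous_pow_mult. }
      nra. }
    destruct (hadamard d b hb h0) as (c & h1 & h2 & _).
    destruct (IH c h1 hc) as (beta & b1 & b2 & b3).
    { intros x hx hx0; apply (Rmult_eq_reg_l (x * x)); [| nra].
      replace (x * x * (c x * c x)) with (b x * b x) by (rewrite h2; [ring | auto]).
      rewrite h by auto; replace (2 * S n)%nat with (S (S (2 * n))) by lia.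
      simpl; ring. }
    exists beta; split; [exact b1 |]; split; [exact b2 |].
    intros x hx; rewrite h2, b3 by exact hx; simpl; ring.
Qed.

Lemma pow_even_nonneg (x : R) (n : nat) : Nat.Even n -> 0 <= x ^ n.
Proof. intros [k ->]; rewrite pow_mult; apply pow_le, pow2_ge_0. Qed.

(** [Rpower] keeps the induction on derivatives inside one family of
    functions, which gives the smoothness of square roots. *)
Lemma smooth_on_Rpower (c a : R) :
  smooth_on (fun q => 0 < fst q) (fun q => c * Rpower (fst q) a).
Proof.
  assert (hO : open (fun q : R * R => 0 < fst q)).
  { apply (open_comp fst (fun x => 0 < x)); [| apply open_gt].
    intros x _; apply continuous_fst. }
  apply smooth_on_Ck; intros k; revert c a.
  assert (hder : forall c a x, 0 < x ->
            is_derive (fun t => c * Rpower t a) x (c * a * Rpower x (a - 1))).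
  { intros c a x hx; rewrite Rmult_assoc; apply is_derive_scal, is_derive_Reals.
    now apply derivable_pt_lim_power. }
  assert (hcont : forall c a q, 0 < fst q ->
            continuous (fun q : R * R => c * Rpower (fst q) a) q).
  { intros c a q hq; apply (continuous_comp fst (fun t => c * Rpower t a)).
    - apply continuous_fst.
    - apply (ex_derive_continuous (fun t => c * Rpower t a)).
      eexists; now apply hder. }
  induction k as [|k IH]; intros c a.
  - intros q hq; split; [| exact I].
    now apply (continuity_2d_continuous (fun q => c * Rpower (fst q) a)), hcont.
  - apply Ck_S; split; [| split; [| split; [| split]]].
    + intros q hq; now apply hcont.
    + intros q hq; eexists; now apply hder.
    + intros q hq; apply (ex_derive_const (c * Rpower (fst q) a)).
    + apply (Ck_ext _ _ (fun q => c * a * Rpower (fst q) (a - 1))); auto.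
      intros q hq; symmetry; now apply is_derive_unique, hder.
    + apply (Ck_ext _ _ (fun _ => 0)); auto; [| apply Ck_const].
      intros q hq; symmetry; apply (Derive_const (c * Rpower (fst q) a)).
Qed.

Lemma smooth_on_sqrt_comp (U : R * R -> Prop) (F : R * R -> R) :
  open U -> smooth_on U F -> (forall q, U q -> 0 < F q) ->
  smooth_on U (fun q => sqrt (F q)).
Proof.
  intros hU hF hpos.
  apply (smooth_on_ext U (fun q => 1 * Rpower (F q) (/ 2))); auto.
  - intros q hq; rewrite Rpower_sqrt by auto; ring.
  - apply (smooth_on_compose (fun q => 0 < fst q) U
             (fun q => 1 * Rpower (fst q) (/ 2)) (fun q => (F q, 0))); auto.
    + apply (open_comp fst (fun x => 0 < x)); [| apply open_gt].
      intros x _; apply continuous_fst.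
    + apply smooth_on_Rpower.
    + split; [exact hF | exact (smooth_on_const U 0)].
Qed.

(** * Fundamental forms under change of parameters *)

Lemma ambient_dim_pos (c : R) : (0 < ambient_dim c)%nat.
Proof. unfold ambient_dim; destruct (Req_EM_T c 0); lia. Qed.

Lemma coord_mk {c : R} (u : nat -> R) (i : nat) :
  (i < ambient_dim c)%nat -> coord (c := c) (mk_Tn (ambient_dim c) u) i = u i.
Proof. intros hi; unfold coord; now apply coeff_Tn_bij. Qed.

Lemma inner_sym {c : R} (x y : ambient c) : inner x y = inner y x.
Proof. unfold inner; apply sum_eq; intros; ring. Qed.

Lemma inner_linear_l {c : R} (a b : R) (x y z w : ambient c) :
  (forall i, (i < ambient_dim c)%nat -> coord x i = a * coord y i + b * coord z i) ->
  inner x w = a * inner y w + b * inner z w.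
Proof.
  intros h; unfold inner; rewrite !scal_sum, <- sum_plus.
  apply sum_eq; intros i hi; rewrite h; [ring |].
  pose proof (ambient_dim_pos c); lia.
Qed.

Lemma inner_ext_l {c : R} (x y w : ambient c) :
  (forall i, (i < ambient_dim c)%nat -> coord x i = coord y i) ->
  inner x w = inner y w.
Proof.
  intros h; rewrite (inner_linear_l 1 0 x y y w); [ring |].
  intros i hi; rewrite h by exact hi; ring.
Qed.

Lemma inner_bilinear {c : R} (a b a' b' : R) (x y z x' y' z' : ambient c) :
  (forall i, (i < ambient_dim c)%nat -> coord x i = a * coord y i + b * coord z i) ->
  (forall i, (i < ambient_dim c)%nat ->
     coord x' i = a' * coord y' i + b' * coord z' i) ->
  inner x x' = a * a' * inner y y' + a * b' * inner y z'
               + b * a' * inner z y' + b * b' * inner z z'.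
Proof.
  intros h h'; rewrite (inner_linear_l a b x y z) by exact h.
  rewrite (inner_sym y), (inner_sym z), !(inner_linear_l a' b' x' y' z') by exact h'.
  rewrite (inner_sym y' y), (inner_sym z' y), (inner_sym y' z), (inner_sym z' z); ring.
Qed.

Lemma inner_tangent_part {c : R} (x w n : ambient c) :
  c * inner x n = 0 -> inner (tangent_part x w) n = inner w n.
Proof.
  intros h.
  rewrite (inner_linear_l 1 (- (c * inner w x)) _ w x).
  - transitivity (inner w n - inner w x * (c * inner x n)); [ring | rewrite h; ring].
  - intros i hi; unfold tangent_part; rewrite coord_mk by exact hi; ring.
Qed.

Lemma is_derive_sum_f_R0 (u : nat -> R -> R) (u' : nat -> R) (n : nat) (t : R) :
  (forall i, (i <= n)%nat -> is_derive (u i) t (u' i)) ->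
  is_derive (fun s => sum_f_R0 (fun i => u i s) n) t (sum_f_R0 u' n).
Proof.
  induction n as [|n IH]; intros h; simpl; [apply h; lia |].
  apply (is_derive_plus (fun s => sum_f_R0 (fun i => u i s) n) (u (S n))); auto.
Qed.

Lemma is_derive_inner {c : R} (X Y : R -> ambient c) (X' Y' : ambient c) (t : R) :
  (forall i, (i < ambient_dim c)%nat ->
     is_derive (fun s => coord (X s) i) t (coord X' i)) ->
  (forall i, (i < ambient_dim c)%nat ->
     is_derive (fun s => coord (Y s) i) t (coord Y' i)) ->
  is_derive (fun s => inner (X s) (Y s)) t (inner X' (Y t) + inner (X t) Y').
Proof.
  intros hX hY; unfold inner; rewrite <- sum_plus.
  apply (is_derive_sum_f_R0 (fun i s =>
           signature_sign c i * (coord (X s) i * coord (Y s) i))).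
  intros i hi.
  assert (hi' : (i < ambient_dim c)%nat) by (pose proof (ambient_dim_pos c); lia).
  replace (signature_sign c i * (coord X' i * coord (Y t) i)
           + signature_sign c i * (coord (X t) i * coord Y' i))
    with (signature_sign c i * (coord X' i * coord (Y t) i + coord (X t) i * coord Y' i))
    by ring.
  apply is_derive_scal.
  apply (is_derive_mult (fun s => coord (X s) i) (fun s => coord (Y s) i)); auto.
  intros a b; apply Rmult_comm.
Qed.

Lemma coord_d_u {c : R} (F : R * R -> ambient c) (q : R * R) (i : nat) :
  (i < ambient_dim c)%nat -> coord (d_u F q) i = D1 (fun z => coord (F z) i) q.
Proof. intros hi; unfold d_u; now rewrite coord_mk. Qed.

Lemma coord_d_v {c : R} (F : R * R -> ambient c) (q : R * R) (i : nat) :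
  (i < ambient_dim c)%nat -> coord (d_v F q) i = D2 (fun z => coord (F z) i) q.
Proof. intros hi; unfold d_v; now rewrite coord_mk. Qed.

Lemma smooth_map_d_u {c : R} (U : R * R -> Prop) (F : R * R -> ambient c) :
  open U -> smooth_map_on U F -> smooth_map_on U (d_u F).
Proof.
  intros hU h i hi; apply (smooth_on_ext U (D1 (fun z => coord (F z) i))); auto.
  - intros; now rewrite coord_d_u.
  - now apply smooth_on_D1, h.
Qed.

Lemma smooth_map_d_v {c : R} (U : R * R -> Prop) (F : R * R -> ambient c) :
  open U -> smooth_map_on U F -> smooth_map_on U (d_v F).
Proof.
  intros hU h i hi; apply (smooth_on_ext U (D2 (fun z => coord (F z) i))); auto.
  - intros; now rewrite coord_d_v.
  - now apply smooth_on_D2, h.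
Qed.

Lemma orthogonal_d_u {c : R} (U : R * R -> Prop) (X Y : R * R -> ambient c)
  (q : R * R) :
  open U -> smooth_map_on U X -> smooth_map_on U Y ->
  (forall z, U z -> inner (X z) (Y z) = 0) -> U q ->
  inner (d_u X q) (Y q) = - inner (X q) (d_u Y q).
Proof.
  intros hU hX hY h hq; destruct q as [x y].
  assert (hd : is_derive (fun t => inner (X (t, y)) (Y (t, y))) x
                 (inner (d_u X (x, y)) (Y (x, y)) + inner (X (x, y)) (d_u Y (x, y)))).
  { apply (is_derive_inner (fun t => X (t, y)) (fun t => Y (t, y))); intros i hi;
      rewrite coord_d_u by exact hi; apply Derive_correct.
    - destruct (proj1 (smooth_on_D _ _) (hX i hi)) as (_ & h1 & _); exact (h1 _ hq).
    - destruct (proj1 (smooth_on_D _ _) (hY i hi)) as (_ & h1 & _); exact (h1 _ hq). }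
  assert (h0 : is_derive (fun t => inner (X (t, y)) (Y (t, y))) x 0).
  { apply (is_derive_ext_loc (fun _ => 0)); [| apply @is_derive_const].
    generalize (locally_prod_fst U (x, y) (hU _ hq)); apply filter_imp.
    intros t ht; symmetry; now apply h. }
  apply is_derive_unique in hd; apply is_derive_unique in h0; lra.
Qed.

Lemma orthogonal_d_v {c : R} (U : R * R -> Prop) (X Y : R * R -> ambient c)
  (q : R * R) :
  open U -> smooth_map_on U X -> smooth_map_on U Y ->
  (forall z, U z -> inner (X z) (Y z) = 0) -> U q ->
  inner (d_v X q) (Y q) = - inner (X q) (d_v Y q).
Proof.
  intros hU hX hY h hq; destruct q as [x y].
  assert (hd : is_derive (fun t => inner (X (x, t)) (Y (x, t))) y
                 (inner (d_v X (x, y)) (Y (x, y)) + inner (X (x, y)) (d_v Y (x, y)))).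
  { apply (is_derive_inner (fun t => X (x, t)) (fun t => Y (x, t))); intros i hi;
      rewrite coord_d_v by exact hi; apply Derive_correct.
    - destruct (proj1 (smooth_on_D _ _) (hX i hi)) as (_ & _ & h1 & _); exact (h1 _ hq).
    - destruct (proj1 (smooth_on_D _ _) (hY i hi)) as (_ & _ & h1 & _); exact (h1 _ hq). }
  assert (h0 : is_derive (fun t => inner (X (x, t)) (Y (x, t))) y 0).
  { apply (is_derive_ext_loc (fun _ => 0)); [| apply @is_derive_const].
    generalize (locally_prod_snd U (x, y) (hU _ hq)); apply filter_imp.
    intros t ht; symmetry; now apply h. }
  apply is_derive_unique in hd; apply is_derive_unique in h0; lra.
Qed.

(** A map into the space form with a normal field, keeping only the relations
    that survive an arbitrary smooth change of parameters. *)
Definition surface {c : R} (U : R * R -> Prop) (F N : R * R -> ambient c) : Prop :=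
  open U /\ smooth_map_on U F /\ smooth_map_on U N /\
  forall q, U q -> c * inner (F q) (N q) = 0 /\
    inner (d_u F q) (N q) = 0 /\ inner (d_v F q) (N q) = 0.

(** Differentiating [<dF, N> = 0] turns the second derivatives of [F] into
    first derivatives of [N]. *)
Lemma second_form_weingarten {c : R} (U : R * R -> Prop) (F N : R * R -> ambient c)
  (q : R * R) :
  surface U F N -> U q ->
  second_form F N q =
    Mat2 (- inner (d_u F q) (d_u N q)) (- inner (d_u F q) (d_v N q))
         (- inner (d_v F q) (d_u N q)) (- inner (d_v F q) (d_v N q)).
Proof.
  intros (hU & hF & hN & h) hq.
  assert (hu := smooth_map_d_u U F hU hF); assert (hv := smooth_map_d_v U F hU hF).
  assert (hM : coef_M F N q = - inner (d_v F q) (d_u N q)).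
  { unfold coef_M, nabla_u; rewrite inner_tangent_part by apply h, hq.
    apply (orthogonal_d_u U (d_v F) N); auto; intros; now apply h. }
  unfold second_form; f_equal; auto.
  - unfold coef_L, nabla_u; rewrite inner_tangent_part by apply h, hq.
    apply (orthogonal_d_u U (d_u F) N); auto; intros; now apply h.
  - unfold coef_M, nabla_u; rewrite inner_tangent_part by apply h, hq.
    rewrite <- (orthogonal_d_v U (d_u F) N); auto; [| intros; now apply h].
    (* the mixed second derivatives of the coordinates of F commute *)
    apply inner_ext_l; intros i hi.
    rewrite coord_d_u, coord_d_v by exact hi.
    transitivity (D1 (D2 (fun z => coord (F z) i)) q).
    + apply Derive_ext; intros t; now apply coord_d_v.
    + rewrite (smooth_on_Schwarz U); auto.
      apply Derive_ext; intros t; symmetry; now apply coord_d_u.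
  - unfold coef_N, nabla_v; rewrite inner_tangent_part by apply h, hq.
    apply (orthogonal_d_v U (d_v F) N); auto; intros; now apply h.
Qed.

Definition jacobian (tau : R * R -> R * R) (w : R * R) : mat2 :=
  Mat2 (D1 (fun z => fst (tau z)) w) (D2 (fun z => fst (tau z)) w)
       (D1 (fun z => snd (tau z)) w) (D2 (fun z => snd (tau z)) w).

Definition mat2_transpose (A : mat2) : mat2 := Mat2 (m11 A) (m21 A) (m12 A) (m22 A).

Definition pullback_form (J S : mat2) : mat2 :=
  mat2_mul (mat2_transpose J) (mat2_mul S J).

Section Pull.

Context {c : R} (U W : R * R -> Prop) (tau : R * R -> R * R)
  (hU : open U) (hW : open W) (hWU : forall w, W w -> U (tau w))
  (htau : smooth_plane_map_on W tau).

Lemma coord_d_u_pull (F : R * R -> ambient c) (w : R * R) (i : nat) :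
  smooth_map_on U F -> W w -> (i < ambient_dim c)%nat ->
  coord (d_u (pull tau F) w) i =
    m11 (jacobian tau w) * coord (d_u F (tau w)) i
    + m21 (jacobian tau w) * coord (d_v F (tau w)) i.
Proof.
  intros hF hw hi; rewrite !coord_d_u, coord_d_v by exact hi; unfold jacobian; simpl.
  rewrite (Rmult_comm (D1 _ w)), (Rmult_comm (D1 _ w)).
  apply is_derive_unique, (is_derive_pull_1 U W (fun z => coord (F z) i)); auto.
Qed.

Lemma coord_d_v_pull (F : R * R -> ambient c) (w : R * R) (i : nat) :
  smooth_map_on U F -> W w -> (i < ambient_dim c)%nat ->
  coord (d_v (pull tau F) w) i =
    m12 (jacobian tau w) * coord (d_u F (tau w)) i
    + m22 (jacobian tau w) * coord (d_v F (tau w)) i.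
Proof.
  intros hF hw hi; rewrite !coord_d_v, coord_d_u by exact hi; unfold jacobian; simpl.
  rewrite (Rmult_comm (D2 _ w)), (Rmult_comm (D2 _ w)).
  apply is_derive_unique, (is_derive_pull_2 U W (fun z => coord (F z) i)); auto.
Qed.

Lemma first_form_pull (F : R * R -> ambient c) (w : R * R) :
  smooth_map_on U F -> W w ->
  first_form (pull tau F) w = pullback_form (jacobian tau w) (first_form F (tau w)).
Proof.
  intros hF hw.
  pose proof (fun i => coord_d_u_pull F w i hF hw) as hu.
  pose proof (fun i => coord_d_v_pull F w i hF hw) as hv.
  unfold first_form, pullback_form, mat2_mul, mat2_transpose.
  cbn [m11 m12 m21 m22]; f_equal; erewrite inner_bilinear by eassumption; ring.
Qed.

Lemma surface_pull (F N : R * R -> ambient c) :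
  surface U F N -> surface W (pull tau F) (pull tau N).
Proof.
  intros (_ & hF & hN & h).
  assert (hs : forall X : R * R -> ambient c,
            smooth_map_on U X -> smooth_map_on W (pull tau X)).
  { intros X hX i hi.
    exact (smooth_on_compose U W (fun q => coord (X q) i) tau hU hW hWU (hX i hi) htau). }
  split; [exact hW |]; split; [now apply hs |]; split; [now apply hs |].
  intros w hw; destruct (h (tau w) (hWU w hw)) as (h1 & h2 & h3).
  split; [exact h1 |]; unfold pull at 2; unfold pull at 3; split.
  - erewrite inner_linear_l by (intros; now apply coord_d_u_pull).
    rewrite h2, h3; ring.
  - erewrite inner_linear_l by (intros; now apply coord_d_v_pull).
    rewrite h2, h3; ring.
Qed.

Lemma second_form_pull (F N : R * R -> ambient c) (w : R * R) :
  surface U F N -> W w ->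
  second_form (pull tau F) (pull tau N) w
  = pullback_form (jacobian tau w) (second_form F N (tau w)).
Proof.
  intros hS hw; pose proof hS as (_ & hF & hN & _).
  rewrite (second_form_weingarten W) by (auto; now apply surface_pull).
  rewrite (second_form_weingarten U) by auto.
  pose proof (fun i => coord_d_u_pull F w i hF hw) as hu.
  pose proof (fun i => coord_d_v_pull F w i hF hw) as hv.
  pose proof (fun i => coord_d_u_pull N w i hN hw) as hu'.
  pose proof (fun i => coord_d_v_pull N w i hN hw) as hv'.
  unfold pullback_form, mat2_mul, mat2_transpose.
  cbn [m11 m12 m21 m22]; f_equal; erewrite inner_bilinear by eassumption; ring.
Qed.

End Pull.

Lemma d_u_ext_loc {c : R} (F F' : R * R -> ambient c) (q : R * R) :
  locally q (fun z => F z = F' z) -> d_u F q = d_u F' q.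
Proof.
  intros h; unfold d_u; apply mk_Tn_ext; intros i hi; apply Derive_ext_loc.
  generalize (locally_prod_fst _ q h); apply filter_imp.
  intros t ht; exact (f_equal (fun z => coord z i) ht).
Qed.

Lemma d_v_ext_loc {c : R} (F F' : R * R -> ambient c) (q : R * R) :
  locally q (fun z => F z = F' z) -> d_v F q = d_v F' q.
Proof.
  intros h; unfold d_v; apply mk_Tn_ext; intros i hi; apply Derive_ext_loc.
  generalize (locally_prod_snd _ q h); apply filter_imp.
  intros t ht; exact (f_equal (fun z => coord z i) ht).
Qed.

Lemma first_form_ext_loc {c : R} (F F' : R * R -> ambient c) (q : R * R) :
  locally q (fun z => F z = F' z) -> first_form F q = first_form F' q.
Proof.
  intros h; unfold first_form.
  now rewrite (d_u_ext_loc F F' q h), (d_v_ext_loc F F' q h).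
Qed.

Lemma second_form_ext_loc {c : R} (F F' N N' : R * R -> ambient c) (q : R * R) :
  locally q (fun z => F z = F' z) -> locally q (fun z => N z = N' z) ->
  second_form F N q = second_form F' N' q.
Proof.
  intros h h'.
  assert (hl := locally_locally _ _ h).
  assert (e1 : d_u (d_u F) q = d_u (d_u F') q).
  { apply d_u_ext_loc; revert hl; apply filter_imp, d_u_ext_loc. }
  assert (e2 : d_u (d_v F) q = d_u (d_v F') q).
  { apply d_u_ext_loc; revert hl; apply filter_imp, d_v_ext_loc. }
  assert (e3 : d_v (d_v F) q = d_v (d_v F') q).
  { apply d_v_ext_loc; revert hl; apply filter_imp, d_v_ext_loc. }
  apply locally_singleton in h; apply locally_singleton in h'.
  unfold second_form, coef_L, coef_M, coef_N, nabla_u, nabla_v.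
  now rewrite e1, e2, e3, h, h'.
Qed.

(** * The shape operator in null coordinates *)

Definition null_metric (E : R) : mat2 := Mat2 0 E E 0.

Definition shape_of_forms (I II : mat2) : mat2 := mat2_mul (mat2_inv I) II.

(** In null coordinates the off-diagonal entries of the shape operator are the
    diagonal entries of the second form up to a common factor, and its diagonal
    is scalar: so the diagonal entries of the second form decide reality of the
    principal curvatures and the principal directions. *)
Lemma shape_null_conjugate (K : mat2) (E l m n : R) :
  mat2_det K <> 0 -> E <> 0 ->
  mat2_mul K (shape_of_forms (pullback_form K (null_metric E))
                (pullback_form K (Mat2 l m m n)))
  = mat2_mul (Mat2 (m / E) (n / E) (l / E) (m / E)) K.
Proof.
  destruct K as [a b a' b']; unfold mat2_det; simpl; intros hK hE.
  unfold shape_of_forms, mat2_inv, pullback_form, mat2_mul, mat2_transpose,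
    mat2_det, null_metric; simpl.
  set (D := (a * (0 * a + E * a') + a' * (E * a + 0 * a')) *
            (b * (0 * b + E * b') + b' * (E * b + 0 * b')) -
            (a * (0 * b + E * b') + a' * (E * b + 0 * b')) *
            (b * (0 * a + E * a') + b' * (E * a + 0 * a'))).
  assert (hD : D = - (E * E) * ((a * b' - b * a') * (a * b' - b * a')))
    by (unfold D; ring).
  rewrite hD; f_equal; field; auto.
Qed.

Lemma mat2_app_mul (A B : mat2) (w : R * R) :
  mat2_app (mat2_mul A B) w = mat2_app A (mat2_app B w).
Proof. unfold mat2_app, mat2_mul; simpl; f_equal; ring. Qed.

Lemma mat2_app_scal (A : mat2) (k : R) (w : R * R) :
  mat2_app A (k * fst w, k * snd w)
  = (k * fst (mat2_app A w), k * snd (mat2_app A w)).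
Proof. unfold mat2_app; simpl; f_equal; ring. Qed.

Lemma mat2_app_inj (A : mat2) (w w' : R * R) :
  mat2_det A <> 0 -> mat2_app A w = mat2_app A w' -> w = w'.
Proof.
  destruct A as [a b a' b'], w as [x y], w' as [x' y'].
  unfold mat2_det, mat2_app; simpl; intros hA he; injection he; intros e2 e1.
  assert (hx : (a * b' - b * a') * (x - x') = 0)
    by (transitivity (b' * (a * x + b * y - (a * x' + b * y'))
                      - b * (a' * x + b' * y - (a' * x' + b' * y')));
        [ring | rewrite e1, e2; ring]).
  assert (hy : (a * b' - b * a') * (y - y') = 0)
    by (transitivity (a * (a' * x + b' * y - (a' * x' + b' * y'))
                      - a' * (a * x + b * y - (a * x' + b * y')));
        [ring | rewrite e1, e2; ring]).
  apply Rmult_integral in hx as [hx | hx]; [contradiction |].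
  apply Rmult_integral in hy as [hy | hy]; [contradiction |].
  f_equal; lra.
Qed.

Section NullShape.

Context (K : mat2) (E l m n : R) (hK : mat2_det K <> 0) (hE : E <> 0).

Let S := shape_of_forms (pullback_form K (null_metric E))
           (pullback_form K (Mat2 l m m n)).

Lemma null_shape_app (w : R * R) :
  mat2_app K (mat2_app S w)
  = mat2_app (Mat2 (m / E) (n / E) (l / E) (m / E)) (mat2_app K w).
Proof. rewrite <- !mat2_app_mul; unfold S; now rewrite shape_null_conjugate. Qed.

Lemma null_principal_direction (w : R * R) (k : R) :
  mat2_app S w = (k * fst w, k * snd w) ->
  l * (fst (mat2_app K w) * fst (mat2_app K w))
  = n * (snd (mat2_app K w) * snd (mat2_app K w)).
Proof.
  intros h; generalize (null_shape_app w); rewrite h, mat2_app_scal.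
  destruct (mat2_app K w) as [A B]; unfold mat2_app; simpl.
  intros he; injection he; intros e2 e1.
  assert (f1 : k * A * E = m * A + n * B) by (rewrite e1; field; exact hE).
  assert (f2 : k * B * E = l * A + m * B) by (rewrite e2; field; exact hE).
  transitivity (A * (l * A + m * B) - m * A * B); [ring |].
  rewrite <- f2; transitivity (B * (k * A * E) - m * A * B); [ring |].
  rewrite f1; ring.
Qed.

Lemma null_principal_direction_conv (w : R * R) :
  l * (fst (mat2_app K w) * fst (mat2_app K w))
  = n * (snd (mat2_app K w) * snd (mat2_app K w)) ->
  exists k, mat2_app S w = (k * fst w, k * snd w).
Proof.
  generalize (null_shape_app w).
  destruct (mat2_app K w) as [A B] eqn:hAB; simpl; intros he h.
  destruct (Req_dec (A * A + B * B) 0) as [z | nz].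
  - assert (hA : A = 0) by nra; assert (hB : B = 0) by nra.
    exists 0; apply (mat2_app_inj K); [exact hK |].
    rewrite he, mat2_app_scal, hAB, hA, hB; unfold mat2_app; simpl; f_equal; ring.
  - (* the Rayleigh quotient of the conjugated operator at K w *)
    exists ((m + (n + l) * A * B / (A * A + B * B)) / E).
    apply (mat2_app_inj K); [exact hK |].
    rewrite he, mat2_app_scal, hAB; unfold mat2_app; simpl; f_equal.
    + apply (Rmult_eq_reg_r (E * (A * A + B * B)));
        [| now apply Rmult_integral_contrapositive_currified].
      transitivity ((m * A + n * B) * (A * A + B * B)); [now field |].
      transitivity (m * A * (A * A + B * B) + A * (n + l) * A * B); [| now field].
      transitivity (m * A * (A * A + B * B) + n * A * A * B + B * (n * (B * B)));
        [ring | rewrite <- h; ring].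
    + apply (Rmult_eq_reg_r (E * (A * A + B * B)));
        [| now apply Rmult_integral_contrapositive_currified].
      transitivity ((l * A + m * B) * (A * A + B * B)); [now field |].
      transitivity (m * B * (A * A + B * B) + B * (n + l) * A * B); [| now field].
      transitivity (m * B * (A * A + B * B) + l * A * B * B + A * (l * (A * A)));
        [ring | rewrite h; ring].
Qed.

Lemma null_umbilic (k : R) : S = Mat2 k 0 0 k -> l = 0 /\ n = 0.
Proof.
  intros h; generalize (shape_null_conjugate K E l m n hK hE); fold S; rewrite h.
  destruct K as [a b a' b']; unfold mat2_mul; unfold mat2_det in hK; simpl in *.
  intros he; injection he; intros e4 e3 e2 e1.
  assert (f1 : (k - m / E) * a = n / E * a') by lra.
  assert (f2 : (k - m / E) * b = n / E * b') by lra.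
  assert (f3 : (k - m / E) * a' = l / E * a) by lra.
  assert (f4 : (k - m / E) * b' = l / E * b) by lra.
  assert (g1 : n / E * (a * b' - b * a') = 0).
  { transitivity (a * (n / E * b') - b * (n / E * a')); [ring |].
    rewrite <- f1, <- f2; ring. }
  assert (g2 : l / E * (a * b' - b * a') = 0).
  { transitivity (b' * (l / E * a) - a' * (l / E * b)); [ring |].
    rewrite <- f3, <- f4; ring. }
  apply Rmult_integral in g1 as [g1 | g1]; [| contradiction].
  apply Rmult_integral in g2 as [g2 | g2]; [| contradiction].
  split; [replace l with (l / E * E) by now field | replace n with (n / E * E) by now field];
    [rewrite g2 | rewrite g1]; ring.
Qed.

Lemma null_discriminant :
  (m11 S - m22 S) * (m11 S - m22 S) + 4 * (m12 S * m21 S) = 4 * (l * n) / (E * E).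
Proof.
  unfold S; destruct K as [a b a' b']; unfold mat2_det in hK; simpl in hK.
  unfold shape_of_forms, mat2_inv, pullback_form, mat2_mul, mat2_transpose,
    mat2_det, null_metric; simpl.
  set (D := (a * (0 * a + E * a') + a' * (E * a + 0 * a')) *
            (b * (0 * b + E * b') + b' * (E * b + 0 * b')) -
            (a * (0 * b + E * b') + a' * (E * b + 0 * b')) *
            (b * (0 * a + E * a') + b' * (E * a + 0 * a'))).
  assert (hD : D = - (E * E) * ((a * b' - b * a') * (a * b' - b * a')))
    by (unfold D; ring).
  rewrite hD; field; auto.
Qed.

End NullShape.

(** A negative discriminant gives an eigenvalue off the real axis. *)
Lemma real_eigenvalues_discriminant (S : mat2) :
  (forall z : C, mat2_eigenvalue S z -> Im z = 0) ->
  0 <= (m11 S - m22 S) * (m11 S - m22 S) + 4 * (m12 S * m21 S).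
Proof.
  destruct S as [a b a' b']; simpl; intros h.
  set (D := (a - b') * (a - b') + 4 * (b * a')).
  destruct (Rle_dec 0 D) as [hD | hD]; [exact hD | exfalso].
  assert (hb : b <> 0).
  { intros e; apply hD; unfold D; rewrite e.
    pose proof (Rle_0_sqr (a - b')) as hsq; unfold Rsqr in hsq; lra. }
  (* the root ((a + b') + i s) / 2 of the characteristic polynomial *)
  set (s := sqrt (- D)).
  assert (hs : s * s = - D) by (apply sqrt_sqrt; lra).
  assert (hs0 : 0 < s) by (apply sqrt_lt_R0; lra).
  enough (he : Im ((a + b') / 2, s / 2) = 0) by (simpl in he; lra).
  apply h; exists (RtoC b), ((b' - a) / 2, s / 2); split; [| split].
  - intros [e _]; apply hb; injection e; auto.
  - unfold Cmult, Cplus, RtoC; simpl; f_equal; field.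
  - unfold Cmult, Cplus, RtoC; simpl; unfold D in hs; f_equal; [| field].
    transitivity ((b' * b' - a * a) / 4 + (a' * b + b' * (b' - a) / 2
                  - (b' * b' - a * a) / 4)); [field |].
    transitivity ((b' * b' - a * a) / 4 - s * s / 4); [rewrite hs; field | field].
Qed.

(** * Null charts and the order of the Hopf differential *)

Lemma locally_box (P : R * R -> Prop) (x0 y0 : R) :
  locally (x0, y0) P <->
  exists r, 0 < r /\
    forall x y, Rabs (x - x0) < r -> Rabs (y - y0) < r -> P (x, y).
Proof.
  assert (hE : locally (x0, y0) P <-> locally (x0, y0) (fun z => P (fst z, snd z))).
  { split; apply filter_imp; intros [a b]; auto. }
  rewrite hE, <- (locally_2d_locally (fun a b => P (a, b))); split.
  - intros [r hr]; exists r; split; [apply cond_pos | exact hr].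
  - intros (r & hr & h); exists (mkposreal r hr); exact h.
Qed.

Lemma locally_box_0 (P : R * R -> Prop) :
  locally (0, 0) P <->
  exists r, 0 < r /\ forall x y, Rabs x < r -> Rabs y < r -> P (x, y).
Proof.
  rewrite locally_box; split; intros (r & hr & h); exists r; split; auto;
    intros x y; specialize (h x y); rewrite !Rminus_0_r in *; exact h.
Qed.

Definition null_plane (w : R * R) : R * R := (fst w + snd w, fst w - snd w).

Definition null_plane_inv (q : R * R) : R * R :=
  ((fst q + snd q) / 2, (fst q - snd q) / 2).

Lemma null_plane_inv_l (w : R * R) : null_plane_inv (null_plane w) = w.
Proof. destruct w; unfold null_plane_inv, null_plane; simpl; f_equal; field. Qed.

Lemma null_plane_inv_r (w : R * R) : null_plane (null_plane_inv w) = w.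
Proof. destruct w; unfold null_plane_inv, null_plane; simpl; f_equal; field. Qed.

Lemma smooth_null_plane (W : R * R -> Prop) :
  open W -> smooth_plane_map_on W null_plane.
Proof.
  intros hW; split.
  - apply (smooth_on_plus W fst snd); auto; [apply smooth_on_fst | apply smooth_on_snd].
  - apply (smooth_on_minus W fst snd); auto; [apply smooth_on_fst | apply smooth_on_snd].
Qed.

Lemma smooth_null_plane_inv (W : R * R -> Prop) :
  open W -> smooth_plane_map_on W null_plane_inv.
Proof.
  intros hW; destruct (smooth_null_plane W hW) as [h1 h2]; split.
  - apply (smooth_on_ext W (fun q => / 2 * fst (null_plane q))); auto.
    + intros; unfold null_plane, null_plane_inv; simpl; field.
    + now apply smooth_on_scal.
  - apply (smooth_on_ext W (fun q => / 2 * snd (null_plane q))); auto.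
    + intros; unfold null_plane, null_plane_inv; simpl; field.
    + now apply smooth_on_scal.
Qed.

Lemma jacobian_null_plane (w : R * R) : jacobian null_plane w = Mat2 1 1 1 (-1).
Proof.
  unfold jacobian, D1, D2, null_plane; simpl; f_equal;
    apply is_derive_unique; auto_derive; auto; ring.
Qed.

(** A null chart is a parametrization by coordinates [(x, y)] whose coordinate
    directions are isotropic; [H] on [V] is the inverse of [G] on [N]. *)
Record null_chart {c : R} (U : R * R -> Prop) (f : R * R -> ambient c) (p : R * R)
  (N : R * R -> Prop) (G : R * R -> R * R) (V : R * R -> Prop)
  (H : R * R -> R * R) : Prop := {
  nc_open_N : open N;
  nc_origin : N (0, 0);
  nc_center : G (0, 0) = p;
  nc_smooth_G : smooth_plane_map_on N G;
  nc_open_V : open V;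
  nc_subset : forall q, V q -> U q;
  nc_smooth_H : smooth_plane_map_on V H;
  nc_GH : forall w, N w -> V (G w) /\ H (G w) = w;
  nc_HG : forall q, V q -> N (H q) /\ G (H q) = q;
  nc_null : forall w, N w ->
    exists E, E <> 0 /\ first_form (pull G f) w = null_metric E }.

(** In null coordinates the Hopf differential is read on the diagonal of the
    second form: the two entries are functions of [x] and of [y] alone. *)
Definition null_splitting {c : R} (f nu : R * R -> ambient c) (G : R * R -> R * R)
  (phi1 phim1 : R -> R) : Prop :=
  smooth_germ phi1 /\ smooth_germ phim1 /\
  locally (0, 0) (fun w =>
    m11 (second_form (pull G f) (pull G nu) w) = phi1 (fst w) /\
    m22 (second_form (pull G f) (pull G nu) w) = phim1 (snd w)).

Definition null_order {c : R} (f nu : R * R -> ambient c) (G : R * R -> R * R)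
  (m : nat) : Prop :=
  exists phi1 phim1, null_splitting f nu G phi1 phim1 /\
    germ_order phi1 (Some m) /\ germ_order phim1 (Some m).

Section Isothermal.

Context {c : R} (U : R * R -> Prop) (f nu : R * R -> ambient c) (p : R * R)
  (W : R * R -> Prop) (g : R * R -> R * R)
  (hS : surface U f nu) (hg : isothermal_coordinates_centered_at U f p W g).

Let N (w : R * R) : Prop := W (null_plane w).
Let G (w : R * R) : R * R := g (null_plane w).

Lemma open_null_domain : open N.
Proof.
  destruct hg as [(hW & _) _].
  apply (open_comp null_plane W); [| exact hW].
  intros w _; apply (smooth_plane_map_continuous (fun _ => True)); [| exact I].
  apply smooth_null_plane, open_true.
Qed.

Lemma isothermal_null_chart : exists V H, null_chart U f p N G V H.
Proof.
  pose proof open_null_domain as hN.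
  destruct hg as [(hW & hW0 & hg0 & hgs & V & h & hV & hVU & hh & hgh & hhg)
                  (sigma & _ & hI)].
  destruct hS as (hU & hf & _).
  exists V, (fun q => null_plane_inv (h q)); split; auto.
  - unfold N, null_plane; simpl; now rewrite Rplus_0_l, Rminus_0_r.
  - unfold G, null_plane; simpl; now rewrite Rplus_0_l, Rminus_0_r.
  - apply (smooth_plane_map_compose W N g null_plane); auto.
    now apply smooth_null_plane.
  - apply (smooth_plane_map_compose W V null_plane_inv h); auto.
    + intros q hq; now apply hhg.
    + now apply smooth_null_plane_inv.
  - intros w hw; destruct (hgh _ hw) as [h1 h2]; split; [exact h1 |].
    unfold G; now rewrite h2, null_plane_inv_l.
  - intros q hq; destruct (hhg _ hq) as [h1 h2]; unfold N, G.
    now rewrite null_plane_inv_r.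
  - intros w hw; exists (2 * exp (2 * sigma (null_plane w))); split.
    + pose proof (exp_pos (2 * sigma (null_plane w))); lra.
    + change (pull G f) with (pull null_plane (pull g f)).
      assert (hgf : smooth_map_on W (pull g f)).
      { intros i hi; apply (smooth_on_compose U W (fun q => coord (f q) i) g); auto.
        intros z hz; apply hVU, hgh, hz. }
      rewrite (first_form_pull W N null_plane); auto;
        [| now apply smooth_null_plane].
      rewrite hI, jacobian_null_plane by exact hw.
      unfold pullback_form, mat2_mul, mat2_transpose, null_metric; simpl.
      f_equal; ring.
Qed.

Lemma locally_null_plane (P : R * R -> Prop) :
  locally (0, 0) P <-> locally (0, 0) (fun w => P (null_plane w)).
Proof.
  assert (h0 : null_plane (0, 0) = (0, 0))
    by (unfold null_plane; simpl; f_equal; ring).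
  assert (h0' : null_plane_inv (0, 0) = (0, 0))
    by (unfold null_plane_inv; simpl; f_equal; field).
  split; intros h.
  - apply (smooth_plane_map_continuous (fun _ => True) null_plane); auto.
    + apply smooth_null_plane, open_true.
    + now rewrite h0.
  - apply (filter_imp (fun w => P (null_plane (null_plane_inv w)))).
    { intros w; now rewrite null_plane_inv_r. }
    apply (smooth_plane_map_continuous (fun _ => True) null_plane_inv (0, 0)
             (smooth_null_plane_inv _ open_true) I (fun w => P (null_plane w))).
    now rewrite h0'.
Qed.

(** With [u = x + y] and [v = x - y] the diagonal entries of the second form
    are [L + N + 2 M] and [L + N - 2 M], the two components of the Hopf
    differential. *)
Lemma hopf_splitting_null (phi1 phim1 : R -> R) :
  hopf_splitting f nu g phi1 phim1 <-> null_splitting f nu G phi1 phim1.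
Proof.
  pose proof open_null_domain as hN.
  destruct hg as [(hW & hW0 & _ & hgs & V & h & _ & hVU & _ & hgh & _) _].
  assert (hgU : forall w, W w -> U (g w)) by (intros z hz; apply hVU, hgh, hz).
  assert (hSg : surface W (pull g f) (pull g nu))
    by (apply (surface_pull U W g); auto; apply hS).
  assert (hN0 : N (0, 0)).
  { unfold N, null_plane; simpl; now rewrite Rplus_0_l, Rminus_0_r. }
  assert (key : forall w, N w ->
    (hopf_coefficient f nu g (null_plane w)
     = pc_add (pc_mul pc_eps1
                 (pc_real (phi1 ((fst (null_plane w) + snd (null_plane w)) / 2))))
              (pc_mul pc_epsm1
                 (pc_real (phim1 ((fst (null_plane w) - snd (null_plane w)) / 2)))))
    <-> (m11 (second_form (pull G f) (pull G nu) w) = phi1 (fst w) /\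
         m22 (second_form (pull G f) (pull G nu) w) = phim1 (snd w))).
  { intros w hw.
    change (pull G f) with (pull null_plane (pull g f)).
    change (pull G nu) with (pull null_plane (pull g nu)).
    rewrite (second_form_pull W N null_plane); auto;
      [| now apply smooth_null_plane].
    rewrite jacobian_null_plane; unfold hopf_coefficient, second_form.
    set (L := coef_L _ _ _); set (M := coef_M _ _ _); set (N' := coef_N _ _ _).
    replace ((fst (null_plane w) + snd (null_plane w)) / 2) with (fst w)
      by (unfold null_plane; simpl; field).
    replace ((fst (null_plane w) - snd (null_plane w)) / 2) with (snd w)
      by (unfold null_plane; simpl; field).
    unfold pc_add, pc_mul, pc_real, pc_eps1, pc_epsm1, pc_j, pullback_form, mat2_mul,
      mat2_transpose; simpl.
    split.
    - intros e; injection e; intros; split; lra.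
    - intros [e1 e2]; rewrite <- e1, <- e2; f_equal; field. }
  unfold hopf_splitting, null_splitting.
  assert (hl : locally (0, 0) N) by now apply hN.
  split; intros (h1 & h2 & h3); split; auto; split; auto.
  - apply locally_null_plane in h3.
    generalize (filter_and _ _ hl h3); apply filter_imp; intros w [hw e].
    now apply key.
  - apply locally_null_plane.
    generalize (filter_and _ _ hl h3); apply filter_imp; intros w [hw e].
    now apply key.
Qed.

Lemma hopf_order_null (m : nat) : hopf_order f nu g m <-> null_order f nu G m.
Proof.
  unfold hopf_order, hopf_split_orders, null_order.
  split; intros (phi1 & phim1 & h & h'); exists phi1, phim1; split; auto;
    now apply hopf_splitting_null.
Qed.

End Isothermal.

(** Both germs are the restriction of the same function to the line [y = 0]. *)
Lemma null_splitting_unique {c : R} (f nu : R * R -> ambient c) (G : R * R -> R * R)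
  (phi1 phim1 psi1 psim1 : R -> R) :
  null_splitting f nu G phi1 phim1 -> null_splitting f nu G psi1 psim1 ->
  locally 0 (fun x => phi1 x = psi1 x).
Proof.
  intros (_ & _ & h1) (_ & _ & h2).
  generalize (filter_and _ _ h1 h2); intros h.
  apply (locally_prod_fst _ (0, 0)) in h; simpl in h; revert h; apply filter_imp.
  intros x [[e1 _] [e2 _]]; now rewrite <- e1, <- e2.
Qed.

Lemma null_order_unique {c : R} (f nu : R * R -> ambient c) (G : R * R -> R * R)
  (m n : nat) : null_order f nu G m -> null_order f nu G n -> m = n.
Proof.
  intros (phi1 & phim1 & h & h1 & _) (psi1 & psim1 & h' & h2 & _).
  apply (germ_order_unique psi1); [| exact h2].
  apply (germ_order_ext phi1); [| exact h1].
  now apply (null_splitting_unique f nu G phi1 phim1 psi1 psim1).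
Qed.

(** This is the change of variable [x -> a(x)] in the quadratic differential
    [phi(x) dx^2].  As [D2 a = 0], the function [a] depends on the first variable
    only; it is that variable times a unit, and [D1 a] is a unit, so both factors
    leave the order of vanishing unchanged. *)
Lemma order_reparametrization (O : R * R -> Prop) (a : R * R -> R) (phi : R -> R)
  (m : nat) :
  open O -> O (0, 0) -> smooth_on O a -> a (0, 0) = 0 -> D1 a (0, 0) <> 0 ->
  locally (0, 0) (fun w => D2 a w = 0) ->
  smooth_germ phi -> germ_order phi (Some m) ->
  exists phi', smooth_germ phi' /\ germ_order phi' (Some m) /\
    locally (0, 0) (fun w => D1 a w * D1 a w * phi (a w) = phi' (fst w)).
Proof.
  intros hO hO0 ha ha0 hD hD2 hphi hm.
  apply smooth_germ_near in hphi as (d & hd & hphi).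
  destruct (germ_order_factor d phi m hd hphi hm) as (psi & hpsi & hpsi0 & hfac).
  assert (had : locally (0, 0) (fun w => Rabs (a w) < d)).
  { apply (smooth_on_continuous O a (0, 0) ha hO0 (fun t => Rabs t < d)).
    rewrite ha0; apply open_Rabs_lt; now rewrite Rabs_R0. }
  generalize (filter_and _ _ (hO _ hO0) (filter_and _ _ hD2 had)).
  intros h; apply locally_box_0 in h as (r & hr & h).
  pose proof (proj1 (smooth_on_D _ _) ha) as (_ & _ & ha2 & _).
  assert (hconst : forall x y, Rabs x < r -> Rabs y < r -> a (x, y) = a (x, 0)).
  { intros x y hx hy.
    assert (hs : forall t, Rmin 0 y <= t <= Rmax 0 y -> Rabs t < r).
    { intros t; unfold Rmin, Rmax, Rabs in *.
      destruct (Rle_dec 0 y), (Rcase_abs t), (Rcase_abs y); lra. }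
    destruct (MVT_gen (fun t => a (x, t)) 0 y (fun t => D2 a (x, t))) as (t & ht & e).
    - intros t ht; apply (Derive_correct (fun t => a (x, t))), (ha2 (x, t)).
      apply h; [exact hx | apply hs; lra].
    - intros t ht; apply continuity_pt_filterlim.
      apply (ex_derive_continuous (fun t => a (x, t))), (ha2 (x, t)), h; auto.
    - destruct (h x t hx (hs t ht)) as (_ & e' & _); rewrite e' in e; lra. }
  set (B := fun q : R * R => Rabs (fst q) < r /\ Rabs (snd q) < r).
  assert (hB : open B) by (apply open_and; [apply open_strip | apply open_strip_snd]).
  assert (hBO : forall q, B q -> O q) by (intros [x y] [hx hy]; now apply h).
  assert (haB : smooth_on B a) by now apply (smooth_on_subset O).
  assert (hB0 : forall x, Rabs x < r -> B (x, 0))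
    by (intros x hx; split; simpl; [exact hx | now rewrite Rabs_R0]).
  assert (halpha : smooth_near r (fun x => a (x, 0)))
    by (intros x hx; apply (smooth_on_horizontal B); auto).
  destruct (hadamard r (fun x => a (x, 0)) halpha ha0) as (alpha & k1 & k2 & k3).
  specialize (k3 hr 0%nat).
  assert (hal0 : alpha 0 = D1 a (0, 0)).
  { symmetry; transitivity (1 * alpha 0); [exact k3 | ring]. }
  assert (hF : smooth_on B (fun w => D1 a w * D1 a w * phi (a w))).
  { assert (smooth_on B (D1 a)) by now apply smooth_on_D1.
    apply smooth_on_mult; [exact hB | now apply smooth_on_mult |].
    apply (smooth_on_fst_comp B d); auto.
    intros [x y] [hx hy]; now apply h. }
  assert (hphi' : smooth_near r (fun x => D1 a (x, 0) * D1 a (x, 0) * phi (a (x, 0)))).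
  { intros x hx.
    apply (smooth_on_horizontal B (fun w => D1 a w * D1 a w * phi (a w)) x 0); auto. }
  exists (fun x => D1 a (x, 0) * D1 a (x, 0) * phi (a (x, 0))).
  split; [apply smooth_germ_near; eauto |]; split.
  - apply (germ_order_of_factor r _
      (fun x => D1 a (x, 0) * D1 a (x, 0) * (alpha x ^ m * psi (a (x, 0))))); auto.
    + assert (c0 : Rabs 0 < r) by now rewrite Rabs_R0.
      assert (cD : continuous (fun x => D1 a (x, 0)) 0).
      { apply (ex_derive_continuous (fun x => D1 a (x, 0))).
        apply (smooth_on_horizontal B (D1 a) 0 0 (smooth_on_D1 _ _ haB) (hB0 0 c0) 1%nat). }
      apply (continuous_mult (fun x => D1 a (x, 0) * D1 a (x, 0))
               (fun x => alpha x ^ m * psi (a (x, 0)))).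
      * now apply (continuous_mult (fun x => D1 a (x, 0)) (fun x => D1 a (x, 0))).
      * apply (continuous_mult (fun x => alpha x ^ m) (fun x => psi (a (x, 0)))).
        -- apply (continuous_comp alpha (fun t => t ^ m)).
           ++ now apply (smooth_near_continuous r).
           ++ apply (ex_derive_continuous (fun t => t ^ m)); auto_derive; exact I.
        -- apply (continuous_comp (fun x => a (x, 0)) psi).
           ++ now apply (smooth_near_continuous r (fun x => a (x, 0))).
           ++ assert (cpsi : continuous psi (a (0, 0))); [| exact cpsi].
              rewrite ha0; apply (smooth_near_continuous d); auto.
              now rewrite Rabs_R0.
    + rewrite ha0, hal0; repeat apply Rmult_integral_contrapositive_currified; auto.
      now apply pow_nonzero.
    + intros x hx _; rewrite hfac by (apply h; [exact hx | now rewrite Rabs_R0]).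
      rewrite (k2 x hx) at 1; rewrite Rpow_mult_distr; ring.
  - apply locally_box_0; exists r; split; [exact hr |]; intros x y hx hy; simpl.
    rewrite hconst by auto.
    replace (D1 a (x, y)) with (D1 a (x, 0)); [reflexivity |].
    unfold D1; simpl; apply Derive_ext_loc.
    generalize (open_Rabs_lt r x hx); apply filter_imp; intros t ht.
    symmetry; now apply hconst.
Qed.

Definition swap (w : R * R) : R * R := (snd w, fst w).

Lemma smooth_swap (W : R * R -> Prop) : smooth_plane_map_on W swap.
Proof. split; [apply smooth_on_snd | apply smooth_on_fst]. Qed.

Lemma continuous_swap (w : R * R) : continuous swap w.
Proof.
  apply (smooth_plane_map_continuous (fun _ => True)); [apply smooth_swap | exact I].
Qed.

Lemma locally_swap (P : R * R -> Prop) (x y : R) :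
  locally (x, y) P -> locally (y, x) (fun w => P (swap w)).
Proof. intros h; apply (continuous_swap (y, x)), h. Qed.

Lemma order_reparametrization_swap (O : R * R -> Prop) (a : R * R -> R)
  (phi : R -> R) (m : nat) :
  open O -> O (0, 0) -> smooth_on O a -> a (0, 0) = 0 -> D2 a (0, 0) <> 0 ->
  locally (0, 0) (fun w => D1 a w = 0) ->
  smooth_germ phi -> germ_order phi (Some m) ->
  exists phi', smooth_germ phi' /\ germ_order phi' (Some m) /\
    locally (0, 0) (fun w => D2 a w * D2 a w * phi (a w) = phi' (snd w)).
Proof.
  intros hO hO0 ha ha0 hD hD2 hphi hm.
  destruct (order_reparametrization (fun w => O (swap w)) (fun w => a (swap w)) phi m)
    as (phi' & h1 & h2 & h3); auto.
  - apply (open_comp swap O); [intros w _; apply continuous_swap | exact hO].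
  - apply (smooth_on_compose O); auto; [| apply smooth_swap].
    apply (open_comp swap O); [intros w _; apply continuous_swap | exact hO].
  - exact (locally_swap _ 0 0 hD2).
  - exists phi'; split; [exact h1 |]; split; [exact h2 |].
    apply locally_swap in h3; revert h3; apply filter_imp; intros [x y]; auto.
Qed.

Lemma second_form_components {c : R} (F N : R * R -> ambient c) (q : R * R) :
  second_form F N q
  = Mat2 (m11 (second_form F N q)) (m12 (second_form F N q))
         (m12 (second_form F N q)) (m22 (second_form F N q)).
Proof. reflexivity. Qed.

Lemma pullback_null_metric (J : mat2) (E : R) :
  pullback_form J (null_metric E)
  = Mat2 (2 * (m11 J * m21 J) * E) ((m11 J * m22 J + m21 J * m12 J) * E)
         ((m11 J * m22 J + m21 J * m12 J) * E) (2 * (m12 J * m22 J) * E).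
Proof.
  unfold pullback_form, mat2_mul, mat2_transpose, null_metric; simpl; f_equal; ring.
Qed.

Lemma locally_neq_0 (O : R * R -> Prop) (F : R * R -> R) (q : R * R) :
  smooth_on O F -> O q -> F q <> 0 -> locally q (fun z => F z <> 0).
Proof.
  intros hF hq hn; apply (smooth_on_continuous O F q hF hq (fun t => t <> 0)).
  apply (open_neq 0), hn.
Qed.

(** A change of null charts preserves the pair of isotropic directions, so it
    is a product of two one-variable changes, up to exchange of the two
    coordinates; as both split-orders are equal, an exchange is harmless. *)
Lemma null_order_transfer {c : R} (U : R * R -> Prop) (f nu : R * R -> ambient c)
  (p : R * R) (N N' : R * R -> Prop) (G G' : R * R -> R * R)
  (V V' : R * R -> Prop) (H H' : R * R -> R * R) (m : nat) :
  surface U f nu -> null_chart U f p N G V H -> null_chart U f p N' G' V' H' ->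
  null_order f nu G m -> null_order f nu G' m.
Proof.
  intros hS hG hG' (phi1 & phim1 & (hs1 & hsm1 & hII) & ho1 & hom1).
  set (O := fun w => N' w /\ V (G' w)).
  set (tau := fun w => H (G' w)).
  assert (hO : open O).
  { apply open_preimage; [apply hG | apply hG' | apply hG']. }
  assert (htau : smooth_plane_map_on O tau).
  { apply (smooth_plane_map_compose V O H G'); auto.
    - apply hG.
    - now intros w [_ hw].
    - apply hG.
    - apply (smooth_plane_map_subset N'); [now intros w [hw _] | apply hG']. }
  assert (hON : forall w, O w -> N (tau w)) by (intros w [_ hw]; now apply hG).
  assert (hO0 : O (0, 0)).
  { split; [apply hG' |]; rewrite (nc_center _ _ _ _ _ _ _ hG').
    rewrite <- (nc_center _ _ _ _ _ _ _ hG); apply hG, hG. }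
  assert (htau0 : tau (0, 0) = (0, 0)).
  { unfold tau; rewrite (nc_center _ _ _ _ _ _ _ hG').
    rewrite <- (nc_center _ _ _ _ _ _ _ hG); apply hG, hG. }
  assert (hGU : forall w, N w -> U (G w)).
  { intros w hw; apply hG; now apply hG. }
  assert (hSG : surface N (pull G f) (pull G nu))
    by (apply (surface_pull U N G); auto; [apply hS | apply hG | apply hG]).
  assert (heq : forall (X : R * R -> ambient c) w, O w ->
            locally w (fun z => pull G' X z = pull tau (pull G X) z)).
  { intros X w hw; generalize (hO w hw); apply filter_imp; intros z [_ hz].
    unfold pull, tau; now rewrite (proj2 (nc_HG _ _ _ _ _ _ _ hG _ hz)). }
  assert (hI : forall w, O w -> exists E E', E' <> 0 /\
            null_metric E' = pullback_form (jacobian tau w) (null_metric E)).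
  { intros w hw; destruct (nc_null _ _ _ _ _ _ _ hG (tau w) (hON w hw)) as (E & _ & e).
    destruct (nc_null _ _ _ _ _ _ _ hG' w (proj1 hw)) as (E' & hE' & e').
    exists E, E'; split; [exact hE' |].
    rewrite <- e, <- e', (first_form_ext_loc _ _ w (heq f w hw)).
    apply (first_form_pull N O tau); auto; apply hSG || apply hG. }
  assert (hJ : forall w, O w ->
            m11 (jacobian tau w) * m21 (jacobian tau w) = 0 /\
            m12 (jacobian tau w) * m22 (jacobian tau w) = 0 /\
            m11 (jacobian tau w) * m22 (jacobian tau w)
            + m21 (jacobian tau w) * m12 (jacobian tau w) <> 0).
  { intros w hw; destruct (hI w hw) as (E & E' & hE' & e).
    rewrite pullback_null_metric in e; unfold null_metric in e.
    pose proof (f_equal m11 e) as e1; pose proof (f_equal m12 e) as e2.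
    pose proof (f_equal m22 e) as e3; cbn [m11 m12 m22] in e1, e2, e3.
    assert (hE : E <> 0) by (intros z; apply hE'; rewrite e2, z; ring).
    split; [| split].
    - apply (Rmult_eq_reg_r (2 * E)); [lra | intros z; apply hE; lra].
    - apply (Rmult_eq_reg_r (2 * E)); [lra | intros z; apply hE; lra].
    - intros z; apply hE'; rewrite e2, z; ring. }
  assert (hIIw : forall w, O w ->
            second_form (pull G' f) (pull G' nu) w
            = pullback_form (jacobian tau w)
                (second_form (pull G f) (pull G nu) (tau w))).
  { intros w hw; rewrite (second_form_ext_loc _ _ _ _ w (heq f w hw) (heq nu w hw)).
    apply (second_form_pull N O tau); auto; apply hG. }
  assert (hlocO : locally (0, 0) O) by now apply hO.
  assert (hII' : locally (0, 0) (fun w =>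
            m11 (second_form (pull G f) (pull G nu) (tau w)) = phi1 (fst (tau w)) /\
            m22 (second_form (pull G f) (pull G nu) (tau w)) = phim1 (snd (tau w)))).
  { apply (smooth_plane_map_continuous O tau (0, 0) htau hO0 (fun z =>
      m11 (second_form (pull G f) (pull G nu) z) = phi1 (fst z) /\
      m22 (second_form (pull G f) (pull G nu) z) = phim1 (snd z))).
    rewrite htau0; exact hII. }
  destruct htau as [ht1 ht2].
  pose proof (smooth_on_D1 _ _ ht1) as h11; pose proof (smooth_on_D2 _ _ ht1) as h12.
  pose proof (smooth_on_D1 _ _ ht2) as h21; pose proof (smooth_on_D2 _ _ ht2) as h22.
  assert (e1 : fst (tau (0, 0)) = 0) by now rewrite htau0.
  assert (e2 : snd (tau (0, 0)) = 0) by now rewrite htau0.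
  destruct (hJ _ hO0) as (j1 & j2 & j3).
  unfold jacobian in j1, j2, j3; simpl in j1, j2, j3.
  destruct (Req_dec (D1 (fun z => fst (tau z)) (0, 0)) 0) as [z | nz].
  - (* the coordinates are exchanged *)
    rewrite z in j3.
    assert (n21 : D1 (fun z => snd (tau z)) (0, 0) <> 0)
      by (intros e; apply j3; rewrite e; ring).
    assert (n12 : D2 (fun z => fst (tau z)) (0, 0) <> 0)
      by (intros e; apply j3; rewrite e; ring).
    pose proof (locally_neq_0 O _ _ h21 hO0 n21) as l21.
    pose proof (locally_neq_0 O _ _ h12 hO0 n12) as l12.
    assert (l11 : locally (0, 0) (fun w => D1 (fun z => fst (tau z)) w = 0)).
    { generalize (filter_and _ _ hlocO l21); apply filter_imp; intros w [hw hn].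
      destruct (hJ w hw) as (i1 & _); unfold jacobian in i1; simpl in i1.
      apply Rmult_integral in i1; tauto. }
    assert (l22 : locally (0, 0) (fun w => D2 (fun z => snd (tau z)) w = 0)).
    { generalize (filter_and _ _ hlocO l12); apply filter_imp; intros w [hw hn].
      destruct (hJ w hw) as (_ & i1 & _); unfold jacobian in i1; simpl in i1.
      apply Rmult_integral in i1; tauto. }
    destruct (order_reparametrization O _ phim1 m hO hO0 ht2 e2 n21 l22 hsm1 hom1)
      as (psi1 & p1 & p2 & p3).
    destruct (order_reparametrization_swap O _ phi1 m hO hO0 ht1 e1 n12 l11 hs1 ho1)
      as (psim1 & q1 & q2 & q3).
    exists psi1, psim1; split; [| auto]; split; [exact p1 |]; split; [exact q1 |].
    generalize (filter_and _ _ (filter_and _ _ hlocO hII')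
      (filter_and _ _ (filter_and _ _ l11 l22) (filter_and _ _ p3 q3))).
    apply filter_imp; intros w [[hw [k1 k2]] [[z11 z22] [k3 k4]]].
    rewrite hIIw, second_form_components by exact hw.
    unfold pullback_form, mat2_mul, mat2_transpose, jacobian.
    cbn [m11 m12 m21 m22].
    rewrite k1, k2, z11, z22, <- k3, <- k4; split; ring.
  - (* each coordinate is a function of the coordinate of the same name *)
    assert (n22 : D2 (fun z => snd (tau z)) (0, 0) <> 0).
    { intros e; apply j3; rewrite e.
      apply Rmult_integral in j1 as [j1 | j1]; [contradiction |]; rewrite j1; ring. }
    pose proof (locally_neq_0 O _ _ h11 hO0 nz) as l11.
    pose proof (locally_neq_0 O _ _ h22 hO0 n22) as l22.
    assert (l21 : locally (0, 0) (fun w => D1 (fun z => snd (tau z)) w = 0)).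
    { generalize (filter_and _ _ hlocO l11); apply filter_imp; intros w [hw hn].
      destruct (hJ w hw) as (i1 & _); unfold jacobian in i1; simpl in i1.
      apply Rmult_integral in i1; tauto. }
    assert (l12 : locally (0, 0) (fun w => D2 (fun z => fst (tau z)) w = 0)).
    { generalize (filter_and _ _ hlocO l22); apply filter_imp; intros w [hw hn].
      destruct (hJ w hw) as (_ & i1 & _); unfold jacobian in i1; simpl in i1.
      apply Rmult_integral in i1; tauto. }
    destruct (order_reparametrization O _ phi1 m hO hO0 ht1 e1 nz l12 hs1 ho1)
      as (psi1 & p1 & p2 & p3).
    destruct (order_reparametrization_swap O _ phim1 m hO hO0 ht2 e2 n22 l21 hsm1 hom1)
      as (psim1 & q1 & q2 & q3).
    exists psi1, psim1; split; [| auto]; split; [exact p1 |]; split; [exact q1 |].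
    generalize (filter_and _ _ (filter_and _ _ hlocO hII')
      (filter_and _ _ (filter_and _ _ l21 l12) (filter_and _ _ p3 q3))).
    apply filter_imp; intros w [[hw [k1 k2]] [[z21 z12] [k3 k4]]].
    rewrite hIIw, second_form_components by exact hw.
    unfold pullback_form, mat2_mul, mat2_transpose, jacobian.
    cbn [m11 m12 m21 m22].
    rewrite k1, k2, z21, z12, <- k3, <- k4; split; ring.
Qed.

(** The Gram determinant of an orthonormal pair of signature [(+ -)] is [-1], and
    it is the determinant of the first form times a square. *)
Lemma time_like_first_form_det {c : R} (U : R * R -> Prop) (f : R * R -> ambient c)
  (q : R * R) :
  time_like_on U f -> U q -> mat2_det (first_form f q) <> 0.
Proof.
  intros ht hq; destruct (ht q hq) as ([a b] & [a' b'] & h1 & h2 & h3).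
  revert h1 h2 h3; unfold mat2_form, mat2_app, mat2_det, first_form; simpl.
  rewrite (inner_sym (d_v f q) (d_u f q)).
  set (I11 := inner (d_u f q) (d_u f q)); set (I12 := inner (d_u f q) (d_v f q)).
  set (I22 := inner (d_v f q) (d_v f q)); intros h1 h2 h3 hd.
  assert (e : (I11 * I22 - I12 * I12) * ((a * b' - b * a') * (a * b' - b * a'))
              = (a * (I11 * a + I12 * b) + b * (I12 * a + I22 * b))
                * (a' * (I11 * a' + I12 * b') + b' * (I12 * a' + I22 * b'))
                - (a * (I11 * a' + I12 * b') + b * (I12 * a' + I22 * b'))
                  * (a * (I11 * a' + I12 * b') + b * (I12 * a' + I22 * b'))) by ring.
  rewrite h1, h2, h3, hd in e; lra.
Qed.

Section Chart.

Context {c : R} (U : R * R -> Prop) (f nu : R * R -> ambient c) (p : R * R)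
  (N : R * R -> Prop) (G : R * R -> R * R) (V : R * R -> Prop) (H : R * R -> R * R)
  (hS : surface U f nu) (ht : time_like_on U f) (hG : null_chart U f p N G V H).

Let II (w : R * R) : mat2 := second_form (pull G f) (pull G nu) w.

Lemma chart_center_inv : H p = (0, 0).
Proof. rewrite <- (nc_center _ _ _ _ _ _ _ hG); apply hG, hG. Qed.

Lemma chart_center_in : V p.
Proof. rewrite <- (nc_center _ _ _ _ _ _ _ hG); apply hG, hG. Qed.

Lemma chart_shape (q : R * R) :
  V q -> mat2_det (jacobian H q) <> 0 /\
  exists E, E <> 0 /\
    shape_operator f nu q
    = shape_of_forms (pullback_form (jacobian H q) (null_metric E))
        (pullback_form (jacobian H q)
           (Mat2 (m11 (II (H q))) (m12 (II (H q))) (m12 (II (H q))) (m22 (II (H q))))).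
Proof.
  intros hq.
  assert (hGU : forall w, N w -> U (G w)) by (intros w hw; apply hG; now apply hG).
  assert (hSG : surface N (pull G f) (pull G nu))
    by (apply (surface_pull U N G); auto; [apply hS | apply hG | apply hG]).
  assert (heq : forall X : R * R -> ambient c,
            locally q (fun z => X z = pull H (pull G X) z)).
  { intros X; generalize (nc_open_V _ _ _ _ _ _ _ hG q hq); apply filter_imp.
    intros z hz; unfold pull; now rewrite (proj2 (nc_HG _ _ _ _ _ _ _ hG _ hz)). }
  assert (hVN : forall z, V z -> N (H z)) by (intros z hz; now apply hG).
  destruct (nc_null _ _ _ _ _ _ _ hG (H q) (hVN q hq)) as (E & hE & e).
  assert (hI : first_form f q = pullback_form (jacobian H q) (null_metric E)).
  { rewrite <- e, (first_form_ext_loc f (pull H (pull G f)) q (heq f)).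
    apply (first_form_pull N V H); auto; apply hSG || apply hG. }
  assert (hII : second_form f nu q = pullback_form (jacobian H q) (II (H q))).
  { rewrite (second_form_ext_loc _ _ _ _ q (heq f) (heq nu)).
    apply (second_form_pull N V H); auto; apply hG. }
  split.
  - intros z; apply (time_like_first_form_det U f q ht (nc_subset _ _ _ _ _ _ _ hG q hq)).
    rewrite hI, pullback_null_metric.
    destruct (jacobian H q) as [a b a' b']; revert z; unfold mat2_det; simpl; intros z.
    transitivity (- (E * E) * ((a * b' - b * a') * (a * b' - b * a'))); [ring |].
    rewrite z; ring.
  - exists E; split; [exact hE |].
    unfold shape_operator, shape_of_forms; now rewrite hI, hII.
Qed.

Lemma chart_principal_direction (q w : R * R) (k : R) :
  V q -> mat2_app (shape_operator f nu q) w = (k * fst w, k * snd w) ->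
  m11 (II (H q)) * (fst (mat2_app (jacobian H q) w) * fst (mat2_app (jacobian H q) w))
  = m22 (II (H q)) * (snd (mat2_app (jacobian H q) w) * snd (mat2_app (jacobian H q) w)).
Proof.
  intros hq; destruct (chart_shape q hq) as (hK & E & hE & e); rewrite e.
  now apply null_principal_direction.
Qed.

Lemma chart_principal_direction_conv (q w : R * R) :
  V q ->
  m11 (II (H q)) * (fst (mat2_app (jacobian H q) w) * fst (mat2_app (jacobian H q) w))
  = m22 (II (H q)) * (snd (mat2_app (jacobian H q) w) * snd (mat2_app (jacobian H q) w)) ->
  exists k, mat2_app (shape_operator f nu q) w = (k * fst w, k * snd w).
Proof.
  intros hq; destruct (chart_shape q hq) as (hK & E & hE & e); rewrite e.
  now apply null_principal_direction_conv.
Qed.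

Lemma chart_umbilic (q : R * R) :
  V q -> umbilic f nu q -> m11 (II (H q)) = 0 /\ m22 (II (H q)) = 0.
Proof.
  intros hq [k hk]; destruct (chart_shape q hq) as (hK & E & hE & e).
  rewrite e in hk; exact (null_umbilic _ _ _ _ _ hK hE k hk).
Qed.

Lemma chart_real_curvatures (q : R * R) :
  V q -> (forall l, principal_curvature f nu q l -> Im l = 0) ->
  0 <= m11 (II (H q)) * m22 (II (H q)).
Proof.
  intros hq hr; destruct (chart_shape q hq) as (hK & E & hE & e).
  pose proof (real_eigenvalues_discriminant _ hr) as hd.
  rewrite e, null_discriminant in hd by auto.
  set (x := m11 (II (H q)) * m22 (II (H q))) in *.
  assert (hE2 : 0 < E * E) by (assert (0 < E \/ E < 0) as [?|?] by lra; nra).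
  replace x with (4 * x / (E * E) * (E * E / 4)) by (field; exact hE).
  apply Rmult_le_pos; lra.
Qed.

End Chart.

Lemma locally_same_sign (psi : R -> R) :
  continuous psi 0 -> psi 0 <> 0 ->
  exists r, 0 < r /\ forall x, Rabs x < r -> 0 < psi x * psi 0.
Proof.
  intros hc hn.
  assert (hc' : continuous (fun x => psi x * psi 0) 0)
    by (apply (continuous_mult psi (fun _ => psi 0)); auto; apply continuous_const).
  assert (h0 : 0 < psi 0 * psi 0) by (assert (0 < psi 0 \/ psi 0 < 0) as [?|?] by lra; nra).
  apply locally_Rabs, (hc' (fun t => 0 < t)), (open_gt 0), h0.
Qed.

(** Compare the points [(t, t)] and [(- t, t)] for small [t]: the units keep
    their signs, and for odd [m] the power changes its own. *)
Lemma even_of_nonneg (r : R) (psi1 psim1 : R -> R) (m : nat) :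
  0 < r -> continuous psi1 0 -> continuous psim1 0 -> psi1 0 <> 0 -> psim1 0 <> 0 ->
  (forall x y, Rabs x < r -> Rabs y < r ->
     0 <= (x ^ m * psi1 x) * (y ^ m * psim1 y)) ->
  Nat.Even m /\ 0 < psi1 0 * psim1 0.
Proof.
  intros hr c1 cm n1 nm h.
  destruct (locally_same_sign psi1 c1 n1) as (r1 & hr1 & s1).
  destruct (locally_same_sign psim1 cm nm) as (rm & hrm & sm).
  set (t := Rmin r (Rmin r1 rm) / 2).
  assert (ht : 0 < t /\ t < r /\ t < r1 /\ t < rm).
  { pose proof (Rmin_pos r1 rm hr1 hrm).
    pose proof (Rmin_pos r (Rmin r1 rm) hr ltac:(lra)).
    pose proof (Rmin_l r (Rmin r1 rm)); pose proof (Rmin_r r (Rmin r1 rm)).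
    pose proof (Rmin_l r1 rm); pose proof (Rmin_r r1 rm); unfold t; lra. }
  destruct ht as (t0 & tr & t1 & tm).
  assert (at1 : Rabs t = t) by (apply Rabs_pos_eq; lra).
  assert (at2 : Rabs (- t) = t) by now rewrite Rabs_Ropp.
  assert (htm : 0 < t ^ m) by now apply pow_lt.
  pose proof (s1 t ltac:(lra)) as p1; pose proof (sm t ltac:(lra)) as p2.
  pose proof (s1 (- t) ltac:(lra)) as p3.
  pose proof (h t t ltac:(lra) ltac:(lra)) as q1.
  pose proof (h (- t) t ltac:(lra) ltac:(lra)) as q2.
  assert (f1 : 0 < psi1 0 * psim1 0).
  { assert (g : 0 <= psi1 t * psim1 t).
    { apply (Rmult_le_reg_l (t ^ m * t ^ m)); [now apply Rmult_lt_0_compat |].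
      rewrite Rmult_0_r; eapply Rle_trans; [exact q1 |]; right; ring. }
    assert (g' : 0 < (psi1 t * psi1 0) * (psim1 t * psim1 0)) by now apply Rmult_lt_0_compat.
    assert (g2 : (psi1 t * psim1 t) * (psi1 0 * psim1 0)
                 = (psi1 t * psi1 0) * (psim1 t * psim1 0)) by ring.
    destruct (Rlt_dec 0 (psi1 0 * psim1 0)) as [k | k]; [exact k | exfalso].
    apply Rnot_lt_le in k; nra. }
  split; [| exact f1].
  destruct (Nat.Even_or_Odd m) as [e | o]; [exact e | exfalso].
  assert (hneg : (- t) ^ m = - t ^ m).
  { destruct o as [k ->]; rewrite !pow_add, !pow_mult; simpl.
    replace (- t * (- t * 1)) with (t * (t * 1)) by ring; ring. }
  rewrite hneg in q2.
  assert (g : psi1 (- t) * psim1 t <= 0).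
  { apply (Rmult_le_reg_l (t ^ m * t ^ m)); [now apply Rmult_lt_0_compat |].
    rewrite Rmult_0_r; apply Ropp_le_cancel; rewrite Ropp_0.
    eapply Rle_trans; [exact q2 |]; right; ring. }
  assert (g' : 0 < (psi1 (- t) * psi1 0) * (psim1 t * psim1 0)) by now apply Rmult_lt_0_compat.
  assert (g2 : (psi1 (- t) * psim1 t) * (psi1 0 * psim1 0)
               = (psi1 (- t) * psi1 0) * (psim1 t * psim1 0)) by ring.
  nra.
Qed.

(** * A curvature line flow of index one *)

Definition ray (p e : R * R) (s : R) : R * R := (fst p + s * fst e, snd p + s * snd e).

Definition dir (t : R) : R * R := (cos t, sin t).

Lemma dir_bound (t : R) : Rabs (fst (dir t)) <= 1 /\ Rabs (snd (dir t)) <= 1.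
Proof.
  split; simpl; apply Rabs_le; [apply COS_bound | apply SIN_bound].
Qed.

Lemma dir_half (t : R) : / 2 <= Rabs (fst (dir t)) \/ / 2 <= Rabs (snd (dir t)).
Proof.
  pose proof (sin2_cos2 t) as h; unfold Rsqr in h; simpl.
  unfold Rabs; destruct (Rcase_abs (cos t)), (Rcase_abs (sin t));
    destruct (Rle_dec (/ 2) (cos t)), (Rle_dec (/ 2) (- cos t)),
      (Rle_dec (/ 2) (sin t)), (Rle_dec (/ 2) (- sin t)); auto; exfalso; nra.
Qed.

Lemma mean_value_ray (V : R * R -> Prop) (F : R * R -> R) (p e : R * R) (r s : R) :
  open V -> smooth_on V F ->
  (forall x y, Rabs (x - fst p) < r -> Rabs (y - snd p) < r -> V (x, y)) ->
  Rabs (fst e) <= 1 -> Rabs (snd e) <= 1 -> 0 < s < r ->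
  exists xi, 0 <= xi <= s /\
    F (ray p e s) - F p
    = s * (D1 F (ray p e xi) * fst e + D2 F (ray p e xi) * snd e).
Proof.
  intros hV hF hr h1 h2 hs.
  assert (hin : forall t, Rmin 0 s <= t <= Rmax 0 s -> V (ray p e t)).
  { intros t; rewrite Rmin_left, Rmax_right by lra; intros ht; apply hr.
    - replace (fst p + t * fst e - fst p) with (t * fst e) by ring.
      rewrite Rabs_mult, (Rabs_pos_eq t) by lra; pose proof (Rabs_pos (fst e)); nra.
    - replace (snd p + t * snd e - snd p) with (t * snd e) by ring.
      rewrite Rabs_mult, (Rabs_pos_eq t) by lra; pose proof (Rabs_pos (snd e)); nra. }
  assert (hd : forall t, Rmin 0 s <= t <= Rmax 0 s ->
            is_derive (fun t => F (ray p e t)) t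
              (D1 F (ray p e t) * fst e + D2 F (ray p e t) * snd e)).
  { intros t ht; apply (C1_is_derive_curve V F (fun t => fst p + t * fst e)
                          (fun t => snd p + t * snd e)); auto.
    - now apply smooth_on_Ck.
    - exact (hin t ht).
    - auto_derive; [exact I | ring].
    - auto_derive; [exact I | ring]. }
  destruct (MVT_gen (fun t => F (ray p e t)) 0 s
    (fun t => D1 F (ray p e t) * fst e + D2 F (ray p e t) * snd e)) as (xi & hxi & e').
  - intros t ht; apply hd; lra.
  - intros t ht; apply continuity_pt_filterlim.
    apply (ex_derive_continuous (fun t => F (ray p e t))); eexists; now apply hd.
  - rewrite Rmin_left, Rmax_right in hxi by lra; exists xi; split; [exact hxi |].
    replace (F p) with (F (ray p e 0)).
    + rewrite e'; ring.
    + unfold ray; rewrite !Rmult_0_l, !Rplus_0_r; now destruct p.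
Qed.

(** For odd [n] the sum [x * x ^ n * h + y * y ^ n * h'] is positive and of the
    order of the [(n + 1)]-st power of the larger of [|x|] and [|y|]; replacing
    one factor [x], [y] by [x'], [y'] costs a small multiple of it. *)
Lemma odd_pow_estimate (n : nat) (a b k eta s x y x' y' h h' : R) :
  Nat.Odd n -> 0 < a -> a <= h <= b -> a <= h' <= b -> 0 < s -> 0 <= eta ->
  0 < k -> 2 * eta * b < a * k ->
  Rabs (x' - x) <= eta * s -> Rabs (y' - y) <= eta * s ->
  k * s <= Rabs x \/ k * s <= Rabs y ->
  0 < x' * (x ^ n * h) + y' * (y ^ n * h').
Proof.
  intros [j hn] ha hh hh' hs heta hk hkey hx hy hR.
  assert (hpow : forall z, z * z ^ n = Rabs z * Rabs z ^ n).
  { intros z; assert (e : forall u, u * u ^ n = (u * u) ^ S j).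
    { intros u; rewrite hn, pow_add, pow_mult, pow_1; simpl.
      rewrite Rmult_1_r; ring. }
    rewrite !e, <- Rabs_mult, Rabs_pos_eq; [reflexivity | nra]. }
  assert (hone : forall z z' g, a <= g <= b -> Rabs (z' - z) <= eta * s ->
            a * (Rabs z * Rabs z ^ n) - eta * s * b * Rabs z ^ n <= z' * (z ^ n * g)).
  { intros z z' g hg hz.
    replace (z' * (z ^ n * g)) with (z * z ^ n * g + (z' - z) * (z ^ n * g)) by ring.
    rewrite <- (hpow z).
    assert (p1 : 0 <= Rabs z ^ n) by apply pow_le, Rabs_pos.
    assert (p2 : 0 <= Rabs z * Rabs z ^ n) by (apply Rmult_le_pos; [apply Rabs_pos | auto]).
    assert (p3 : Rabs ((z' - z) * (z ^ n * g)) <= eta * s * b * Rabs z ^ n).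
    { rewrite !Rabs_mult, <- RPow_abs, (Rabs_pos_eq g) by lra.
      replace (eta * s * b * Rabs z ^ n) with (eta * s * (Rabs z ^ n * b)) by ring.
      apply Rmult_le_compat; [apply Rabs_pos | | exact hz |].
      - apply Rmult_le_pos; lra.
      - apply Rmult_le_compat_l; lra. }
    apply Rabs_le_between in p3.
    assert (p4 : a * (z * z ^ n) <= z * z ^ n * g)
      by (rewrite (Rmult_comm a); apply Rmult_le_compat_l; [rewrite hpow |]; lra).
    lra. }
  pose proof (hone x x' h hh hx) as q1; pose proof (hone y y' h' hh' hy) as q2.
  assert (main : forall u v, k * s <= u -> 0 <= v <= u ->
            0 < a * (u * u ^ n) - eta * s * b * u ^ n
                + (a * (v * v ^ n) - eta * s * b * v ^ n)).
  { intros u v hu hv.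
    assert (hu0 : 0 < u) by nra.
    assert (p1 : 0 < u ^ n) by now apply pow_lt.
    assert (p2 : 0 <= v ^ n) by now apply pow_le.
    assert (p3 : v ^ n <= u ^ n) by now apply pow_incr.
    assert (p4 : 0 <= a * (v * v ^ n)) by (apply Rmult_le_pos; [lra | apply Rmult_le_pos; lra]).
    assert (p5 : 0 <= eta * s * b) by (apply Rmult_le_pos; [apply Rmult_le_pos |]; lra).
    assert (p6 : 0 < u ^ n * (a * u - 2 * (eta * s * b))).
    { apply Rmult_lt_0_compat; [exact p1 |].
      assert (a * (k * s) <= a * u) by (apply Rmult_le_compat_l; lra).
      assert (s * (2 * eta * b) < s * (a * k)) by now apply Rmult_lt_compat_l.
      lra. }
    nra. }
  pose proof (Rabs_pos x); pose proof (Rabs_pos y).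
  destruct (Rle_dec (Rabs y) (Rabs x)) as [l | l].
  - pose proof (main (Rabs x) (Rabs y) ltac:(lra) ltac:(lra)); lra.
  - pose proof (main (Rabs y) (Rabs x) ltac:(lra) ltac:(lra)); lra.
Qed.

Lemma linear_lower_bound (A : mat2) :
  mat2_det A <> 0 ->
  exists k, 0 < k /\ forall t,
    2 * k <= Rabs (fst (mat2_app A (dir t))) \/ 2 * k <= Rabs (snd (mat2_app A (dir t))).
Proof.
  intros hA.
  set (M := Rabs (m11 A) + Rabs (m12 A) + Rabs (m21 A) + Rabs (m22 A) + 1).
  pose proof (Rabs_pos (m11 A)); pose proof (Rabs_pos (m12 A)).
  pose proof (Rabs_pos (m21 A)); pose proof (Rabs_pos (m22 A)).
  assert (hM : 0 < M) by (unfold M; lra).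
  assert (hd : 0 < Rabs (mat2_det A)) by now apply Rabs_pos_lt.
  set (k := Rabs (mat2_det A) / (4 * M)).
  assert (hk : Rabs (mat2_det A) = 4 * M * k) by (unfold k; field; lra).
  exists k; split; [unfold k; apply Rdiv_lt_0_compat; lra |].
  intros t; destruct (dir t) as [e1 e2] eqn:he.
  pose proof (dir_half t) as hh; rewrite he in hh; simpl in hh.
  unfold mat2_app; simpl.
  set (u := m11 A * e1 + m12 A * e2); set (v := m21 A * e1 + m22 A * e2).
  destruct (Rle_dec (2 * k) (Rabs u)) as [l | l]; [now left |].
  destruct (Rle_dec (2 * k) (Rabs v)) as [l' | l']; [now right | exfalso].
  assert (hk0 : 0 < k) by (unfold k; apply Rdiv_lt_0_compat; lra).
  assert (b1 : Rabs (mat2_det A) * Rabs e1 <= (Rabs (m22 A) + Rabs (m12 A)) * (2 * k)).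
  { rewrite <- Rabs_mult.
    replace (mat2_det A * e1) with (m22 A * u - m12 A * v)
      by (unfold mat2_det, u, v; ring).
    eapply Rle_trans; [apply Rabs_triang |].
    rewrite Rabs_Ropp, !Rabs_mult; nra. }
  assert (b2 : Rabs (mat2_det A) * Rabs e2 <= (Rabs (m11 A) + Rabs (m21 A)) * (2 * k)).
  { rewrite <- Rabs_mult.
    replace (mat2_det A * e2) with (m11 A * v - m21 A * u)
      by (unfold mat2_det, u, v; ring).
    eapply Rle_trans; [apply Rabs_triang |].
    rewrite Rabs_Ropp, !Rabs_mult; nra. }
  rewrite hk in b1, b2.
  assert (hMk : 0 < 4 * M * k) by (apply Rmult_lt_0_compat; lra).
  assert (g1 : (Rabs (m22 A) + Rabs (m12 A)) * k <= (M - 1) * k)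
    by (apply Rmult_le_compat_r; unfold M; lra).
  assert (g2 : (Rabs (m11 A) + Rabs (m21 A)) * k <= (M - 1) * k)
    by (apply Rmult_le_compat_r; unfold M; lra).
  destruct hh as [hh | hh]; apply (Rmult_le_compat_l (4 * M * k)) in hh; lra.
Qed.

Lemma Rabs_comb_bound (u v e1 e2 d : R) :
  Rabs u <= d -> Rabs v <= d -> Rabs e1 <= 1 -> Rabs e2 <= 1 ->
  Rabs (u * e1 + v * e2) <= 2 * d.
Proof.
  intros; eapply Rle_trans; [apply Rabs_triang |]; rewrite !Rabs_mult.
  pose proof (Rabs_pos u); pose proof (Rabs_pos v); pose proof (Rabs_pos e1);
    pose proof (Rabs_pos e2); nra.
Qed.

(** For odd [n] the field with components [- y ^ n * hm] and [x ^ n * h1] is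
    transverse to the radial vector [(x, y)].  Read in another chart [H], this
    survives on small circles: by the mean value theorem the differential of [H]
    at [q] maps the radial vector at [q] to [H q] up to a small relative error.
    The sum below is the determinant of that image and the field. *)
Lemma transverse_on_small_circles (V : R * R -> Prop) (H : R * R -> R * R)
  (p : R * R) (n : nat) (h1 hm : R -> R) :
  open V -> V p -> smooth_plane_map_on V H -> H p = (0, 0) ->
  mat2_det (jacobian H p) <> 0 -> Nat.Odd n -> 
  continuous h1 0 -> continuous hm 0 -> 0 < h1 0 -> 0 < hm 0 ->
  exists r0, 0 < r0 /\ forall s t, 0 < s < r0 ->
    let q := ray p (dir t) s in
    V q /\
    0 < fst (mat2_app (jacobian H q) (dir t)) * (fst (H q) ^ n * h1 (fst (H q)))
        + snd (mat2_app (jacobian H q) (dir t)) * (snd (H q) ^ n * hm (snd (H q))).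
Proof.
  intros hV hp hH hp0 hK hn c1 cm p1 pm.
  destruct (linear_lower_bound _ hK) as (k & hk & hlow).
  set (a := Rmin (h1 0) (hm 0) / 2); set (b := 2 * Rmax (h1 0) (hm 0)).
  assert (ha : 0 < a) by (unfold a; pose proof (Rmin_pos _ _ p1 pm); lra).
  assert (hab : a <= b).
  { unfold a, b; pose proof (Rmin_l (h1 0) (hm 0)); pose proof (Rmax_l (h1 0) (hm 0)); lra. }
  assert (hloc : forall h : R -> R, continuous h 0 -> 0 < h 0 ->
            a <= h 0 / 2 -> 2 * h 0 <= b -> locally 0 (fun x => a <= h x <= b)).
  { intros h ch ph l1 l2.
    apply (filter_imp (fun x => h 0 / 2 < h x /\ h x < 2 * h 0)); [intros; lra |].
    apply filter_and.
    - apply (ch (fun t => h 0 / 2 < t)), (open_gt (h 0 / 2)); lra.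
    - apply (ch (fun t => t < 2 * h 0)), (open_lt (2 * h 0)); lra. }
  assert (l1 : locally 0 (fun x => a <= h1 x <= b)).
  { apply hloc; auto; unfold a, b.
    - pose proof (Rmin_l (h1 0) (hm 0)); lra.
    - pose proof (Rmax_l (h1 0) (hm 0)); lra. }
  assert (lm : locally 0 (fun x => a <= hm x <= b)).
  { apply hloc; auto; unfold a, b.
    - pose proof (Rmin_r (h1 0) (hm 0)); lra.
    - pose proof (Rmax_r (h1 0) (hm 0)); lra. }
  (* the oscillation d allowed for the jacobian: the error per unit of radius is
     then 4 * d, and the estimate needs 2 * (4 * d) * b < a * k *)
  set (d := a * k / (16 * b)).
  assert (hd : 0 < d).
  { unfold d; apply Rdiv_lt_0_compat; [now apply Rmult_lt_0_compat | lra]. }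
  assert (hdb : 16 * (d * b) = a * k) by (unfold d; field; lra).
  assert (hdk : d <= k) by nra.
  destruct hH as [hH1 hH2].
  assert (hnear : forall F, smooth_on V F -> locally p (fun q => Rabs (F q - F p) < d)).
  { intros F hF; pose proof (smooth_on_continuous V F p hF hp) as hc.
    apply (filter_imp (fun q => F p - d < F q /\ F q < F p + d));
      [intros q hq; apply Rabs_def1; lra |].
    apply filter_and.
    - apply (hc (fun t => F p - d < t)), (open_gt (F p - d)); lra.
    - apply (hc (fun t => t < F p + d)), (open_lt (F p + d)); lra. }
  assert (hall : locally p (fun q => V q /\
     (Rabs (D1 (fun z => fst (H z)) q - D1 (fun z => fst (H z)) p) < d /\
      Rabs (D2 (fun z => fst (H z)) q - D2 (fun z => fst (H z)) p) < d) /\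
     (Rabs (D1 (fun z => snd (H z)) q - D1 (fun z => snd (H z)) p) < d /\
      Rabs (D2 (fun z => snd (H z)) q - D2 (fun z => snd (H z)) p) < d) /\
     (a <= h1 (fst (H q)) <= b /\ a <= hm (snd (H q)) <= b))).
  { apply filter_and; [now apply hV |].
    apply filter_and; [| apply filter_and].
    - apply filter_and; apply hnear; [now apply smooth_on_D1 | now apply smooth_on_D2].
    - apply filter_and; apply hnear; [now apply smooth_on_D1 | now apply smooth_on_D2].
    - apply filter_and.
      + apply (smooth_on_continuous V (fun z => fst (H z)) p hH1 hp
                 (fun x => a <= h1 x <= b)); now rewrite hp0.
      + apply (smooth_on_continuous V (fun z => snd (H z)) p hH2 hp
                 (fun x => a <= hm x <= b)); now rewrite hp0. }
  destruct p as [p1' p2']; apply locally_box in hall as (r0 & hr0 & hall).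
  exists r0; split; [exact hr0 |]; intros s t hs q.
  pose proof (hlow t) as hl; destruct (dir_bound t) as [e1 e2].
  revert e1 e2 hl; subst q; generalize (dir t); intros e e1 e2 hl.
  set (q := ray (p1', p2') e s).
  assert (hray : forall xi, 0 <= xi <= s ->
            Rabs (fst (p1', p2') + xi * fst e - p1') < r0 /\
            Rabs (snd (p1', p2') + xi * snd e - p2') < r0).
  { intros xi hxi; simpl; split.
    - replace (p1' + xi * fst e - p1') with (xi * fst e) by ring.
      rewrite Rabs_mult, (Rabs_pos_eq xi) by lra; pose proof (Rabs_pos (fst e)); nra.
    - replace (p2' + xi * snd e - p2') with (xi * snd e) by ring.
      rewrite Rabs_mult, (Rabs_pos_eq xi) by lra; pose proof (Rabs_pos (snd e)); nra. }
  assert (hq := hall _ _ (proj1 (hray s ltac:(lra))) (proj2 (hray s ltac:(lra)))).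
  change (fst (p1', p2') + s * fst e, snd (p1', p2') + s * snd e) with q in hq.
  destruct hq as (hqV & (a1 & a2) & (a3 & a4) & ab1 & ab2).
  split; [exact hqV |].
  assert (hVbox : forall x y, Rabs (x - p1') < r0 -> Rabs (y - p2') < r0 -> V (x, y))
    by (intros; now apply hall).
  destruct (mean_value_ray V _ (p1', p2') e r0 s hV hH1 hVbox e1 e2 hs) as (x1 & hx1 & m1).
  destruct (mean_value_ray V _ (p1', p2') e r0 s hV hH2 hVbox e1 e2 hs) as (x2 & hx2 & m2).
  fold q in m1, m2; rewrite hp0 in m1, m2; simpl in m1, m2; rewrite Rminus_0_r in m1, m2.
  pose proof (hall _ _ (proj1 (hray x1 hx1)) (proj2 (hray x1 hx1))) as (_ & (b1 & b2) & _).
  pose proof (hall _ _ (proj1 (hray x2 hx2)) (proj2 (hray x2 hx2))) as (_ & _ & (b3 & b4) & _).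
  change (fst (p1', p2') + x1 * fst e, snd (p1', p2') + x1 * snd e)
    with (ray (p1', p2') e x1) in b1, b2.
  change (fst (p1', p2') + x2 * fst e, snd (p1', p2') + x2 * snd e)
    with (ray (p1', p2') e x2) in b3, b4.
  unfold mat2_app, jacobian in *; simpl in *.
  assert (tri : forall u v w, Rabs (u - w) < d -> Rabs (v - w) < d -> Rabs (u - v) <= 2 * d).
  { intros u v w i1 i2; replace (u - v) with ((u - w) - (v - w)) by ring.
    eapply Rle_trans; [apply Rabs_triang |]; rewrite Rabs_Ropp; lra. }
  apply (Rmult_lt_reg_l s); [lra |]; rewrite Rmult_0_r, Rmult_plus_distr_l, <- !Rmult_assoc.
  rewrite !(Rmult_assoc _ (_ ^ n) _).
  apply (odd_pow_estimate n a b k (4 * d) s); auto; try lra.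
  - assert (0 < a * k) by now apply Rmult_lt_0_compat.
    lra.
  - rewrite m1, <- Rmult_minus_distr_l, Rabs_mult, (Rabs_pos_eq s) by lra.
    rewrite (Rmult_comm (4 * d)); apply Rmult_le_compat_l; [lra |].
    replace (4 * d) with (2 * (2 * d)) by ring.
    match goal with |- Rabs (?u * ?g1 + ?v * ?g2 - (?u' * ?g1 + ?v' * ?g2)) <= _ =>
      replace (u * g1 + v * g2 - (u' * g1 + v' * g2))
        with ((u - u') * g1 + (v - v') * g2) by ring end.
    apply Rabs_comb_bound; auto; eapply tri; eassumption.
  - rewrite m2, <- Rmult_minus_distr_l, Rabs_mult, (Rabs_pos_eq s) by lra.
    rewrite (Rmult_comm (4 * d)); apply Rmult_le_compat_l; [lra |].
    replace (4 * d) with (2 * (2 * d)) by ring.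
    match goal with |- Rabs (?u * ?g1 + ?v * ?g2 - (?u' * ?g1 + ?v' * ?g2)) <= _ =>
      replace (u * g1 + v * g2 - (u' * g1 + v' * g2))
        with ((u - u') * g1 + (v - v') * g2) by ring end.
    apply Rabs_comb_bound; auto; eapply tri; eassumption.
  - rewrite m1, m2, !Rabs_mult, (Rabs_pos_eq s) by lra.
    assert (low : forall u v u' v', Rabs (u' - u) < d -> Rabs (v' - v) < d ->
              2 * k <= Rabs (u * fst e + v * snd e) ->
              k * s <= s * Rabs (u' * fst e + v' * snd e)).
    { intros u v u' v' i1 i2 i3; rewrite (Rmult_comm k).
      apply Rmult_le_compat_l; [lra |].
      assert (i4 : Rabs ((u' - u) * fst e + (v' - v) * snd e) <= 2 * d)
        by (apply Rabs_comb_bound; auto; lra).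
      replace ((u' - u) * fst e + (v' - v) * snd e)
        with ((u' * fst e + v' * snd e) - (u * fst e + v * snd e)) in i4 by ring.
      pose proof (Rabs_triang_inv (u * fst e + v * snd e) (u' * fst e + v' * snd e)) as i5.
      rewrite Rabs_minus_sym in i4; nra. }
    destruct hl as [hl | hl]; [left | right]; eapply low; eassumption.
Qed.

Lemma open_neq_point (p : R * R) : open (fun q => q <> p).
Proof.
  destruct p as [a b].
  apply (open_ext (fun q : R * R => fst q <> a \/ snd q <> b)).
  - intros [x y]; simpl; split.
    + intros [h | h] e; injection e; auto.
    + intros h; destruct (Req_dec x a) as [-> | h']; [right | now left].
      intros ->; now apply h.
  - apply open_or.
    + apply (open_comp fst (fun x => x <> a)); [| apply open_neq].
      intros x _; apply continuous_fst.
    + apply (open_comp snd (fun x => x <> b)); [| apply open_neq].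
      intros x _; apply continuous_snd.
Qed.

Lemma smooth_on_pow (U : R * R -> Prop) (F : R * R -> R) (n : nat) :
  open U -> smooth_on U F -> smooth_on U (fun q => F q ^ n).
Proof.
  intros hU hF; induction n as [|n IH]; [exact (smooth_on_const U 1) |].
  apply (smooth_on_mult U F (fun q => F q ^ n)); auto.
Qed.

(** The angle from the radial direction to the line of the field can be taken
    between [0] and [PI] by transversality, hence is given by an arc tangent; it
    is periodic, so the total rotation is that of the radius. *)
Lemma index_of_transverse_field (V : R * R -> Prop) (p : R * R)
  (Y : R * R -> R * R) (D : R * R -> R * R -> Prop) (r0 : R) :
  open V -> smooth_plane_map_on V Y -> 0 < r0 ->
  (forall s t, 0 < s < r0 -> V (ray p (dir t) s) /\
     cos t * snd (Y (ray p (dir t) s)) - sin t * fst (Y (ray p (dir t) s)) <> 0) ->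
  (forall q, V q -> forall k, D q (k * fst (Y q), k * snd (Y q))) ->
  direction_field_index D p 1.
Proof.
  intros hV [hY1 hY2] hr0 htr hD; exists r0; split; [exact hr0 |]; intros r hr.
  set (y1 := fun t => fst (Y (ray p (dir t) r))).
  set (y2 := fun t => snd (Y (ray p (dir t) r))).
  set (kappa := fun t => (cos t * y1 t + sin t * y2 t) / (cos t * y2 t - sin t * y1 t)).
  assert (hder : forall F, smooth_on V F ->
            forall t, ex_derive (fun t => F (ray p (dir t) r)) t).
  { intros F hF t; eexists.
    apply (C1_is_derive_curve V F (fun t => fst p + r * cos t) (fun t => snd p + r * sin t)
             t (r * (- sin t)) (r * cos t)); auto.
    - now apply smooth_on_Ck.
    - now apply (htr r t).
    - auto_derive; [exact I | ring].
    - auto_derive; [exact I | ring]. }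
  exists (fun t => t + PI / 2 - atan (kappa t)); split; [| split].
  - intros t; apply continuity_pt_filterlim.
    apply (ex_derive_continuous (fun t => t + PI / 2 - atan (kappa t))).
    apply (ex_derive_minus (fun t => t + PI / 2)); [auto_derive; exact I |].
    apply (ex_derive_comp atan kappa).
    + eexists; apply is_derive_Reals, derivable_pt_lim_atan.
    + pose proof (hder _ hY1 t) as d1; pose proof (hder _ hY2 t) as d2.
      fold y1 in d1; fold y2 in d2.
      assert (hn : cos t * y2 t - sin t * y1 t <> 0) by now apply htr.
      unfold kappa; auto_derive; repeat split; auto.
  - intros t _; destruct (htr r t hr) as [hVq hn].
    fold (y1 t) in hn; fold (y2 t) in hn.
    set (al := atan (kappa t)).
    assert (hc : 0 < cos al).
    { apply cos_gt_0; pose proof (atan_bound (kappa t)); unfold al; lra. }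
    assert (hs : sin al = kappa t * cos al).
    { pose proof (tan_atan (kappa t)) as e; fold al in e; rewrite <- e.
      unfold tan; field; lra. }
    assert (e1 : cos (t + PI / 2 - al)
                 = cos al / (cos t * y2 t - sin t * y1 t) * y1 t).
    { replace (t + PI / 2 - al) with (PI / 2 + (t - al)) by ring.
      replace (cos (PI / 2 + (t - al))) with (- sin (t - al)) by (rewrite sin_cos; ring).
      rewrite sin_minus, hs; unfold kappa.
      pose proof (sin2_cos2 t) as h2; unfold Rsqr in h2.
      transitivity (cos al / (cos t * y2 t - sin t * y1 t)
                    * ((sin t * sin t + cos t * cos t) * y1 t)); [field; exact hn |].
      rewrite h2; ring. }
    assert (e2 : sin (t + PI / 2 - al)
                 = cos al / (cos t * y2 t - sin t * y1 t) * y2 t).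
    { replace (t + PI / 2 - al) with (PI / 2 + (t - al)) by ring.
      rewrite <- cos_sin, cos_minus, hs; unfold kappa.
      pose proof (sin2_cos2 t) as h2; unfold Rsqr in h2.
      transitivity (cos al / (cos t * y2 t - sin t * y1 t)
                    * ((sin t * sin t + cos t * cos t) * y2 t)); [field; exact hn |].
      rewrite h2; ring. }
    rewrite e1, e2; apply (hD _ hVq).
  - assert (e : kappa (2 * PI) = kappa 0).
    { unfold kappa, y1, y2, dir; now rewrite cos_2PI, sin_2PI, cos_0, sin_0. }
    rewrite e; ring.
Qed.

(** With [m = 2 n], the directions [(A, B)] with
    [A = y ^ n * sqrt |psim1 y|] and [B = - x ^ n * sqrt |psi1 x|], up to a common
    constant factor, solve [phi1 * A ^ 2 = phim1 * B ^ 2] and are smooth across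
    the axes.  They are carried to the given parameters by the adjugate of the
    jacobian of [H], a multiple of its inverse with smooth entries. *)
Lemma flow_of_index_one {c : R} (U : R * R -> Prop) (f nu : R * R -> ambient c)
  (p : R * R) (N : R * R -> Prop) (G : R * R -> R * R) (V : R * R -> Prop)
  (H : R * R -> R * R) (phi1 phim1 psi1 psim1 : R -> R) (d : R) (n : nat) :
  surface U f nu -> time_like_on U f -> null_chart U f p N G V H ->
  null_splitting f nu G phi1 phim1 ->
  0 < d -> smooth_near d psi1 -> smooth_near d psim1 ->
  (forall x, Rabs x < d -> phi1 x = x ^ (2 * n) * psi1 x) ->
  (forall x, Rabs x < d -> phim1 x = x ^ (2 * n) * psim1 x) ->
  0 < psi1 0 * psim1 0 -> Nat.Odd n ->
  exists D, curvature_line_flow U f nu p D /\ direction_field_index D p 1.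
Proof.
  intros hS htl hG (_ & _ & hII) hd hs1 hsm1 hf1 hfm1 hpos hn.
  assert (hd0 : Rabs 0 < d) by now rewrite Rabs_R0.
  assert (n1 : psi1 0 <> 0) by (intros e; rewrite e in hpos; lra).
  assert (nm1 : psim1 0 <> 0) by (intros e; rewrite e in hpos; lra).
  destruct (locally_same_sign psi1 (smooth_near_continuous _ _ _ hs1 hd0) n1)
    as (r1 & hr1 & g1).
  destruct (locally_same_sign psim1 (smooth_near_continuous _ _ _ hsm1 hd0) nm1)
    as (rm & hrm & gm).
  apply locally_box_0 in hII as (r2 & hr2 & hII).
  assert (exists r, 0 < r /\ r <= d /\ r <= r1 /\ r <= rm /\ r <= r2)
    as (r & hr & rd & rr1 & rrm & rr2).
  { exists (Rmin (Rmin d r1) (Rmin rm r2)).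
    pose proof (Rmin_l d r1); pose proof (Rmin_r d r1).
    pose proof (Rmin_l rm r2); pose proof (Rmin_r rm r2).
    pose proof (Rmin_l (Rmin d r1) (Rmin rm r2)).
    pose proof (Rmin_r (Rmin d r1) (Rmin rm r2)).
    split; [repeat apply Rmin_pos; auto | lra]. }
  (* multiplying by the value at 0 makes both factors positive *)
  assert (pos1 : forall x, Rabs x < r -> 0 < psi1 0 * psi1 x).
  { intros x hx; rewrite Rmult_comm; apply g1; lra. }
  assert (posm1 : forall x, Rabs x < r -> 0 < psi1 0 * psim1 x).
  { intros x hx; pose proof (gm x ltac:(lra)) as k1.
    assert (k2 : 0 < (psim1 x * psim1 0) * (psi1 0 * psim1 0)) by now apply Rmult_lt_0_compat.
    replace ((psim1 x * psim1 0) * (psi1 0 * psim1 0))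
      with ((psi1 0 * psim1 x) * (psim1 0 * psim1 0)) in k2 by ring.
    assert (0 < psim1 0 * psim1 0) by nra.
    apply (Rmult_lt_reg_r (psim1 0 * psim1 0)); lra. }
  set (h1 := fun x => sqrt (psi1 0 * psi1 x)).
  set (hm := fun x => sqrt (psi1 0 * psim1 x)).
  assert (hsq1 : forall x, Rabs x < r -> h1 x * h1 x = psi1 0 * psi1 x).
  { intros x hx; apply sqrt_sqrt; left; auto. }
  assert (hsqm : forall x, Rabs x < r -> hm x * hm x = psi1 0 * psim1 x).
  { intros x hx; apply sqrt_sqrt; left; auto. }
  assert (hh1 : forall x, Rabs x < r -> 0 < h1 x) by (intros; apply sqrt_lt_R0; auto).
  assert (hhm : forall x, Rabs x < r -> 0 < hm x) by (intros; apply sqrt_lt_R0; auto).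
  set (V0 := fun q => V q /\ Rabs (fst (H q)) < r /\ Rabs (snd (H q)) < r).
  assert (hVo : open V) by apply hG.
  assert (hHs : smooth_plane_map_on V H) by apply hG.
  assert (hHp : H p = (0, 0)).
  { rewrite <- (nc_center _ _ _ _ _ _ _ hG); apply hG, hG. }
  assert (hVp : V p).
  { rewrite <- (nc_center _ _ _ _ _ _ _ hG); apply hG, hG. }
  assert (hr0 : Rabs 0 < r) by now rewrite Rabs_R0.
  assert (hV0 : open V0).
  { apply (open_preimage (fun q => Rabs (fst q) < r /\ Rabs (snd q) < r) V H); auto.
    apply open_and; [apply open_strip | apply open_strip_snd]. }
  assert (hVp0 : V0 p) by (split; [exact hVp |]; rewrite hHp; simpl; auto).
  assert (hHs0 : smooth_plane_map_on V0 H)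
    by (apply (smooth_plane_map_subset V); auto; now intros q [hq _]).
  pose proof hHs0 as [hs01 hs02].
  set (A := fun q => snd (H q) ^ n * hm (snd (H q))).
  set (B := fun q => - (fst (H q) ^ n * h1 (fst (H q)))).
  assert (hAs : smooth_on V0 A).
  { apply smooth_on_mult; [exact hV0 | now apply smooth_on_pow |].
    apply smooth_on_sqrt_comp; auto.
    - apply smooth_on_scal; auto; apply (smooth_on_fst_comp V0 d); auto.
      intros q (_ & _ & hq); lra.
    - intros q (_ & _ & hq); auto. }
  assert (hBs : smooth_on V0 B).
  { apply (smooth_on_ext V0 (fun q => (-1) * (fst (H q) ^ n * h1 (fst (H q))))); auto.
    { intros q _; unfold B; ring. }
    apply smooth_on_scal; auto.
    apply smooth_on_mult; [exact hV0 | now apply smooth_on_pow |].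
    apply smooth_on_sqrt_comp; auto.
    - apply smooth_on_scal; auto; apply (smooth_on_fst_comp V0 d); auto.
      intros q (_ & hq & _); lra.
    - intros q (_ & hq & _); auto. }
  set (Y := fun q => (m22 (jacobian H q) * A q - m12 (jacobian H q) * B q,
                      m11 (jacobian H q) * B q - m21 (jacobian H q) * A q)).
  assert (hYs : smooth_plane_map_on V0 Y).
  { assert (smooth_on V0 (D1 (fun z => fst (H z)))) by now apply smooth_on_D1.
    assert (smooth_on V0 (D2 (fun z => fst (H z)))) by now apply smooth_on_D2.
    assert (smooth_on V0 (D1 (fun z => snd (H z)))) by now apply smooth_on_D1.
    assert (smooth_on V0 (D2 (fun z => snd (H z)))) by now apply smooth_on_D2.
    split; apply smooth_on_minus; auto; apply smooth_on_mult; auto. }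
  assert (hKY : forall q, mat2_app (jacobian H q) (Y q)
            = (mat2_det (jacobian H q) * A q, mat2_det (jacobian H q) * B q)).
  { intros q; unfold mat2_app, mat2_det, Y; simpl; f_equal; ring. }
  assert (hdet : forall q, V0 q -> mat2_det (jacobian H q) <> 0).
  { intros q [hq _]; apply (chart_shape U f nu p N G V H hS htl hG q hq). }
  assert (hz : forall x h, 0 < h -> x ^ n * h = 0 -> x = 0).
  { intros x h hh e; destruct (Req_dec x 0) as [z | nz]; [exact z | exfalso].
    apply Rmult_integral in e as [e | e]; [| lra]; now apply (pow_nonzero x n). }
  exists (fun q w => exists k, w = (k * fst (Y q), k * snd (Y q))); split.
  - exists V0; split; [exact hV0 |]; split; [exact hVp0 |]; split; [| split].
    + intros q [hq _]; now apply (nc_subset _ _ _ _ _ _ _ hG).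
    + intros q hq; exists (fun q => V0 q /\ q <> p), Y; split; [| split; [| split; [| split]]].
      * apply open_and; [exact hV0 | apply open_neq_point].
      * exact hq.
      * auto.
      * apply (smooth_plane_map_subset V0); [now intros z [hz' _] | exact hYs].
      * intros z [hz1 hzp]; split; [| intros w; reflexivity].
        intros e; apply hzp.
        pose proof (hKY z) as hk; rewrite e in hk; unfold mat2_app in hk; simpl in hk.
        assert (eA : mat2_det (jacobian H z) * A z = 0)
          by (apply (f_equal fst) in hk; simpl in hk; rewrite <- hk; ring).
        assert (eB : mat2_det (jacobian H z) * B z = 0)
          by (apply (f_equal snd) in hk; simpl in hk; rewrite <- hk; ring).
        apply Rmult_integral in eA as [eA | eA]; [now apply hdet in eA |].
        apply Rmult_integral in eB as [eB | eB]; [now apply hdet in eB |].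
        destruct hz1 as (hzV & hz1 & hz2).
        apply hz in eA; [| now apply hhm].
        unfold B in eB.
        assert (eB' : fst (H z) ^ n * h1 (fst (H z)) = 0) by lra.
        apply hz in eB'; [| now apply hh1].
        rewrite <- (proj2 (nc_HG _ _ _ _ _ _ _ hG z hzV)), <- (nc_center _ _ _ _ _ _ _ hG).
        f_equal; rewrite (surjective_pairing (H z)); now f_equal.
    + intros q hq _ w [k ->].
      apply (chart_principal_direction_conv U f nu p N G V H); auto; [apply hq |].
      rewrite mat2_app_scal, hKY; simpl.
      destruct hq as (hqV & hq1 & hq2).
      destruct (hII (fst (H q)) (snd (H q))) as [i1 i2]; try lra.
      rewrite <- surjective_pairing in i1, i2; simpl in i1, i2; rewrite i1, i2.
      rewrite hf1, hfm1 by lra; unfold A, B.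
      set (x := fst (H q)) in *; set (y := snd (H q)) in *.
      apply (Rmult_eq_reg_l (psi1 0)); [| exact n1].
      assert (epow : forall u, u ^ (2 * n) = u ^ n * u ^ n).
      { intros u; replace (2 * n)%nat with (n + n)%nat by lia; apply pow_add. }
      rewrite !epow; set (D := mat2_det _).
      transitivity ((psi1 0 * psi1 x) * (x ^ n * x ^ n * (k * D * (y ^ n * hm y)) *
                      (k * D * (y ^ n * hm y)))); [ring |].
      rewrite <- hsq1 by exact hq1.
      transitivity ((psi1 0 * psim1 y) * (y ^ n * y ^ n * (k * D * (x ^ n * h1 x)) *
                      (k * D * (x ^ n * h1 x)))); [rewrite <- hsqm by exact hq2 |]; ring.
  - assert (c1 : continuous h1 0).
    { apply (continuous_comp (fun x => psi1 0 * psi1 x) sqrt); [| apply continuous_sqrt].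
      apply (continuous_scal_r (psi1 0) psi1), (smooth_near_continuous d); auto. }
    assert (cm : continuous hm 0).
    { apply (continuous_comp (fun x => psi1 0 * psim1 x) sqrt); [| apply continuous_sqrt].
      apply (continuous_scal_r (psi1 0) psim1), (smooth_near_continuous d); auto. }
    destruct (transverse_on_small_circles V0 H p n h1 hm) as (r0 & hr00 & htr); auto.
    apply (index_of_transverse_field V0 p Y _ r0); auto.
    + intros s t hst; destruct (htr s t hst) as [hq hlt]; split; [exact hq |].
      set (q := ray p (dir t) s) in *.
      intros e; apply (Rlt_irrefl 0); eapply Rlt_le_trans; [exact hlt |]; right.
      transitivity (- (cos t * snd (Y q) - sin t * fst (Y q))); [| rewrite e; ring].
      unfold Y, A, B, mat2_app; simpl; ring.
    + intros q _ k; now exists k.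
Qed.

(** * Flows for which the order is divisible by four *)

Lemma ray_dir_box (p : R * R) (t s : R) :
  0 < s -> Rabs (fst p + s * cos t - fst p) <= s /\ Rabs (snd p + s * sin t - snd p) <= s.
Proof.
  intros hs; destruct (dir_bound t) as [h1 h2]; simpl in h1, h2; split.
  - replace (fst p + s * cos t - fst p) with (s * cos t) by ring.
    rewrite Rabs_mult, (Rabs_pos_eq s) by lra; pose proof (Rabs_pos (cos t)); nra.
  - replace (snd p + s * sin t - snd p) with (s * sin t) by ring.
    rewrite Rabs_mult, (Rabs_pos_eq s) by lra; pose proof (Rabs_pos (sin t)); nra.
Qed.

Lemma locally_small_circles (P : R * R -> Prop) (p : R * R) :
  locally p P -> exists r0, 0 < r0 /\ forall s t, 0 < s < r0 -> P (ray p (dir t) s).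
Proof.
  destruct p as [a b]; intros h; apply locally_box in h as (r0 & hr0 & h).
  exists r0; split; [exact hr0 |]; intros s t hs.
  destruct (ray_dir_box (a, b) t s ltac:(lra)) as [h1 h2]; simpl in h1, h2.
  apply h; simpl; lra.
Qed.

Lemma same_sign_of_no_zero (g : R -> R) (a b k : R) :
  a <= b -> (forall t, a <= t <= b -> continuity_pt g t) ->
  (forall t, a <= t <= b -> g t <> 0) -> 0 < g a * k -> 0 < g b * k.
Proof.
  intros hab hc hn ha.
  destruct (Rlt_dec 0 (g b * k)) as [h | h]; [exact h | exfalso].
  assert (hk : k <> 0) by (intros e; rewrite e in ha; lra).
  assert (hb : g b * k < 0).
  { assert (g b * k <> 0); [| lra].
    apply Rmult_integral_contrapositive_currified; [apply hn; lra | exact hk]. }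
  assert (hlt : a < b) by (destruct hab as [l | e]; [exact l | subst; lra]).
  destruct (IVT_interv (fun t => - (g t * k)) a b) as (z & hz & e); try lra.
  - intros t ht; apply continuity_pt_opp, continuity_pt_mult; [now apply hc |].
    apply continuity_pt_const; intros ? ?; reflexivity.
  - apply (hn z hz); apply (Rmult_eq_reg_r k); lra.
Qed.

(** In a full turn the field takes four successive orthogonal positions.  At two
    opposite positions the covector [(l1, l2)], nearly constant on a small circle,
    takes values of the same sign only if it almost vanishes there; but it cannot
    almost vanish on two orthogonal directions. *)
Lemma no_full_turn (V : R * R -> Prop) (p : R * R) (l1 l2 : R * R -> R) :
  open V -> V p -> smooth_on V l1 -> smooth_on V l2 -> (l1 p <> 0 \/ l2 p <> 0) ->
  exists r0, 0 < r0 /\ forall s (theta : R -> R) (d : R),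
    0 < s < r0 -> (forall t, continuity_pt theta t) -> (d = 1 \/ d = -1) ->
    theta (2 * PI) - theta 0 = 2 * PI * d ->
    ~ (forall t, 0 <= t <= 2 * PI ->
         l1 (ray p (dir t) s) * cos (theta t) + l2 (ray p (dir t) s) * sin (theta t) <> 0).
Proof.
  intros hV hp h1 h2 hn.
  set (Q := l1 p * l1 p + l2 p * l2 p).
  assert (hQ : 0 < Q) by (unfold Q; destruct hn as [n | n]; nra).
  (* two orthogonal values of size at most 2 * eta give Q <= 8 * eta ^ 2 *)
  set (eta := sqrt Q / 4).
  assert (heta : 0 < eta) by (unfold eta; pose proof (sqrt_lt_R0 Q hQ); lra).
  assert (heta2 : 16 * (eta * eta) = Q).
  { unfold eta; transitivity (sqrt Q * sqrt Q); [field | apply sqrt_sqrt; lra]. }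
  assert (hnear : forall F, smooth_on V F -> locally p (fun q => Rabs (F q - F p) < eta)).
  { intros F hF; pose proof (smooth_on_continuous V F p hF hp) as hc.
    apply (filter_imp (fun q => F p - eta < F q /\ F q < F p + eta));
      [intros q hq; apply Rabs_def1; lra |].
    apply filter_and.
    - apply (hc (fun t => F p - eta < t)), (open_gt (F p - eta)); lra.
    - apply (hc (fun t => t < F p + eta)), (open_lt (F p + eta)); lra. }
  destruct (locally_small_circles _ p
    (filter_and _ _ (hV p hp) (filter_and _ _ (hnear l1 h1) (hnear l2 h2))))
    as (r0 & hr0 & hall).
  exists r0; split; [exact hr0 |]; intros s theta d hs hth hd hturn hne.
  set (F := fun t => l1 (ray p (dir t) s) * cos (theta t)
                     + l2 (ray p (dir t) s) * sin (theta t)) in *.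
  assert (hder : forall l, smooth_on V l ->
            forall t, continuity_pt (fun t => l (ray p (dir t) s)) t).
  { intros l hl t; apply continuity_pt_filterlim.
    apply (ex_derive_continuous (fun t => l (ray p (dir t) s))); eexists.
    apply (C1_is_derive_curve V l (fun t => fst p + s * cos t) (fun t => snd p + s * sin t)
             t (s * (- sin t)) (s * cos t)); auto.
    - now apply smooth_on_Ck.
    - apply (hall s t hs).
    - auto_derive; [exact I | ring].
    - auto_derive; [exact I | ring]. }
  assert (hF : forall t, continuity_pt F t).
  { intros t; unfold F; apply continuity_pt_plus; apply continuity_pt_mult; auto.
    - apply (continuity_pt_comp theta cos); auto; apply continuity_cos.
    - apply (continuity_pt_comp theta sin); auto; apply continuity_sin. }
  pose proof PI_RGT_0 as hpi.
  assert (hval : forall x, 0 <= x <= 2 * PI ->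
            exists t, 0 <= t <= 2 * PI /\ theta t = theta 0 + d * x).
  { intros x hx; destruct (IVT_gen theta 0 (2 * PI) (theta 0 + d * x)) as (t & ht & e).
    - exact hth.
    - unfold Rmin, Rmax; destruct (Rle_dec (theta 0) (theta (2 * PI)));
        destruct hd as [-> | ->]; lra.
    - rewrite Rmin_left, Rmax_right in ht by lra; eauto. }
  assert (hsign : forall t, 0 <= t <= 2 * PI -> 0 < F t * F 0).
  { intros t ht; apply (same_sign_of_no_zero F 0 t).
    - lra.
    - auto.
    - intros t' ht'; apply hne; lra.
    - assert (F 0 <> 0) by (apply hne; lra); nra. }
  set (c := cos (theta 0)); set (z := sin (theta 0)).
  assert (hc : Rabs c <= 1 /\ Rabs z <= 1) by apply (dir_bound (theta 0)).
  assert (happrox : forall t u v, Rabs u <= 1 -> Rabs v <= 1 ->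
            Rabs ((l1 (ray p (dir t) s) * u + l2 (ray p (dir t) s) * v)
                  - (l1 p * u + l2 p * v)) <= 2 * eta).
  { intros t u v hu hv; destruct (hall s t hs) as (_ & i1 & i2).
    match goal with |- Rabs (?a * _ + ?b * _ - _) <= _ =>
      replace (a * u + b * v - (l1 p * u + l2 p * v))
        with ((a - l1 p) * u + (b - l2 p) * v) by ring end.
    apply Rabs_comb_bound; lra. }
  destruct (hval (PI / 2) ltac:(lra)) as (t1 & ht1 & e1).
  destruct (hval PI ltac:(lra)) as (t2 & ht2 & e2).
  destruct (hval (3 * (PI / 2)) ltac:(lra)) as (t3 & ht3 & e3).
  assert (c2 : cos (theta t2) = - c /\ sin (theta t2) = - z).
  { rewrite e2; unfold c, z; destruct hd as [-> | ->].
    - rewrite Rmult_1_l, neg_cos, neg_sin; auto.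
    - replace (theta 0 + -1 * PI) with (theta 0 - PI) by ring.
      rewrite cos_minus, sin_minus, cos_PI, sin_PI; split; ring. }
  assert (c1 : cos (theta t1) = - d * z /\ sin (theta t1) = d * c).
  { rewrite e1; unfold c, z; destruct hd as [-> | ->].
    - rewrite Rmult_1_l, cos_plus, sin_plus, cos_PI2, sin_PI2; split; ring.
    - replace (theta 0 + -1 * (PI / 2)) with (theta 0 - PI / 2) by ring.
      rewrite cos_minus, sin_minus, cos_PI2, sin_PI2; split; ring. }
  assert (c3 : cos (theta t3) = d * z /\ sin (theta t3) = - d * c).
  { rewrite e3; unfold c, z; destruct hd as [-> | ->].
    - rewrite Rmult_1_l, cos_plus, sin_plus, cos_3PI2, sin_3PI2; split; ring.
    - replace (theta 0 + -1 * (3 * (PI / 2))) with (theta 0 - 3 * (PI / 2)) by ring.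
      rewrite cos_minus, sin_minus, cos_3PI2, sin_3PI2; split; ring. }
  assert (s0 := hsign 0 ltac:(lra)); assert (s1 := hsign t1 ht1).
  assert (s2 := hsign t2 ht2); assert (s3 := hsign t3 ht3).
  assert (hopp : forall a b x, 0 < a * F 0 -> 0 < - b * F 0 ->
            Rabs (a - x) <= 2 * eta -> Rabs (b - x) <= 2 * eta -> Rabs x <= 2 * eta).
  { intros a b x p1 p2 i1 i2; apply Rabs_le_between in i1; apply Rabs_le_between in i2.
    apply Rabs_le; destruct (Rlt_dec 0 (F 0)); split; nra. }
  assert (g0 : Rabs (l1 p * c + l2 p * z) <= 2 * eta).
  { apply (hopp (F 0) (l1 (ray p (dir t2) s) * c + l2 (ray p (dir t2) s) * z)); auto.
    - replace (- (l1 (ray p (dir t2) s) * c + l2 (ray p (dir t2) s) * z)) with (F t2);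
        [exact s2 | unfold F; destruct c2 as [-> ->]; ring].
    - apply happrox; apply hc.
    - apply happrox; apply hc. }
  assert (hdz : d * d = 1) by (destruct hd as [-> | ->]; ring).
  assert (g1 : Rabs (l1 p * - z + l2 p * c) <= 2 * eta).
  { assert (hz' : Rabs (- z) <= 1) by (rewrite Rabs_Ropp; apply hc).
    set (a := l1 (ray p (dir t1) s) * - z + l2 (ray p (dir t1) s) * c).
    set (b := l1 (ray p (dir t3) s) * - z + l2 (ray p (dir t3) s) * c).
    assert (f1 : F t1 = d * a) by (unfold F, a; destruct c1 as [-> ->]; ring).
    assert (f3 : F t3 = - (d * b)) by (unfold F, b; destruct c3 as [-> ->]; ring).
    assert (i1 : Rabs (a - (l1 p * - z + l2 p * c)) <= 2 * eta)
      by (apply happrox; [exact hz' | apply hc]).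
    assert (i3 : Rabs (b - (l1 p * - z + l2 p * c)) <= 2 * eta)
      by (apply happrox; [exact hz' | apply hc]).
    rewrite f1 in s1; rewrite f3 in s3; destruct hd as [-> | ->].
    - apply (hopp a b); auto; nra.
    - apply (hopp b a); auto; nra. }
  pose proof (sin2_cos2 (theta 0)) as hcs; unfold Rsqr in hcs; fold c z in hcs.
  assert (hfin : (l1 p * c + l2 p * z) * (l1 p * c + l2 p * z)
                 + (l1 p * - z + l2 p * c) * (l1 p * - z + l2 p * c) = Q).
  { transitivity ((z * z + c * c) * Q); [unfold Q; ring | rewrite hcs; ring]. }
  assert (hsq : forall x, Rabs x <= 2 * eta -> x * x <= 4 * (eta * eta)).
  { intros x hx; apply Rabs_le_between in hx; nra. }
  apply hsq in g0; apply hsq in g1; nra.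
Qed.

Lemma pow_mult_neq_0 (x psi : R) (n : nat) : x <> 0 -> psi <> 0 -> x ^ n * psi <> 0.
Proof.
  intros hx hpsi; apply Rmult_integral_contrapositive_currified; [| exact hpsi].
  now apply pow_nonzero.
Qed.

(** Across an axis the product [A * B] of the components of the field is a
    smooth square root of [x ^ (2 n)] times a unit, hence keeps its sign when
    [n] is even.  This is where smoothness of the flow enters: a continuous
    field may switch branches on the axis. *)
Lemma axis_sign (A B : R * R -> R) (phi psi chi : R -> R) (y0 rho : R) (n : nat) :
  0 < rho ->
  smooth_on (fun q => Rabs (fst q) < rho /\ Rabs (snd q - y0) < rho) A ->
  smooth_on (fun q => Rabs (fst q) < rho /\ Rabs (snd q - y0) < rho) B ->
  (forall x y, Rabs x < rho -> Rabs (y - y0) < rho ->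
     phi x * (A (x, y) * A (x, y)) = chi y * (B (x, y) * B (x, y)) /\
     (A (x, y) <> 0 \/ B (x, y) <> 0)) ->
  (forall x, Rabs x < rho -> phi x = x ^ (2 * n) * psi x /\ psi x <> 0) ->
  smooth_near rho psi ->
  (forall y, Rabs (y - y0) < rho -> chi y <> 0) ->
  Nat.Even n -> n <> 0%nat ->
  exists eps, eps <> 0 /\
    forall x y, Rabs x < rho -> Rabs (y - y0) < rho -> 0 <= eps * (A (x, y) * B (x, y)).
Proof.
  intros hrho hA hB hrel hphi hpsi hchi hev hn.
  set (Bx := fun q : R * R => Rabs (fst q) < rho /\ Rabs (snd q - y0) < rho) in *.
  assert (hBx : open Bx).
  { apply open_and; [apply open_strip |].
    apply (open_comp (fun q : R * R => snd q - y0) (fun x => Rabs x < rho));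
      [| apply open_Rabs_lt].
    intros q _; apply (smooth_on_continuous (fun _ => True)); [| exact I].
    apply smooth_on_minus; [apply open_true | apply smooth_on_snd |].
    exact (smooth_on_const _ y0). }
  assert (hy0 : Rabs (y0 - y0) < rho) by (rewrite Rminus_diag, Rabs_R0; exact hrho).
  assert (h00 : Rabs 0 < rho) by now rewrite Rabs_R0.
  set (s := fun q => A q * B q).
  assert (hs : smooth_on Bx s) by now apply smooth_on_mult.
  assert (hzero : forall y, Rabs (y - y0) < rho -> B (0, y) = 0 /\ A (0, y) <> 0).
  { intros y hy; destruct (hrel 0 y h00 hy) as [e hAB].
    destruct (hphi 0 h00) as [e0 _]; rewrite e0, pow_i, !Rmult_0_l in e by lia.
    specialize (hchi y hy).
    assert (hB0 : B (0, y) = 0).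
    { symmetry in e; apply Rmult_integral in e as [e | e]; [contradiction |].
      apply Rmult_integral in e; tauto. }
    split; [exact hB0 | tauto]. }
  assert (hnz : forall x y, Rabs x < rho -> Rabs (y - y0) < rho -> x <> 0 -> s (x, y) <> 0).
  { intros x y hx hy hx0 e; destruct (hrel x y hx hy) as [e' hAB].
    destruct (hphi x hx) as [e0 hpx]; specialize (hchi y hy).
    assert (hp : phi x <> 0) by (rewrite e0; now apply pow_mult_neq_0).
    apply Rmult_integral in e as [e | e]; rewrite e, !Rmult_0_l, Rmult_0_r in e'.
    - symmetry in e'; apply Rmult_integral in e' as [e' | e']; [contradiction |].
      apply Rmult_integral in e'; tauto.
    - apply Rmult_integral in e' as [e' | e']; [contradiction |].
      apply Rmult_integral in e'; tauto. }
  assert (hAn : smooth_near rho (fun x => A (x, y0))).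
  { intros x hx; apply (smooth_on_horizontal Bx); [exact hA | split; auto]. }
  assert (hb : smooth_near rho (fun x => s (x, y0))).
  { intros x hx; apply (smooth_on_horizontal Bx); [exact hs | split; auto]. }
  set (a := fun x => A (x, y0)).
  destruct (smooth_sqrt_factor rho (fun x => s (x, y0))
              (fun x => (a x * a x) * (a x * a x) * (psi x * / chi y0)) n hrho hb)
    as (beta & hbeta & hb0 & hfac).
  { assert (ca : continuous a 0) by now apply (smooth_near_continuous rho).
    assert (caa : continuous (fun x => a x * a x) 0) by now apply (continuous_mult a a).
    apply (continuous_mult (fun x => (a x * a x) * (a x * a x)) (fun x => psi x * / chi y0)).
    - now apply (continuous_mult (fun x => a x * a x) (fun x => a x * a x)).
    - apply (continuous_mult psi (fun _ => / chi y0)); [| apply continuous_const].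
      now apply (smooth_near_continuous rho). }
  { intros x hx _; destruct (hrel x y0 hx hy0) as [e _].
    destruct (hphi x hx) as [e0 _]; unfold s, a; specialize (hchi y0 hy0).
    apply (Rmult_eq_reg_l (chi y0)); [| exact hchi].
    transitivity (A (x, y0) * A (x, y0) * (chi y0 * (B (x, y0) * B (x, y0)))); [ring |].
    rewrite <- e, e0; field; exact hchi. }
  assert (hb0n : beta 0 <> 0).
  { intros e; rewrite e, Rmult_0_l in hb0; symmetry in hb0.
    destruct (hzero y0 hy0) as [_ hA0]; change (A (0, y0)) with (a 0) in hA0.
    revert hb0; repeat apply Rmult_integral_contrapositive_currified; auto.
    - now apply hphi.
    - now apply Rinv_neq_0_compat, hchi. }
  destruct (locally_same_sign beta (smooth_near_continuous _ _ _ hbeta h00) hb0n)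
    as (r1 & hr1 & hsg).
  set (x1 := Rmin rho r1 / 2).
  assert (hx1 : 0 < x1 /\ x1 < rho /\ x1 < r1).
  { pose proof (Rmin_pos _ _ hrho hr1); pose proof (Rmin_l rho r1);
      pose proof (Rmin_r rho r1); unfold x1; lra. }
  assert (habs : Rabs x1 = x1 /\ Rabs (- x1) = x1)
    by (rewrite Rabs_Ropp, Rabs_pos_eq by lra; auto).
  assert (hseed : forall x, Rabs x = x1 -> 0 < s (x, y0) * beta 0).
  { intros x hx; rewrite (hfac x) by lra.
    rewrite Rmult_assoc; apply Rmult_lt_0_compat; [| apply hsg; lra].
    assert (x <> 0) by (intros e; rewrite e, Rabs_R0 in hx; lra).
    pose proof (pow_even_nonneg x n hev); pose proof (pow_nonzero x n H); lra. }
  exists (beta 0); split; [exact hb0n |]; intros x y hx hy.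
  destruct (Req_dec x 0) as [-> | hx0].
  { destruct (hzero y hy) as [-> _]; rewrite !Rmult_0_r; lra. }
  assert (hgo : exists x', Rabs x' = x1 /\ 0 < x * x').
  { destruct (Rlt_dec 0 x); [exists x1 | exists (- x1)]; split; try tauto; nra. }
  destruct hgo as (x' & hx' & hxx').
  set (g := fun t => s (x' + t * (x - x'), y0 + t * (y - y0))).
  assert (hseg : forall t, 0 <= t <= 1 ->
            Rabs (x' + t * (x - x')) < rho /\ Rabs (y0 + t * (y - y0) - y0) < rho /\
            x' + t * (x - x') <> 0).
  { intros t ht; split; [| split].
    - replace (x' + t * (x - x')) with ((1 - t) * x' + t * x) by ring.
      eapply Rle_lt_trans; [apply Rabs_triang |].
      rewrite !Rabs_mult, (Rabs_pos_eq t), (Rabs_pos_eq (1 - t)) by lra.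
      apply (Rle_lt_trans _ (Rmax (Rabs x') (Rabs x))); [| apply Rmax_lub_lt; lra].
      pose proof (Rmax_l (Rabs x') (Rabs x)); pose proof (Rmax_r (Rabs x') (Rabs x)).
      nra.
    - replace (y0 + t * (y - y0) - y0) with (t * (y - y0)) by ring.
      rewrite Rabs_mult, (Rabs_pos_eq t) by lra; pose proof (Rabs_pos (y - y0)); nra.
    - intros e.
      assert (hx'0 : x' <> 0) by (intros z; rewrite z in hxx'; lra).
      assert (x' * (x' + t * (x - x')) = (1 - t) * (x' * x') + t * (x * x')) by ring.
      rewrite e, Rmult_0_r in H; nra. }
  assert (hg1 : g 1 = A (x, y) * B (x, y)).
  { unfold g, s; now replace (x' + 1 * (x - x')) with x by ring;
      replace (y0 + 1 * (y - y0)) with y by ring. }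
  rewrite <- hg1, Rmult_comm; left.
  apply (same_sign_of_no_zero g 0 1); [lra | | |].
  - intros t ht; apply continuity_pt_filterlim.
    apply (ex_derive_continuous g); eexists.
    apply (C1_is_derive_curve Bx s (fun t => x' + t * (x - x')) (fun t => y0 + t * (y - y0))
             t (x - x') (y - y0)); auto.
    + now apply smooth_on_Ck.
    + destruct (hseg t ht) as (i1 & i2 & _); now split.
    + auto_derive; [exact I | ring].
    + auto_derive; [exact I | ring].
  - intros t ht; destruct (hseg t ht) as (i1 & i2 & i3); now apply hnz.
  - unfold g; rewrite !Rmult_0_l, !Rplus_0_r; now apply hseed.
Qed.

(** On the second axis the first one is used with exchanged coordinates; off the
    axes the product does not vanish and continuity suffices. *)
Lemma local_sign (O : R * R -> Prop) (A B : R * R -> R) (phi1 phim1 psi1 psim1 : R -> R)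
  (r : R) (n : nat) (x0 y0 : R) :
  open O -> O (x0, y0) -> smooth_on O A -> smooth_on O B ->
  (forall x y, O (x, y) ->
     Rabs x < r /\ Rabs y < r /\
     phi1 x * (A (x, y) * A (x, y)) = phim1 y * (B (x, y) * B (x, y)) /\
     (A (x, y) <> 0 \/ B (x, y) <> 0)) ->
  (forall x, Rabs x < r -> phi1 x = x ^ (2 * n) * psi1 x /\ psi1 x <> 0) ->
  (forall x, Rabs x < r -> phim1 x = x ^ (2 * n) * psim1 x /\ psim1 x <> 0) ->
  smooth_near r psi1 -> smooth_near r psim1 ->
  Nat.Even n -> n <> 0%nat -> (x0, y0) <> (0, 0) ->
  exists eps, eps <> 0 /\ locally (x0, y0) (fun w => 0 <= eps * (A w * B w)).
Proof.
  intros hO hw0 hA hB hrel h1 hm1 hs1 hsm1 hev hn hne.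
  destruct (hrel x0 y0 hw0) as (hx0r & hy0r & hrel0 & hnv0).
  destruct (proj1 (locally_box O x0 y0) (hO _ hw0)) as (r0 & hr0 & hbox).
  destruct (Req_dec x0 0) as [zx | nx]; [| destruct (Req_dec y0 0) as [zy | ny]].
  - subst x0.
    assert (ny : y0 <> 0) by (intros ->; now apply hne).
    assert (hay : 0 < Rabs y0) by now apply Rabs_pos_lt.
    set (rho := Rmin r0 (Rabs y0)).
    assert (hrho : 0 < rho) by now apply Rmin_pos.
    assert (l0 : rho <= r0) by apply Rmin_l; assert (ly : rho <= Rabs y0) by apply Rmin_r.
    assert (hin : forall x y, Rabs x < rho -> Rabs (y - y0) < rho -> O (x, y)).
    { intros x y hx hy; apply hbox; [rewrite Rminus_0_r |]; lra. }
    assert (hy0' : Rabs (y0 - y0) < rho) by (rewrite Rminus_diag, Rabs_R0; exact hrho).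
    assert (hxr : forall x, Rabs x < rho -> Rabs x < r).
    { intros x hx; now apply (hrel x y0), hin. }
    destruct (axis_sign A B phi1 psi1 phim1 y0 rho n) as (eps & he & hsg); auto.
    + apply (smooth_on_subset O); auto; intros [x y] [hx hy]; now apply hin.
    + apply (smooth_on_subset O); auto; intros [x y] [hx hy]; now apply hin.
    + intros x y hx hy; now apply hrel, hin.
    + intros x hx; exact (hs1 x (hxr x hx)).
    + intros y hy.
      assert (hyr : Rabs y < r) by (apply (hrel 0 y), hin; auto; now rewrite Rabs_R0).
      destruct (hm1 y hyr) as [-> hp]; apply pow_mult_neq_0; auto.
      intros ->; rewrite Rminus_0_l, Rabs_Ropp in hy; lra.
    + exists eps; split; [exact he |]; apply locally_box; exists rho; split; auto.
      intros x y hx hy; apply hsg; [rewrite Rminus_0_r in hx |]; auto.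
  - subst y0.
    assert (hax : 0 < Rabs x0) by now apply Rabs_pos_lt.
    set (rho := Rmin r0 (Rabs x0)).
    assert (hrho : 0 < rho) by now apply Rmin_pos.
    assert (l0 : rho <= r0) by apply Rmin_l; assert (ly : rho <= Rabs x0) by apply Rmin_r.
    assert (hin : forall x y, Rabs (x - x0) < rho -> Rabs y < rho -> O (x, y)).
    { intros x y hx hy; apply hbox; [| rewrite Rminus_0_r]; lra. }
    assert (hx0' : Rabs (x0 - x0) < rho) by (rewrite Rminus_diag, Rabs_R0; exact hrho).
    assert (hyr : forall y, Rabs y < rho -> Rabs y < r).
    { intros y hy; now apply (hrel x0 y), hin. }
    set (O' := fun w : R * R => Rabs (fst w) < rho /\ Rabs (snd w - x0) < rho).
    assert (hO' : open O').
    { apply open_and; [apply open_strip |].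
      apply (open_comp (fun q : R * R => snd q - x0) (fun x => Rabs x < rho));
        [| apply open_Rabs_lt].
      intros q _; apply (smooth_on_continuous (fun _ => True)); [| exact I].
      apply smooth_on_minus; [apply open_true | apply smooth_on_snd |].
      exact (smooth_on_const _ x0). }
    assert (hsw : forall F, smooth_on O F -> smooth_on O' (fun w => F (swap w))).
    { intros F hF; apply (smooth_on_compose O O' F swap); auto; [| apply smooth_swap].
      intros [y x] [hy hx]; now apply hin. }
    destruct (axis_sign (fun w => B (swap w)) (fun w => A (swap w)) phim1 psim1 phi1 x0 rho n)
      as (eps & he & hsg); auto.
    + intros y x hy hx; destruct (hrel x y (hin x y hx hy)) as (_ & _ & e & h).
      unfold swap; simpl; split; [now symmetry | tauto].
    + intros y hy; exact (hsm1 y (hyr y hy)).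
    + intros x hx.
      assert (hxr : Rabs x < r) by (apply (hrel x 0), hin; auto; now rewrite Rabs_R0).
      destruct (h1 x hxr) as [-> hp]; apply pow_mult_neq_0; auto.
      intros ->; rewrite Rminus_0_l, Rabs_Ropp in hx; lra.
    + exists eps; split; [exact he |]; apply locally_box; exists rho; split; auto.
      intros x y hx hy; rewrite Rminus_0_r in hy.
      rewrite (Rmult_comm (A (x, y))); exact (hsg y x hy hx).
  - destruct (h1 x0 hx0r) as [e1 p1]; destruct (hm1 y0 hy0r) as [em pm].
    assert (n1 : phi1 x0 <> 0) by (rewrite e1; now apply pow_mult_neq_0).
    assert (nm : phim1 y0 <> 0) by (rewrite em; now apply pow_mult_neq_0).
    assert (hs0 : A (x0, y0) * B (x0, y0) <> 0).
    { intros e; apply Rmult_integral in e as [e | e];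
        rewrite e, !Rmult_0_l, Rmult_0_r in hrel0.
      - symmetry in hrel0; apply Rmult_integral in hrel0 as [k | k]; [contradiction |].
        apply Rmult_integral in k; tauto.
      - apply Rmult_integral in hrel0 as [k | k]; [contradiction |].
        apply Rmult_integral in k; tauto. }
    assert (hs : smooth_on O (fun w => A (x0, y0) * B (x0, y0) * (A w * B w)))
      by (apply smooth_on_scal; auto; now apply smooth_on_mult).
    exists (A (x0, y0) * B (x0, y0)); split; [exact hs0 |].
    apply (filter_imp (fun w => 0 < A (x0, y0) * B (x0, y0) * (A w * B w)));
      [intros; now apply Rlt_le |].
    apply (smooth_on_continuous O _ (x0, y0) hs hw0 (fun t => 0 < t)), (open_gt 0); nra.
Qed.

Lemma locally_constant_constant (P : R -> Prop) :
  (forall t, P t -> locally t P) -> (forall t, ~ P t -> locally t (fun u => ~ P u)) ->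
  forall a b, P a -> P b.
Proof.
  intros h1 h2 a b ha.
  set (chi := fun t => if excluded_middle_informative (P t) then 1 else 0).
  assert (hchi : forall t, is_derive chi t 0).
  { intros t; apply (is_derive_ext_loc (fun _ => chi t)); [| apply @is_derive_const].
    unfold chi; destruct (excluded_middle_informative (P t)) as [p | np].
    - generalize (h1 t p); apply filter_imp; intros u hu.
      now destruct (excluded_middle_informative (P u)).
    - generalize (h2 t np); apply filter_imp; intros u hu.
      now destruct (excluded_middle_informative (P u)). }
  destruct (MVT_gen chi a b (fun _ => 0)) as (z & _ & e).
  - intros; apply hchi.
  - intros t _; apply continuity_pt_filterlim, (ex_derive_continuous chi).
    eexists; apply hchi.
  - rewrite Rmult_0_l in e; unfold chi in e.
    destruct (excluded_middle_informative (P b)); [assumption |].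
    destruct (excluded_middle_informative (P a)); [lra | contradiction].
Qed.

Lemma continuous_ray (p : R * R) (s t : R) : continuous (fun t => ray p (dir t) s) t.
Proof.
  unfold ray; simpl.
  apply (continuous_comp_2 (fun t => fst p + s * cos t) (fun t => snd p + s * sin t)
           (fun a b => (a, b))).
  - apply (ex_derive_continuous (fun t => fst p + s * cos t)); auto_derive; exact I.
  - apply (ex_derive_continuous (fun t => snd p + s * sin t)); auto_derive; exact I.
  - apply (continuous_ext (fun z => z)); [intros [a b]; reflexivity |].
    apply continuous_id.
Qed.

Lemma ray_dir_neq (p : R * R) (s t : R) : 0 < s -> ray p (dir t) s <> p.
Proof.
  intros hs e; destruct p as [a b]; unfold ray in e; simpl in e.
  injection e; intros e2 e1; pose proof (sin2_cos2 t) as h; unfold Rsqr in h.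
  assert (z1 : s * cos t = 0) by lra; assert (z2 : s * sin t = 0) by lra.
  apply Rmult_integral in z1 as [z1 | z1]; [lra |].
  apply Rmult_integral in z2 as [z2 | z2]; [lra |].
  rewrite z1, z2 in h; lra.
Qed.

Section NoFlow.

Context {c : R} (U : R * R -> Prop) (f nu : R * R -> ambient c) (p : R * R)
  (N : R * R -> Prop) (G : R * R -> R * R) (V : R * R -> Prop) (H : R * R -> R * R)
  (hS : surface U f nu) (htl : time_like_on U f) (hG : null_chart U f p N G V H)
  (phi1 phim1 psi1 psim1 : R -> R) (r : R) (n : nat) (hr : 0 < r)
  (hII : forall x y, Rabs x < r -> Rabs y < r -> N (x, y) /\
     m11 (second_form (pull G f) (pull G nu) (x, y)) = phi1 x /\
     m22 (second_form (pull G f) (pull G nu) (x, y)) = phim1 y)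
  (h1 : forall x, Rabs x < r -> phi1 x = x ^ (2 * n) * psi1 x /\ psi1 x <> 0)
  (hm1 : forall x, Rabs x < r -> phim1 x = x ^ (2 * n) * psim1 x /\ psim1 x <> 0)
  (hs1 : smooth_near r psi1) (hsm1 : smooth_near r psim1)
  (hev : Nat.Even n) (hn : n <> 0%nat)
  (D : R * R -> R * R -> Prop) (V1 : R * R -> Prop) (hV1 : open V1) (hpV1 : V1 p)
  (hDs : smooth_direction_field_on (fun q => V1 q /\ q <> p) D)
  (hDc : forall q, V1 q -> q <> p -> forall w, D q w -> exists k,
     mat2_app (shape_operator f nu q) w = (k * fst w, k * snd w)).

Let a (q w : R * R) : R := fst (mat2_app (jacobian H q) w).
Let b (q w : R * R) : R := snd (mat2_app (jacobian H q) w).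

Let region (w : R * R) : Prop :=
  N w /\ V1 (G w) /\ (Rabs (fst w) < r /\ Rabs (snd w) < r) /\ w <> (0, 0).

Lemma region_neq (w : R * R) : region w -> V (G w) /\ H (G w) = w /\ G w <> p.
Proof.
  intros (hN & _ & _ & h0); destruct (nc_GH _ _ _ _ _ _ _ hG w hN) as [i1 i2].
  split; [exact i1 |]; split; [exact i2 |].
  intros e; apply h0; rewrite <- i2, e; exact (chart_center_inv U f p N G V H hG).
Qed.

Lemma flow_relation (w v : R * R) :
  region w -> D (G w) v ->
  phi1 (fst w) * (a (G w) v * a (G w) v) = phim1 (snd w) * (b (G w) v * b (G w) v).
Proof.
  intros hw hv; pose proof hw as (hN & hV1w & (hx & hy) & h0).
  destruct (region_neq w hw) as (i1 & i2 & i3).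
  destruct (hDc _ hV1w i3 v hv) as [k hk].
  pose proof (chart_principal_direction U f nu p N G V H hS htl hG (G w) v k i1 hk) as e.
  rewrite i2 in e; destruct w as [x y]; destruct (hII x y hx hy) as (_ & e1 & e2).
  rewrite e1, e2 in e; exact e.
Qed.

Lemma components_neq_0 (w v : R * R) :
  region w -> v <> (0, 0) -> a (G w) v <> 0 \/ b (G w) v <> 0.
Proof.
  intros hw hv; destruct (region_neq w hw) as (i1 & _ & _).
  destruct (chart_shape U f nu p N G V H hS htl hG (G w) i1) as [hdet _].
  destruct (Req_dec (a (G w) v) 0) as [z | nz]; [| now left].
  destruct (Req_dec (b (G w) v) 0) as [z' | nz']; [| now right].
  exfalso; apply hv, (mat2_app_inj (jacobian H (G w))); [exact hdet |].
  rewrite (surjective_pairing (mat2_app _ v)); fold (a (G w) v) (b (G w) v).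
  rewrite z, z'; unfold mat2_app; simpl; f_equal; ring.
Qed.

Lemma flow_local_sign (w0 : R * R) :
  region w0 ->
  exists eps, eps <> 0 /\
    locally w0 (fun w => forall v, D (G w) v -> 0 <= eps * (a (G w) v * b (G w) v)).
Proof.
  intros hw0; pose proof hw0 as (hN & hV1w & (hx & hy) & h0).
  destruct (region_neq w0 hw0) as (i1 & i2 & i3).
  destruct (hDs (G w0) (conj hV1w i3)) as (Wq & X & hWo & hWq & hWV & [hX1 hX2] & hX).
  set (O := fun w => (N w /\ Wq (G w)) /\ (Rabs (fst w) < r /\ Rabs (snd w) < r)).
  assert (hNo : open N) by apply hG.
  assert (hGs : smooth_plane_map_on N G) by apply hG.
  assert (hO : open O).
  { apply open_and; [now apply open_preimage |].
    apply open_and; [apply open_strip | apply open_strip_snd]. }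
  assert (hOr : forall w, O w -> region w).
  { intros w ((o1 & o2) & o3); destruct (hWV _ o2) as [o4 o5].
    split; [exact o1 |]; split; [exact o4 |]; split; [exact o3 |].
    intros e; apply o5; rewrite e; apply hG. }
  set (VW := fun q => V q /\ Wq q).
  assert (hVW : open VW) by (apply open_and; [apply hG | exact hWo]).
  destruct (nc_smooth_H _ _ _ _ _ _ _ hG) as [hH1 hH2].
  assert (hX1' : smooth_on VW (fun q => fst (X q)))
    by (apply (smooth_on_subset Wq); auto; now intros q [_ h]).
  assert (hX2' : smooth_on VW (fun q => snd (X q)))
    by (apply (smooth_on_subset Wq); auto; now intros q [_ h]).
  assert (hsub : forall F, smooth_on V F -> smooth_on VW F)
    by (intros F; apply smooth_on_subset; now intros q [h _]).
  assert (hcomp : forall F, smooth_on VW F -> smooth_on O (fun w => F (G w))).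
  { intros F hF; apply (smooth_on_compose VW O F G); auto.
    - intros w hw; split; [apply (region_neq w (hOr w hw)) | apply hw].
    - apply (smooth_plane_map_subset N); auto; now intros w [[h _] _]. }
  assert (hrel : forall x y, O (x, y) -> Rabs x < r /\ Rabs y < r /\
     phi1 x * (a (G (x, y)) (X (G (x, y))) * a (G (x, y)) (X (G (x, y))))
     = phim1 y * (b (G (x, y)) (X (G (x, y))) * b (G (x, y)) (X (G (x, y)))) /\
     (a (G (x, y)) (X (G (x, y))) <> 0 \/ b (G (x, y)) (X (G (x, y))) <> 0)).
  { intros x y hw; pose proof hw as ((_ & o2) & (o3 & o4)); simpl in o3, o4.
    destruct (hX _ o2) as [nz hspan].
    split; [exact o3 |]; split; [exact o4 |]; split.
    - apply (flow_relation (x, y)); [now apply hOr |].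
      apply hspan; exists 1; rewrite !Rmult_1_l; apply surjective_pairing.
    - apply components_neq_0; [now apply hOr | exact nz]. }
  destruct w0 as [x0 y0].
  destruct (local_sign O (fun w => a (G w) (X (G w))) (fun w => b (G w) (X (G w)))
              phi1 phim1 psi1 psim1 r n x0 y0) as (eps & he & hloc); auto.
  - now split.
  - apply (hcomp (fun q => a q (X q))).
    unfold a, mat2_app, jacobian; simpl.
    apply smooth_on_plus; auto; apply smooth_on_mult; auto; apply hsub;
      [now apply smooth_on_D1 | now apply smooth_on_D2].
  - apply (hcomp (fun q => b q (X q))).
    unfold b, mat2_app, jacobian; simpl.
    apply smooth_on_plus; auto; apply smooth_on_mult; auto; apply hsub;
      [now apply smooth_on_D1 | now apply smooth_on_D2].
  - exists eps; split; [exact he |].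
    assert (hOw0 : O (x0, y0)) by now split.
    generalize (filter_and _ _ (hO _ hOw0) hloc); apply filter_imp.
    intros w [[[_ o2] _] hw] v hv.
    apply hX in hv as [t ->]; [| exact o2].
    apply (Rle_trans _ (t * t * (eps * (a (G w) (X (G w)) * b (G w) (X (G w)))))).
    + apply Rmult_le_pos; [apply Rle_0_sqr | exact hw].
    + right; unfold a, b; rewrite mat2_app_scal; cbn [fst snd]; ring.
Qed.

Let signed (eps : R) (w : R * R) : Prop :=
  locally w (fun w => forall v, D (G w) v -> 0 <= eps * (a (G w) v * b (G w) v)).

(** The sign is locally constant on the punctured neighborhood, and well defined
    since points off the axes, where the product does not vanish, are dense. *)
Lemma signed_or (w : R * R) : region w -> signed 1 w \/ signed (-1) w.
Proof.
  intros hw; destruct (flow_local_sign w hw) as (eps & he & hloc).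
  destruct (Rlt_dec 0 eps) as [hp | hp]; [left | right];
    unfold signed; revert hloc; apply filter_imp; intros z hz v hv;
    specialize (hz v hv).
  - rewrite Rmult_1_l; apply (Rmult_le_reg_l eps); lra.
  - apply (Rmult_le_reg_l (- eps)); lra.
Qed.

Lemma signed_exclusive (w : R * R) : region w -> signed 1 w -> signed (-1) w -> False.
Proof.
  intros hw s1 s2.
  assert (hreg : locally w region).
  { assert (ho : open region).
    { assert (hNo : open N) by apply hG.
      apply (open_ext (fun w => (N w /\ V1 (G w)) /\
               ((Rabs (fst w) < r /\ Rabs (snd w) < r) /\ w <> (0, 0)))).
      - intros z; unfold region; tauto.
      - apply open_and; [apply open_preimage; auto; apply hG |].
        apply open_and; [| apply open_neq_point].
        apply open_and; [apply open_strip | apply open_strip_snd]. }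
    now apply ho. }
  destruct w as [x0 y0].
  pose proof (filter_and _ _ hreg (filter_and _ _ s1 s2)) as h.
  apply locally_box in h as (e & he & h).
  assert (hpick : forall z, exists x, x <> 0 /\ Rabs (x - z) < e).
  { intros z; destruct (Req_dec (z + e / 2) 0) as [k | k].
    - exists (z + e / 3); split; [lra |].
      replace (z + e / 3 - z) with (e / 3) by ring; rewrite Rabs_pos_eq; lra.
    - exists (z + e / 2); split; [exact k |].
      replace (z + e / 2 - z) with (e / 2) by ring; rewrite Rabs_pos_eq; lra. }
  destruct (hpick x0) as (x & nx & hx); destruct (hpick y0) as (y & ny & hy).
  destruct (h x y hx hy) as (hreg' & k1 & k2).
  pose proof hreg' as (hN & hV1w & (hxr & hyr) & h0); simpl in hxr, hyr.
  destruct (region_neq _ hreg') as (i1 & i2 & i3).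
  destruct (hDs _ (conj hV1w i3)) as (Wq & X & _ & hWq & _ & _ & hX).
  destruct (hX _ hWq) as [nz hspan].
  set (v := X (G (x, y))) in *.
  assert (hv : D (G (x, y)) v).
  { apply hspan; exists 1; rewrite !Rmult_1_l; apply surjective_pairing. }
  pose proof (flow_relation _ v hreg' hv) as e1; simpl in e1.
  pose proof (components_neq_0 _ v hreg' nz) as e2.
  specialize (k1 v hv); specialize (k2 v hv).
  destruct (h1 x hxr) as [f1 f2]; destruct (hm1 y hyr) as [f3 f4].
  assert (p1 : phi1 x <> 0) by (rewrite f1; now apply pow_mult_neq_0).
  assert (pm : phim1 y <> 0) by (rewrite f3; now apply pow_mult_neq_0).
  assert (hab : a (G (x, y)) v * b (G (x, y)) v = 0) by lra.
  apply Rmult_integral in hab as [z | z]; rewrite z, !Rmult_0_l, Rmult_0_r in e1.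
  - symmetry in e1; apply Rmult_integral in e1 as [e1 | e1]; [contradiction |].
    apply Rmult_integral in e1; tauto.
  - apply Rmult_integral in e1 as [e1 | e1]; [contradiction |].
    apply Rmult_integral in e1; tauto.
Qed.

(** Along a small circle the field stays in one pair of opposite quadrants of
    the null coordinates, so it stays transverse to a direction that is almost
    constant near [p]. *)
Lemma no_flow_of_index_one (d : R) :
  d = 1 \/ d = -1 -> ~ direction_field_index D p d.
Proof.
  intros hd (rD & hrD & hidx).
  pose proof (chart_center_inv U f p N G V H hG) as hHp.
  pose proof (chart_center_in U f p N G V H hG) as hVp.
  assert (hVo : open V) by apply hG.
  pose proof (nc_smooth_H _ _ _ _ _ _ _ hG) as hHs; pose proof hHs as [hH1 hH2].
  set (l1 := fun eps q => m11 (jacobian H q) + eps * m21 (jacobian H q)).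
  set (l2 := fun eps q => m12 (jacobian H q) + eps * m22 (jacobian H q)).
  assert (hturn : forall eps, eps = 1 \/ eps = -1 ->
    exists r0, 0 < r0 /\ forall s (theta : R -> R) (d : R),
    0 < s < r0 -> (forall t, continuity_pt theta t) -> (d = 1 \/ d = -1) ->
    theta (2 * PI) - theta 0 = 2 * PI * d ->
    ~ (forall t, 0 <= t <= 2 * PI ->
         l1 eps (ray p (dir t) s) * cos (theta t)
         + l2 eps (ray p (dir t) s) * sin (theta t) <> 0)).
  { intros eps heps; apply (no_full_turn V); auto.
    - apply (smooth_on_plus V (D1 (fun z => fst (H z)))); auto.
      + now apply smooth_on_D1.
      + now apply smooth_on_scal, smooth_on_D1.
    - apply (smooth_on_plus V (D2 (fun z => fst (H z)))); auto.
      + now apply smooth_on_D2.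
      + now apply smooth_on_scal, smooth_on_D2.
    - destruct (chart_shape U f nu p N G V H hS htl hG p hVp) as [hdet _].
      destruct (Req_dec (l1 eps p) 0) as [z1 | nz1]; [| now left].
      destruct (Req_dec (l2 eps p) 0) as [z2 | nz2]; [| now right].
      exfalso; apply hdet; unfold l1 in z1; unfold l2 in z2; unfold mat2_det.
      replace (m11 (jacobian H p)) with (- (eps * m21 (jacobian H p))) by lra.
      replace (m12 (jacobian H p)) with (- (eps * m22 (jacobian H p))) by lra; ring. }
  destruct (hturn 1 ltac:(now left)) as (r1 & hr1 & turn1).
  destruct (hturn (-1) ltac:(now right)) as (r2 & hr2 & turn2).
  assert (hnear : locally p (fun q => V q /\ V1 q /\
            (Rabs (fst (H q)) < r /\ Rabs (snd (H q)) < r))).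
  { apply filter_and; [now apply hVo |]; apply filter_and; [now apply hV1 |].
    apply (smooth_plane_map_continuous V H p hHs hVp
             (fun w => Rabs (fst w) < r /\ Rabs (snd w) < r)).
    rewrite hHp; apply (open_and (fun w : R * R => Rabs (fst w) < r)
                          (fun w => Rabs (snd w) < r)).
    - apply open_strip.
    - apply open_strip_snd.
    - simpl; rewrite Rabs_R0; auto. }
  destruct (locally_small_circles _ p hnear) as (r3 & hr3 & hcirc).
  assert (exists s, 0 < s /\ s < rD /\ s < r1 /\ s < r2 /\ s < r3)
    as (s & hs0 & hsD & hsr1 & hsr2 & hsr3).
  { exists (Rmin (Rmin rD r1) (Rmin r2 r3) / 2).
    pose proof (Rmin_l rD r1); pose proof (Rmin_r rD r1).
    pose proof (Rmin_l r2 r3); pose proof (Rmin_r r2 r3).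
    pose proof (Rmin_l (Rmin rD r1) (Rmin r2 r3)).
    pose proof (Rmin_r (Rmin rD r1) (Rmin r2 r3)).
    assert (0 < Rmin (Rmin rD r1) (Rmin r2 r3)) by (repeat apply Rmin_pos; auto); lra. }
  destruct (hidx s (conj hs0 hsD)) as (theta & hcont & hD & hfull).
  set (gamma := fun t => H (ray p (dir t) s)).
  assert (hGg : forall t, G (gamma t) = ray p (dir t) s).
  { intros t; destruct (hcirc s t (conj hs0 hsr3)) as (i1 & _).
    exact (proj2 (nc_HG _ _ _ _ _ _ _ hG _ i1)). }
  assert (hreg : forall t, region (gamma t)).
  { intros t; destruct (hcirc s t (conj hs0 hsr3)) as (i1 & i2 & i3).
    split; [exact (proj1 (nc_HG _ _ _ _ _ _ _ hG _ i1)) |].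
    split; [rewrite hGg; exact i2 |]; split; [exact i3 |].
    intros e; apply (ray_dir_neq p s t hs0).
    rewrite <- hGg, e; apply hG. }
  assert (hgc : forall t, continuous gamma t).
  { intros t; apply (continuous_comp (fun t => ray p (dir t) s) H).
    - apply continuous_ray.
    - apply (smooth_plane_map_continuous V); auto; apply (hcirc s t (conj hs0 hsr3)). }
  assert (hop : forall eps t, signed eps (gamma t) ->
            locally t (fun u => signed eps (gamma u))).
  { intros eps t ht; apply (hgc t (signed eps)), locally_locally, ht. }
  assert (hconst : forall t u, signed 1 (gamma t) -> signed 1 (gamma u)).
  { apply (locally_constant_constant (fun t => signed 1 (gamma t))); [apply hop |].
    intros t ht; destruct (signed_or _ (hreg t)) as [k | k]; [contradiction |].
    generalize (hop _ _ k); apply filter_imp; intros u hu hu'.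
    exact (signed_exclusive _ (hreg u) hu' hu). }
  assert (hall : exists eps, (eps = 1 \/ eps = -1) /\ forall t, signed eps (gamma t)).
  { destruct (signed_or _ (hreg 0)) as [k | k].
    - exists 1; split; [now left |]; intros t; now apply (hconst 0).
    - exists (-1); split; [now right |]; intros t.
      destruct (signed_or _ (hreg t)) as [k' | k']; [exfalso | exact k'].
      apply (signed_exclusive _ (hreg 0)); [now apply (hconst t) | exact k]. }
  destruct hall as (eps & heps & hall).
  assert (hnz : forall t, 0 <= t <= 2 * PI ->
            l1 eps (ray p (dir t) s) * cos (theta t)
            + l2 eps (ray p (dir t) s) * sin (theta t) <> 0).
  { intros t ht e; pose proof (locally_singleton _ _ (hall t)) as hk.
    specialize (hk (cos (theta t), sin (theta t))); rewrite hGg in hk.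
    specialize (hk (hD t ht)).
    pose proof (components_neq_0 _ (cos (theta t), sin (theta t)) (hreg t)) as hc.
    rewrite hGg in hc; unfold a, b, mat2_app in hk, hc; cbn [fst snd] in hk, hc.
    set (A := m11 _ * _ + m12 _ * _) in *; set (B := m21 _ * _ + m22 _ * _) in *.
    assert (eAB : A + eps * B = 0) by (rewrite <- e; unfold A, B, l1, l2; ring).
    assert (hv : (cos (theta t), sin (theta t)) <> (0, 0)).
    { intros z; injection z; intros z2 z1; pose proof (sin2_cos2 (theta t)) as h.
      unfold Rsqr in h; rewrite z1, z2 in h; lra. }
    specialize (hc hv); destruct heps as [-> | ->].
    - assert (hA : A = - B) by lra; rewrite hA in hk.
      assert (hB : B = 0) by nra; lra.
    - assert (hA : A = B) by lra; rewrite hA in hk.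
      assert (hB : B = 0) by nra; lra. }
  destruct heps as [-> | ->].
  - exact (turn1 s theta d (conj hs0 hsr1) hcont hd hfull hnz).
  - exact (turn2 s theta d (conj hs0 hsr2) hcont hd hfull hnz).
Qed.

End NoFlow.

(** * The theorem *)

Lemma surface_of_unit_normal {c : R} (U : R * R -> Prop) (f nu : R * R -> ambient c) :
  open U -> immersion_on U f -> unit_normal_on U f nu -> surface U f nu.
Proof.
  intros hU (hf & _) (hnu & h); split; [exact hU |]; split; [exact hf |].
  split; [exact hnu |]; intros q hq; destruct (h q hq) as (h1 & _ & h2 & h3).
  split; [| now split].
  apply Rmult_eq_0_compat.
  destruct (Req_dec c 0) as [z | nz]; [now left | right; exact (h1 nz)].
Qed.

Lemma null_order_pos {c : R} (U : R * R -> Prop) (f nu : R * R -> ambient c)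
  (p : R * R) (N : R * R -> Prop) (G : R * R -> R * R) (V : R * R -> Prop)
  (H : R * R -> R * R) (m : nat) :
  surface U f nu -> time_like_on U f -> null_chart U f p N G V H ->
  umbilic f nu p -> null_order f nu G m -> (1 <= m)%nat.
Proof.
  intros hS ht hG hum (phi1 & phim1 & (_ & _ & hII) & [_ ho] & _).
  apply locally_singleton in hII as [e _].
  assert (hVp : V p) by exact (chart_center_in U f p N G V H hG).
  destruct (chart_umbilic U f nu p N G V H hS ht hG p hVp hum) as [z _].
  rewrite (chart_center_inv U f p N G V H hG), e in z.
  destruct m as [|m]; [exfalso; now apply ho | lia].
Qed.

Section NullIndex.

Context {c : R} (U : R * R -> Prop) (f nu : R * R -> ambient c) (p : R * R)
  (N : R * R -> Prop) (G : R * R -> R * R) (V : R * R -> Prop) (H : R * R -> R * R)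
  (m : nat) (hS : surface U f nu) (ht : time_like_on U f)
  (hG : null_chart U f p N G V H) (hm : null_order f nu G m).

Lemma null_order_factors :
  exists d phi1 phim1 psi1 psim1, 0 < d /\ null_splitting f nu G phi1 phim1 /\
    smooth_near d psi1 /\ smooth_near d psim1 /\ psi1 0 <> 0 /\ psim1 0 <> 0 /\
    (forall x, Rabs x < d -> phi1 x = x ^ m * psi1 x) /\
    (forall x, Rabs x < d -> phim1 x = x ^ m * psim1 x).
Proof.
  destruct hm as (phi1 & phim1 & hsplit & o1 & om1).
  pose proof hsplit as (s1 & sm1 & _).
  apply smooth_germ_near in s1 as (d1 & hd1 & s1).
  apply smooth_germ_near in sm1 as (dm & hdm & sm1).
  assert (hd : 0 < Rmin d1 dm) by now apply Rmin_pos.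
  apply (smooth_near_le _ (Rmin d1 dm)) in s1; [| apply Rmin_l].
  apply (smooth_near_le _ (Rmin d1 dm)) in sm1; [| apply Rmin_r].
  destruct (germ_order_factor _ _ _ hd s1 o1) as (psi1 & p1 & p2 & p3).
  destruct (germ_order_factor _ _ _ hd sm1 om1) as (psim1 & q1 & q2 & q3).
  exists (Rmin d1 dm), phi1, phim1, psi1, psim1; repeat split; auto; apply hsplit.
Qed.

(** The discriminant of the shape operator is [phi1 x * phim1 y] up to a positive
    factor, so reality of the principal curvatures is a sign condition. *)
Lemma isolated_umbilic_signs (phi1 phim1 psi1 psim1 : R -> R) (d : R) :
  isolated_umbilic U f nu p -> null_splitting f nu G phi1 phim1 -> 0 < d ->
  smooth_near d psi1 -> smooth_near d psim1 -> psi1 0 <> 0 -> psim1 0 <> 0 ->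
  (forall x, Rabs x < d -> phi1 x = x ^ m * psi1 x) ->
  (forall x, Rabs x < d -> phim1 x = x ^ m * psim1 x) ->
  Nat.Even m /\ 0 < psi1 0 * psim1 0.
Proof.
  intros (_ & U1 & hU1 & hpU1 & _ & hreal & _) (_ & _ & hII) hd s1 sm1 n1 nm1 f1 fm1.
  assert (hd0 : Rabs 0 < d) by now rewrite Rabs_R0.
  assert (hN : locally (0, 0) (fun w => N w /\ U1 (G w))).
  { apply (open_preimage U1 N G); [exact hU1 | apply hG | apply hG |].
    split; [apply hG |]; now rewrite (nc_center _ _ _ _ _ _ _ hG). }
  pose proof (filter_and _ _ hN hII) as h.
  apply locally_box_0 in h as (r & hr & h).
  apply (even_of_nonneg (Rmin r d) psi1 psim1 m); auto.
  - now apply Rmin_pos.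
  - now apply (smooth_near_continuous d).
  - now apply (smooth_near_continuous d).
  - intros x y hx hy.
    pose proof (Rmin_l r d); pose proof (Rmin_r r d).
    destruct (h x y) as [[hNw hUw] [e1 e2]]; try lra; cbn [fst snd] in e1, e2.
    destruct (nc_GH _ _ _ _ _ _ _ hG _ hNw) as [i1 i2].
    pose proof (chart_real_curvatures U f nu p N G V H hS ht hG (G (x, y)) i1
                  (hreal _ hUw)) as k.
    rewrite i2, e1, e2, f1, fm1 in k by lra; exact k.
Qed.

(** Write [m = 2 n]; then [m] is divisible by four exactly when [n] is even. *)
Lemma isolated_umbilic_flow :
  (1 <= m)%nat -> isolated_umbilic U f nu p ->
  Nat.Even m /\
  ((exists D : R * R -> R * R -> Prop,
      curvature_line_flow U f nu p D /\
      (direction_field_index D p 1 \/ direction_field_index D p (-1)))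
   <-> Nat.Even m /\ ~ Nat.divide 4 m).
Proof.
  intros hm1 hiso.
  destruct null_order_factors as (d & phi1 & phim1 & psi1 & psim1 & hd & hsplit & s1 & sm1
                                  & n1 & nm1 & f1 & fm1).
  destruct (isolated_umbilic_signs phi1 phim1 psi1 psim1 d) as [hev hpos]; auto.
  split; [exact hev |]; destruct hev as [n hn].
  assert (hd0 : Rabs 0 < d) by now rewrite Rabs_R0.
  split.
  - intros (D & (V1 & hV1 & hpV1 & _ & hDs & hDc) & hidx); split; [now exists n |].
    intros [k hk].
    destruct (locally_same_sign psi1 (smooth_near_continuous _ _ _ s1 hd0) n1)
      as (r1 & hr1 & g1).
    destruct (locally_same_sign psim1 (smooth_near_continuous _ _ _ sm1 hd0) nm1)
      as (r2 & hr2 & g2).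
    pose proof hsplit as (_ & _ & hII).
    assert (hNo : locally (0, 0) N) by (apply (nc_open_N _ _ _ _ _ _ _ hG), hG).
    pose proof (filter_and _ _ hNo hII) as h.
    apply locally_box_0 in h as (r3 & hr3 & h).
    assert (exists r, 0 < r /\ r <= d /\ r <= r1 /\ r <= r2 /\ r <= r3)
      as (r & hr & rd & rr1 & rr2 & rr3).
    { exists (Rmin (Rmin d r1) (Rmin r2 r3)).
      pose proof (Rmin_l d r1); pose proof (Rmin_r d r1).
      pose proof (Rmin_l r2 r3); pose proof (Rmin_r r2 r3).
      pose proof (Rmin_l (Rmin d r1) (Rmin r2 r3)).
      pose proof (Rmin_r (Rmin d r1) (Rmin r2 r3)).
      split; [repeat apply Rmin_pos; auto | lra]. }
    assert (nz : forall psi x, 0 < psi x * psi 0 -> psi x <> 0)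
      by (intros psi x hx e; rewrite e in hx; lra).
    assert (hno : forall e, e = 1 \/ e = -1 -> ~ direction_field_index D p e).
    { apply (no_flow_of_index_one U f nu p N G V H hS ht hG phi1 phim1 psi1 psim1 r n hr)
        with (V1 := V1); auto.
      - intros x y hx hy; apply (h x y); lra.
      - intros x hx; rewrite <- hn; split; [apply f1; lra | apply nz, g1; lra].
      - intros x hx; rewrite <- hn; split; [apply fm1; lra | apply nz, g2; lra].
      - now apply (smooth_near_le d).
      - now apply (smooth_near_le d).
      - exists k; lia.
      - lia. }
    destruct hidx as [i | i]; revert i; apply hno; auto.
  - intros [_ h4].
    destruct (flow_of_index_one U f nu p N G V H phi1 phim1 psi1 psim1 d n)
      as (D & hD1 & hD2); auto.
    + intros x hx; rewrite <- hn; now apply f1.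
    + intros x hx; rewrite <- hn; now apply fm1.
    + destruct (Nat.Even_or_Odd n) as [[k hk] | o]; [exfalso | exact o].
      apply h4; exists k; lia.
    + exists D; auto.
Qed.

End NullIndex.

Theorem mainTheorem2 (c : R) (U : R * R -> Prop) (f nu : R * R -> ambient c)
  (p : R * R) (W : R * R -> Prop) (g : R * R -> R * R)
  (hU : plane_domain U)
  (hf : immersion_on U f)
  (hf_time_like : time_like_on U f)
  (hnu : unit_normal_on U f nu)
  (hH : constant_mean_curvature_on U f nu)
  (hp : U p)
  (hp_umbilic : umbilic f nu p)
  (hg : isothermal_coordinates_centered_at U f p W g)
  (hQ_finite : hopf_finite_type f nu g)
  (hQ_nondeg : hopf_nondegenerate f nu g) :
  exists m : nat, (1 <= m)%nat /\
    (forall (W' : R * R -> Prop) (g' : R * R -> R * R),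
       isothermal_coordinates_centered_at U f p W' g' ->
       forall m' : nat, hopf_order f nu g' m' <-> m' = m) /\
    (isolated_umbilic U f nu p ->
       Nat.Even m /\
       ((exists D : R * R -> R * R -> Prop,
           curvature_line_flow U f nu p D /\
           (direction_field_index D p 1 \/ direction_field_index D p (-1)))
        <-> Nat.Even m /\ ~ Nat.divide 4 m)).
Proof.
  pose proof (surface_of_unit_normal U f nu (proj1 hU) hf hnu) as hS.
  destruct (isothermal_null_chart U f nu p W g hS hg) as (V & H & hG).
  destruct hQ_nondeg as [m hm].
  pose proof (proj1 (hopf_order_null U f nu p W g hS hg m) hm) as hm'.
  assert (hm1 : (1 <= m)%nat)
    by exact (null_order_pos U f nu p _ _ V H m hS hf_time_like hG hp_umbilic hm').
  exists m; split; [exact hm1 |]; split.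
  - intros W' g' hg' m'.
    destruct (isothermal_null_chart U f nu p W' g' hS hg') as (V' & H' & hG').
    assert (hmg' : null_order f nu (fun w => g' (null_plane w)) m)
      by exact (null_order_transfer U f nu p _ _ _ _ V V' H H' m hS hG hG' hm').
    rewrite (hopf_order_null U f nu p W' g' hS hg').
    split; [| now intros ->].
    intros h; exact (null_order_unique f nu _ m' m h hmg').
  - exact (isolated_umbilic_flow U f nu p _ _ V H m hS hf_time_like hG hm' hm1).
Qed.
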